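(* Let $\{K_\epsilon\}_{\epsilon>0}$ be a family of compact subsets of $\overline\Omega$ concentrating, as $\epsilon\to0$, to a compact set $K\subseteq\overline\Omega$ with $\mathrm{Cap}_{\bar\Omega}(K)=0$. Let $n_0\ge1$ be such that $\lambda_0:=\lambda_{n_0}$ is simple, let $\phi_0$ be a corresponding $L^2(\Omega)$-normalized eigenfunction, and let $\lambda_\epsilon:=\lambda_{n_0}(\Omega;K_\epsilon)$. Then $$\lambda_\epsilon-\lambda_0=\mathrm{Cap}_{\bar\Omega,c}(K_\epsilon,\phi_0)+o\big(\mathrm{Cap}_{\bar\Omega,c}(K_\epsilon,\phi_0)\big)\quad\text{as }\epsilon\to0.$$
   Context: Let $N\ge 2$ and let $\Omega\subseteq\mathbb{R}^N$ be an open, bounded, connected, Lipschitz set. Let $c\in L^\infty(\mathbb{R}^N)$ satisfy $c(x)\ge c_0>0$ for a.e. $x\in\mathbb{R}^N$, for some $c_0\in\mathbb{R}$, and let $q(u,v)=\int_\Omega(\nabla u\cdot\nabla v+cuv)\,dx$ for $u,v\in H^1(\Omega)$, $q(u):=q(u,u)$. For $K\subseteq\overline\Omega$ compact, $H^1_{0,K}(\Omega)$ denotes the closure in $H^1(\Omega)$ of $C_c^\infty(\overline\Omega\setminus K)$. A real $\lambda$ is an eigenvalue (of the restriction of $q$ to $H^1_{0,K}(\Omega)$), with eigenfunction $u$, if $u\in H^1_{0,K}(\Omega)$, $u\not\equiv0$, and $q(u,v)=\lambda\,(u,v)_{L^2(\Omega)}$ for all $v\in H^1_{0,K}(\Omega)$.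 The eigenvalues form a diverging nondecreasing sequence of positive numbers $(\lambda_n(\Omega;K))_{n\ge1}$, each repeated according to multiplicity. We write $\lambda_n:=\lambda_n(\Omega;\emptyset)$. Capacities: for $K\subseteq\overline\Omega$ compact and $f\in H^1(\Omega)$, $$\mathrm{Cap}_{\bar\Omega}(K):=\inf\Big\{\int_\Omega(|\nabla u|^2+u^2)\,dx:\ u\in H^1(\Omega),\ u-1\in H^1_{0,K}(\Omega)\Big\},$$ $$\mathrm{Cap}_{\bar\Omega,c}(K,f):=\inf\{q(u):\ u\in H^1(\Omega),\ u-f\in H^1_{0,K}(\Omega)\}.$$ A family $\{K_\epsilon\}_{\epsilon>0}$ of compact subsets of $\overline\Omega$ is concentrating at (to) a compact set $K\subseteq\overline\Omega$ as $\epsilon\to0$ if for every open set $U\subseteq\mathbb{R}^N$ with $K\subseteq U$ there is $\epsilon_U>0$ such that $K_\epsilon\subseteq U$ for all $\epsilon\in(0,\epsilon_U)$. *)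

(* Defs.v *)
From HB Require Import structures.
From mathcomp Require Import all_boot all_order all_algebra.
From mathcomp Require Import all_classical all_reals all_analysis.
Set Implicit Arguments.
Unset Strict Implicit.
Unset Printing Implicit Defensive.
Import Order.TTheory GRing.Theory Num.Theory.
Import numFieldNormedType.Exports.
Local Open Scope classical_set_scope.
Local Open Scope ring_scope.

Definition measure_rV_display : measure_display -> measure_display.
Proof. exact. Qed.

Section measurable_rV.
Context {d} {T : measurableType d} (n : nat).

Definition rV_coord (i : 'I_n) (x : 'rV[T]_n) : T := x ord0 i.

Let rV_set0 : g_sigma_preimage rV_coord set0.
Proof. exact: sigma_algebra0. Qed.

Let rV_setC A : g_sigma_preimage rV_coord A -> g_sigma_preimage rV_coord (~` A).
Proof. exact: sigma_algebraC. Qed.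

Let rV_bigcup (F : _^nat) : (forall i, g_sigma_preimage rV_coord (F i)) ->
  g_sigma_preimage rV_coord (\bigcup_i (F i)).
Proof. exact: sigma_algebra_bigcup. Qed.

HB.instance Definition _ := @isMeasurable.Build (measure_rV_display d)
  'rV[T]_n (g_sigma_preimage rV_coord) rV_set0 rV_setC rV_bigcup.

Lemma measurable_rV_coord (i : 'I_n) : measurable_fun setT (rV_coord i).
Proof.
move=> _ Y mY; rewrite setTI; apply: sub_sigma_algebra => /=.
rewrite -bigcup_seq/=; exists i => /=; first by rewrite mem_index_enum.
by exists Y => //; rewrite setTI.
Qed.

Lemma measurable_fun_rV d1 (T1 : measurableType d1) (f : T1 -> 'rV[T]_n) :
  (forall i, measurable_fun setT (fun x => f x ord0 i)) -> measurable_fun setT f.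
Proof.
move=> mf _ A mA; rewrite setTI.
suff : <<s \big[setU/set0]_(i < n)
    preimage_set_system setT (rV_coord i) measurable >>
    `<=` [set B | measurable (f @^-1` B)] by exact.
apply: smallest_sub.
  split => /=.
  - by rewrite preimage_set0.
  - by move=> B mB; rewrite setTD preimage_setC; exact: measurableC.
  - by move=> F mF; rewrite preimage_bigcup; exact: bigcup_measurable.
rewrite -bigcup_seq => B [i _ [C mC <-]] /=; rewrite setTI.
by rewrite -[X in measurable X]setTI; exact: mf.
Qed.

End measurable_rV.

Section lebesgue_rV.
Context {R : realType}.
Local Open Scope ereal_scope.

Definition rV_cons n (p : R * 'rV[R]_n) : 'rV[R]_n.+1 :=
  \row_j (if unlift ord0 j is Some k then p.2 ord0 k else p.1).

Definition rV_uncons n (x : 'rV[R]_n.+1) : R * 'rV[R]_n :=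
  (x ord0 ord0, \row_j x ord0 (lift ord0 j)).

Lemma rV_consK n : cancel (@rV_cons n) (@rV_uncons n).
Proof.
move=> [a y]; rewrite /rV_uncons /rV_cons !mxE unlift_none; congr pair.
by apply/rowP => j; rewrite !mxE liftK.
Qed.

Lemma measurable_rV_cons n : measurable_fun setT (@rV_cons n).
Proof.
apply: measurable_fun_rV => i; rewrite /rV_cons.
case: (unliftP ord0 i) => [k ->|->].
  under eq_fun do rewrite mxE liftK.
  exact: (measurableT_comp (measurable_rV_coord k) measurable_snd).
by under eq_fun do rewrite mxE unlift_none; exact: measurable_fst.
Qed.

Lemma measurable_rV_uncons n : measurable_fun setT (@rV_uncons n).
Proof.
apply/measurable_fun_pairP; split; first exact: (measurable_rV_coord ord0).
apply: measurable_fun_rV => i /=; under eq_fun do rewrite mxE.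
exact: (measurable_rV_coord (lift ord0 i)).
Qed.

Section step.
Variables (n : nat) (m : {sigma_finite_measure set 'rV[R]_n -> \bar R}).

Definition lebesgue_rV_step : set 'rV[R]_n.+1 -> \bar R :=
  pushforward (@lebesgue_measure R \x m) (@rV_cons n).


Let step0 : lebesgue_rV_step set0 = 0.
Proof. by rewrite /lebesgue_rV_step /pushforward preimage_set0 measure0. Qed.

Let step_ge0 A : 0 <= lebesgue_rV_step A.
Proof. by rewrite /lebesgue_rV_step /pushforward measure_ge0. Qed.

Let step_sigma_additive : semi_sigma_additive lebesgue_rV_step.
Proof.
have mf A : measurable A -> measurable (@rV_cons n @^-1` A).
  by move=> mA; rewrite -[X in measurable X]setTI; exact: measurable_rV_cons.
move=> F mF tF mUF; rewrite /lebesgue_rV_step /pushforward preimage_bigcup.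
apply: measure_semi_sigma_additive.
- by move=> k; exact: mf.
- apply/trivIsetP => /= i j _ _ ij; rewrite -preimage_setI.
  by move/trivIsetP : tF => /(_ _ _ _ _ ij) ->//; rewrite preimage_set0.
- by rewrite -preimage_bigcup; exact: mf.
Qed.

HB.instance Definition _ := isMeasure.Build _ _ _
  lebesgue_rV_step step0 step_ge0 step_sigma_additive.

Let step_sigma_finite : sigma_finite setT lebesgue_rV_step.
Proof.
have /sigma_finiteP[F [TF ndF Foo]] := sigma_finiteT (@lebesgue_measure R).
have /sigma_finiteP[G [TG ndG Goo]] := sigma_finiteT m.
exists (fun k => @rV_uncons n @^-1` (F k `*` G k)).
  rewrite -preimage_bigcup (_ : \bigcup_k _ = setT) ?preimage_setT//.
  apply/seteqP; split => // -[x y] _.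
  have [i _ Fx] : (\bigcup_k F k) x by rewrite -TF.
  have [j _ Gy] : (\bigcup_k G k) y by rewrite -TG.
  exists (maxn i j) => //; split => /=.
  - by move: x Fx; exact/subsetPset/ndF/leq_maxl.
  - by move: y Gy; exact/subsetPset/ndG/leq_maxr.
move=> k; have [mF Fk] := Foo k; have [mG Gk] := Goo k; split.
  by rewrite -[X in measurable X]setTI; apply: measurable_rV_uncons => //;
    exact: measurableX.
rewrite /lebesgue_rV_step /pushforward -comp_preimage.
rewrite (_ : @rV_uncons n \o @rV_cons n = id).
  by rewrite preimage_id product_measure1E// lte_mul_pinfty// ge0_fin_numE.
by apply/funext => p; exact: rV_consK.
Qed.

HB.instance Definition _ := Measure_isSigmaFinite.Build _ _ _
  lebesgue_rV_step step_sigma_finite.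

End step.

(* N-fold product of the Lebesgue measure; see lebesgue_rV_box. *)
Fixpoint lebesgue_rV n : {sigma_finite_measure set 'rV[R]_n -> \bar R} :=
  if n is k.+1 then lebesgue_rV_step (lebesgue_rV k)
  else \d_(0%R : 'rV[R]_0).

Lemma lebesgue_rV_box n (A : 'I_n -> set R) :
  (forall i, measurable (A i)) ->
  let box := [set x : 'rV[R]_n | forall i, A i (x ord0 i)] in
  measurable box /\ lebesgue_rV n box = \prod_(i < n) lebesgue_measure (A i).
Proof.
elim: n A => [|n IH] A mA /=.
  rewrite (_ : [set _ | _] = setT); last by apply/seteqP; split => // x _ [].
  by split => //; rewrite big_ord0 /= diracT.
have [mB leB] := IH (fun i => A (lift ord0 i)) (fun i => mA _).
set B := [set _ | _] in mB leB.
have -> : [set x : 'rV[R]_n.+1 | forall i, A i (x ord0 i)] =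
    @rV_uncons n @^-1` (A ord0 `*` B).
  apply/seteqP; split => x /=.
    by move=> Ax; split => //= i; rewrite mxE.
  by move=> [A0 Bx] i; case: (unliftP ord0 i) => [k ->|->//];
    have := Bx k; rewrite mxE.
split.
  by rewrite -[X in measurable X]setTI; apply: measurable_rV_uncons => //;
    exact: measurableX.
rewrite big_ord_recl -leB /lebesgue_rV_step /pushforward -comp_preimage.
rewrite (_ : @rV_uncons n \o @rV_cons n = id).
  rewrite preimage_id.
  apply: (product_measure1E (@lebesgue_measure R) (lebesgue_rV n)) => //.
  exact: mA.
by apply/funext => p; exact: rV_consK.
Qed.

End lebesgue_rV.

Section domains.
Context {R : realType} {N : nat}.
Implicit Types (Omega K : set 'rV[R]_N).

(* Near each boundary point and after an orthogonal change of coordinates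
   y |-> y *m Q, Omega is the strict epigraph of a Lipschitz function of the
   N - 1 coordinates other than the k-th. *)
Definition lipschitz_boundary Omega :=
  forall x, (closure Omega `\` Omega°) x ->
  exists (Q : 'M[R]_N) (k : 'I_N) (g : 'rV[R]_N.-1 -> R) (U : set 'rV[R]_N),
    [/\ Q *m Q^T = 1%:M, lipschitz g, nbhs x U &
      forall y, U y ->
        (Omega y <-> g (col' k (y *m Q)) < (y *m Q) ord0 k)].

Definition concentrating (K_ : R -> set 'rV[R]_N) K :=
  forall U, open U -> K `<=` U ->
    exists2 epsU : R, 0 < epsU & forall eps, 0 < eps < epsU -> K_ eps `<=` U.

End domains.

Section sobolev.
Context {R : realType} {N : nat}.
Local Notation mu := (@lebesgue_rV R N).
Implicit Types (Omega K : set 'rV[R]_N) (u v f phi : 'rV[R]_N -> R).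

Definition pderiv (i : 'I_N) f : 'rV[R]_N -> R :=
  fun x => 'D_(delta_mx ord0 i) f x.

Definition smooth f := forall s : seq 'I_N,
  continuous (foldr pderiv f s) /\
  forall (i : 'I_N) x, derivable (foldr pderiv f s) x (delta_mx ord0 i).

Definition supp f : set 'rV[R]_N := closure [set x | f x != 0].

Definition test_function (U : set 'rV[R]_N) phi :=
  [/\ smooth phi, compact (supp phi) & supp phi `<=` U].

(* Elements of function spaces on Omega are total functions on R^N whose values
   off Omega are irrelevant: u \_ Omega is u extended by 0 off Omega. *)
Definition L2 Omega u := u \_ Omega \in Lfun mu 2%:E.

Definition dotL2 Omega u v : R := \int[mu]_(x in Omega) (u x * v x).

Definition weak_partial Omega (i : 'I_N) u g :=
  forall phi, test_function Omega phi ->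
    dotL2 Omega u (pderiv i phi) = - dotL2 Omega g phi.

Definition H1 Omega u :=
  L2 Omega u /\ forall i, exists2 g, L2 Omega g & weak_partial Omega i u g.

(* The weak derivative is unique only up to a null set: xget fixes a
   representative, which exists as soon as u is in H1 Omega. *)
Definition wpd Omega (i : 'I_N) u : 'rV[R]_N -> R :=
  xget (cst 0) [set g | L2 Omega g /\ weak_partial Omega i u g].

Definition dotgrad Omega u v : 'rV[R]_N -> R :=
  fun x => \sum_(i < N) wpd Omega i u x * wpd Omega i v x.

Definition sqnormH1 Omega u : R :=
  \int[mu]_(x in Omega) (dotgrad Omega u u x + u x ^+ 2).

(* Elements of C_c^oo of (closure Omega) \ K are the restrictions to
   closure Omega of smooth functions on R^N with compact support disjoint
   from K. *)
Definition H10 Omega K u :=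
  H1 Omega u /\
  forall e : R, 0 < e ->
    exists2 phi, test_function (~` K) phi &
      Num.sqrt (sqnormH1 Omega (u \- phi)) < e.

Definition Cap Omega K : R :=
  inf [set sqnormH1 Omega u | u in
        [set u | H1 Omega u /\ H10 Omega K (u \- cst 1)]].

Section potential.
Variable c : 'rV[R]_N -> R.

Definition q Omega u v : R :=
  \int[mu]_(x in Omega) (dotgrad Omega u v x + c x * u x * v x).

Definition Capc Omega K f : R :=
  inf [set q Omega u u | u in
        [set u | H1 Omega u /\ H10 Omega K (u \- f)]].

Definition eigenspace Omega K (l : R) : set ('rV[R]_N -> R) :=
  [set u | H10 Omega K u /\
    forall v, H10 Omega K v -> q Omega u v = l * dotL2 Omega u v].

Definition eigenfunction Omega K (l : R) u :=
  eigenspace Omega K l u /\ ~ ae_eq mu Omega u (cst 0).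

(* V has dimension m as a space of functions modulo equality a.e. on Omega. *)
Definition has_dim Omega (V : set ('rV[R]_N -> R)) (m : nat) :=
  exists e : 'I_m -> 'rV[R]_N -> R,
    [/\ forall i, V (e i),
      forall a : 'I_m -> R,
        ae_eq mu Omega (fun x => \sum_(i < m) a i * e i x) (cst 0) ->
        forall i, a i = 0 &
      forall u, V u -> exists a : 'I_m -> R,
        ae_eq mu Omega u (fun x => \sum_(i < m) a i * e i x)].

Definition has_multiplicity Omega K (l : R) (m : nat) :=
  has_dim Omega (eigenspace Omega K l) m.

Definition simple_eigenvalue Omega K (l : R) := has_multiplicity Omega K l 1.

(* lam lists the eigenvalues in nondecreasing order, each repeated according
   to multiplicity; a real l that is not an eigenvalue has multiplicity 0 and
   so does not occur. *)
Definition eigenvalue_sequence Omega K (lam : nat -> R) :=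
  [/\ forall n, 0 < lam n,
    nondecreasing_seq lam,
    lam n @[n --> \oo] --> +oo &
    forall l : R, exists2 m : nat, has_multiplicity Omega K l m &
      ([set n | lam n = l] #= `I_m)%card].

(* The n-th eigenvalue, counted from n = 1. *)
Definition lambda Omega K (n : nat) : R :=
  xget (cst 0) (eigenvalue_sequence Omega K) n.-1.

End potential.
End sobolev.

(* Main.v *)
Require Import Defs.
From HB Require Import structures.
From mathcomp Require Import finmap.
From mathcomp Require Import all_boot all_order all_algebra.
From mathcomp Require Import all_classical all_reals all_analysis.
From mathcomp Require Import measurable_realfun ess_sup_inf.
From mathcomp Require Import ring lra.
Set Implicit Arguments.
Unset Strict Implicit.
Unset Printing Implicit Defensive.
Import Order.TTheory GRing.Theory Num.Theory.
Import numFieldNormedType.Exports.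
Local Open Scope classical_set_scope.
Local Open Scope ring_scope.

(** Let [V] be the energy space, with the energy form [q] and the scalar
    product [b] of square integrable functions, and let [S] be the closed
    subspace of the functions that vanish near the compact set [K_ eps]. Let
    [p] be the [q]-orthogonal projection of the eigenfunction [phi] to [S], and
    [U = phi - p]. The capacity of [K_ eps] relative to [phi] is [q U U], since
    [U] is the competitor of least energy ([Capc_projection]). If [u] is the
    normalized eigenvector of [S] for the perturbed eigenvalue [lam], then
    testing the equation of [phi] with [u], and that of [u] with [p], gives
      [(lam - l) * b phi u = lam * b U u].
    Now [l * b U phi = q U U], and [u] is nearly proportional to [phi]: the
    component of [p] orthogonal to [u] is bounded by [b U U] through the
    spectral gap at [lam] ([gap_estimate]). Hence [lam - l] equals [q U U] up to
    a factor close to 1 and an error of the order of [b U U], and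
    [b U U = o(q U U)] because [U] is
    [q]-orthogonal to [S], which exhausts [V] as [eps] tends to 0, while [b] is
    compact relative to [q]. This is [eigenvalue_expansion], a statement about
    two forms on a vector space.

    It rests on three facts about the domain. First, [S] exhausts [V] in the
    sense that each vector of [V] is a limit of vectors of [S]
    ([vanishing_dense]): a set [K] of null capacity is avoided by functions
    arbitrarily close to 1, which serve as cutoffs, and [K_ eps] concentrates
    at [K]. Secondly, [b] is compact relative to [q]
    ([qform_relatively_compact]). This is Rellich's theorem, proved here from
    Poincare's inequality on small cubes inside the domain, and from an
    estimate on thin layers along the boundary, where the Lipschitz condition
    provides a direction that points into the domain ([boundary_layer],
    [rellich_smooth]). Compactness is used in the form of an inequality with
    finitely many functionals ([relatively_compact]), so weak convergence does
    not enter. Thirdly, the spaces are complete ([vanishing_complete]).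

    Compactness and completeness also produce the spectrum: eigenvectors are
    obtained one after the other by minimizing the Rayleigh quotient
    ([rayleigh_attained], [eigenbasis_exists]), and the resulting list is the
    sequence of eigenvalues with multiplicities, because the multiplicities
    determine a nondecreasing sequence ([lambda_eigenbasis]). *)

(** * Quadratic forms and orthogonal projections *)

Lemma inv_nat_lt (R : archiRealFieldType) (e : R) : 0 < e ->
  exists n0 : nat, forall n, (n0 <= n)%N -> n.+1%:R^-1 < e.
Proof.
move=> e0; exists (Num.bound e^-1) => n hn; rewrite invf_plt ?posrE//.
apply: lt_le_trans (archi_boundP _) _; first by rewrite invr_ge0 ltW.
by rewrite ler_nat (leq_trans hn).
Qed.

(** A nonnegative quadratic polynomial has a nonpositive discriminant. The
    degenerate case [A = 0] is what makes Cauchy-Schwarz available for forms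
    that are only semidefinite. *)
Lemma discr_le (R : realFieldType) (A B C : R) : 0 <= A ->
  (forall s, 0 <= A * s ^+ 2 - 2 * B * s + C) -> B ^+ 2 <= A * C.
Proof.
move=> A0 h; have [A0'|An0] := eqVneq A 0.
  rewrite A0' mul0r; have [->|Bn0] := eqVneq B 0; first by rewrite expr0n.
  have := h ((C + 1) / (2 * B)); rewrite A0' mul0r.
  have -> : 2 * B * ((C + 1) / (2 * B)) = C + 1 by field.
  lra.
have Ap : 0 < A by rewrite lt_neqAle eq_sym An0.
have := h (B / A).
have -> : A * (B / A) ^+ 2 - 2 * B * (B / A) + C = (A * C - B ^+ 2) / A by field.
by rewrite pmulr_lge0 ?invr_gt0// subr_ge0.
Qed.

Section bilinear_forms.
Context {R : realType} {V : lmodType R}.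
Implicit Types (a b q : V -> V -> R) (S T X : set V) (u v w : V).

(** Functions will stand for their classes modulo equality almost everywhere, so
    the forms below are only semidefinite and limits are only unique up to null
    vectors; this replaces the passage to a quotient space. *)
Definition sbilin a :=
  (forall u v, a u v = a v u) /\
  (forall k u v w, a (k *: u + v) w = k * a u w + a v w).

Definition nonneg_on X a := forall u, X u -> 0 <= a u u.

Definition subspace S := S 0 /\ forall k u v, S u -> S v -> S (k *: u + v).

Definition cauchy_for a (u : nat -> V) := forall e : R, 0 < e ->
  exists n0 : nat, forall m n, (n0 <= m)%N -> (n0 <= n)%N ->
    a (u m - u n) (u m - u n) < e.

Definition cvg_for a (u : nat -> V) l := forall e : R, 0 < e ->
  exists n0 : nat, forall n, (n0 <= n)%N -> a (u n - l) (u n - l) < e.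

Definition complete_for a S := forall u : nat -> V,
  (forall n, S (u n)) -> cauchy_for a u -> exists2 l, S l & cvg_for a u l.

Section bilin_theory.
Variable a : V -> V -> R.
Hypothesis Ha : sbilin a.

Lemma sbilinC u v : a u v = a v u. Proof. by case: Ha. Qed.

Lemma sbilin0l w : a 0 w = 0.
Proof.
case: Ha => _ /(_ 1 0 0 w); rewrite scaler0 add0r mul1r => h.
by apply: (addrI (a 0 w)); rewrite addr0 -h.
Qed.
Lemma sbilinDl u v w : a (u + v) w = a u w + a v w.
Proof. by case: Ha => _ /(_ 1 u v w); rewrite scale1r mul1r. Qed.
Lemma sbilinDr u v w : a w (u + v) = a w u + a w v.
Proof. by rewrite sbilinC sbilinDl !(sbilinC _ w). Qed.

Lemma sbilinZl k u w : a (k *: u) w = k * a u w.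
Proof. by case: Ha => _ /(_ k u 0 w); rewrite addr0 sbilin0l addr0. Qed.
Lemma sbilinZr k u w : a w (k *: u) = k * a w u.
Proof. by rewrite sbilinC sbilinZl sbilinC. Qed.

Lemma sbilinNl u w : a (- u) w = - a u w.
Proof. by rewrite -scaleN1r sbilinZl mulN1r. Qed.
Lemma sbilinNr u w : a w (- u) = - a w u.
Proof. by rewrite sbilinC sbilinNl sbilinC. Qed.

Lemma sbilinBl u v w : a (u - v) w = a u w - a v w.
Proof. by rewrite sbilinDl sbilinNl. Qed.
Lemma sbilinBr u v w : a w (u - v) = a w u - a w v.
Proof. by rewrite sbilinDr sbilinNr. Qed.

Lemma sbilin_suml (I : Type) (r : seq I) (P : pred I) (F : I -> V) w :
  a (\sum_(i <- r | P i) F i) w = \sum_(i <- r | P i) a (F i) w.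
Proof.
elim/big_rec2: _ => [|i y1 y2 _ <-]; first exact: sbilin0l.
exact: sbilinDl.
Qed.
Lemma sbilin_sumr (I : Type) (r : seq I) (P : pred I) (F : I -> V) w :
  a w (\sum_(i <- r | P i) F i) = \sum_(i <- r | P i) a w (F i).
Proof. by rewrite sbilinC sbilin_suml; apply: eq_bigr => i _; rewrite sbilinC. Qed.

Definition sbilinE := (sbilinDl, sbilinDr, sbilinNl, sbilinNr, sbilinZl, sbilinZr).

Lemma sbilin_sqD u v : a (u + v) (u + v) = a u u + 2 * a u v + a v v.
Proof. by rewrite !sbilinE (sbilinC v u); ring. Qed.
Lemma sbilin_sqB u v : a (u - v) (u - v) = a u u - 2 * a u v + a v v.
Proof. by rewrite !sbilinE (sbilinC v u); ring. Qed.
Lemma sbilin_DB u v : a (u + v) (v - u) = a v v - a u u.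
Proof. by rewrite !sbilinE (sbilinC v u); ring. Qed.
Lemma sbilin_sqZ k u : a (k *: u) (k *: u) = k ^+ 2 * a u u.
Proof. by rewrite !sbilinE mulrA. Qed.

End bilin_theory.

Lemma subspace0 S : subspace S -> S 0. Proof. by case. Qed.
Lemma subspaceD S u v : subspace S -> S u -> S v -> S (u + v).
Proof. by case=> _ h Su Sv; rewrite -[u]scale1r; exact: h. Qed.
Lemma subspaceZ S k u : subspace S -> S u -> S (k *: u).
Proof. by case=> S0 h Su; rewrite -[_ *: _]addr0; exact: h. Qed.
Lemma subspaceN S u : subspace S -> S u -> S (- u).
Proof. by move=> sS Su; rewrite -scaleN1r; exact: subspaceZ. Qed.
Lemma subspaceB S u v : subspace S -> S u -> S v -> S (u - v).
Proof. by move=> sS Su Sv; apply: subspaceD => //; exact: subspaceN. Qed.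
Lemma subspace_sum S (I : Type) (r : seq I) (P : pred I) (F : I -> V) :
  subspace S -> (forall i, P i -> S (F i)) -> S (\sum_(i <- r | P i) F i).
Proof.
move=> sS SF; elim/big_rec: _ => [|i x Pi Sx]; first exact: subspace0.
by apply: subspaceD => //; exact: SF.
Qed.

Lemma subspaceT : subspace setT. Proof. by split. Qed.

Section nonneg_theory.
Variables (X : set V) (a : V -> V -> R).
Hypotheses (sX : subspace X) (Ha : sbilin a) (a0 : nonneg_on X a).

Lemma cauchy_schwarz u v : X u -> X v -> a u v ^+ 2 <= a u u * a v v.
Proof.
move=> Xu Xv; apply: discr_le => [|s]; first exact: a0.
have := a0 (subspaceB sX (subspaceZ s sX Xu) Xv).
by rewrite (sbilin_sqB Ha) (sbilin_sqZ Ha) (sbilinZl Ha); lra.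
Qed.

Lemma sqD_le u v : X u -> X v -> a (u + v) (u + v) <= 2 * a u u + 2 * a v v.
Proof.
move=> Xu Xv; have := a0 (subspaceB sX Xu Xv).
by rewrite (sbilin_sqB Ha) (sbilin_sqD Ha); lra.
Qed.

Lemma sqB_le u v : X u -> X v -> a (u - v) (u - v) <= 2 * a u u + 2 * a v v.
Proof.
move=> Xu Xv; have := a0 (subspaceD sX Xu Xv).
by rewrite (sbilin_sqB Ha) (sbilin_sqD Ha); lra.
Qed.

Lemma null_orthogonal u v : X u -> X v -> a u u = 0 -> a u v = 0.
Proof.
move=> Xu Xv au0; have := cauchy_schwarz Xu Xv; rewrite au0 mul0r => h.
by apply/eqP; rewrite -sqrf_eq0 eq_le h sqr_ge0.
Qed.

(** Riesz's argument: near-minimisers of the distance to [T] form a Cauchy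
    sequence by the parallelogram identity, and are nearly orthogonal to [T]. *)
Lemma orthogonal_projection T f : subspace T -> T `<=` X -> complete_for a T ->
  X f -> exists2 p, T p & forall t, T t -> a (f - p) t = 0.
Proof.
move=> sT TX cT Xf.
pose D := [set a (f - t) (f - t) | t in T].
have D0 : has_inf D.
  split; first by exists (a (f - 0) (f - 0)); exists 0 => //; exact: subspace0.
  exists 0 => _ [t Tt <-]; apply: a0; apply: subspaceB => //; exact: TX.
pose d := inf D.
have dle t : T t -> d <= a (f - t) (f - t).
  by move=> Tt; apply: ge_inf; [case: D0|exists t].
have /choice[t_ Ht] : forall n : nat, exists t, T t /\ a (f - t) (f - t) < d + n.+1%:R^-1.
  move=> n; have n0 : (0 : R) < n.+1%:R^-1 by rewrite invr_gt0 ltr0n.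
  by have [_ [t Tt <-] h] := inf_adherent n0 D0; exists t.
have Tt n : T (t_ n) by case: (Ht n).
have Xt n : X (f - t_ n) by apply: subspaceB => //; exact: TX.
have Ct : cauchy_for a t_.
  move=> e e0; have [n0 hn0] := inv_nat_lt (divr_gt0 e0 (ltr0n R 4)).
  exists n0 => m n hm hn.
  have Th : T (2^-1 *: (t_ m + t_ n)) by apply: subspaceZ => //; exact: subspaceD.
  have h1 := dle _ Th.
  have h2 := (Ht m).2; have h3 := (Ht n).2.
  have h4 := hn0 _ hm; have h5 := hn0 _ hn.
  move: h1 h2 h3; rewrite !(sbilin_sqB Ha) (sbilin_sqZ Ha) (sbilin_sqD Ha).
  rewrite (sbilinZr Ha) (sbilinDr Ha) => h1 h2 h3.
  move: (m.+1%:R^-1) (n.+1%:R^-1) h4 h5 h1 h2 h3 => i j h4 h5 h1 h2 h3; lra.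
have [p Tp cp] := cT _ Tt Ct.
exists p => // t Tt'.
have Xt' := TX _ Tt'.
have Xp := TX _ Tp.
have nearly n : a (f - t_ n) t ^+ 2 <= a t t * n.+1%:R^-1.
  apply: discr_le => [|s]; first exact: a0.
  have := dle (t_ n + s *: t) (subspaceD sT (Tt n) (subspaceZ s sT Tt')).
  have := (Ht n).2; rewrite opprD addrA (sbilin_sqB Ha _ (s *: t)).
  by rewrite (sbilin_sqZ Ha) (sbilinZr Ha); move: (n.+1%:R^-1) => i; lra.
apply/eqP; rewrite -sqrf_eq0 eq_le sqr_ge0 andbT; apply/ler_addgt0Pr => e e0.
rewrite add0r.
have tt := a0 Xt'.
pose e' := e / (4 * (a t t + 1)).
have e'0 : 0 < e' by rewrite divr_gt0//; lra.
have [n1 h1] := inv_nat_lt e'0; have [n2 h2] := cp _ e'0.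
pose n := maxn n1 n2.
have {}h1 := h1 n (leq_maxl _ _); have {}h2 := h2 n (leq_maxr _ _).
have h3 := nearly n.
have h4 := cauchy_schwarz (subspaceB sX (TX _ (Tt n)) Xp) Xt'.
have E : a (f - p) t = a (f - t_ n) t + a (t_ n - p) t.
  by rewrite -(sbilinDl Ha) addrA subrK.
have e'E : e' * (4 * (a t t + 1)) = e by rewrite divfK//; apply: lt0r_neq0; lra.
have h5 : a t t * n.+1%:R^-1 <= (a t t + 1) * e'.
  by apply: ler_pM => //; [lra|apply: ltW].
have h6 : a (t_ n - p) (t_ n - p) * a t t <= e' * (a t t + 1).
  by apply: ler_pM => //; [apply: a0; apply: subspaceB => //; exact: TX|apply: ltW|lra].
rewrite E; have := sqr_ge0 (a (f - t_ n) t - a (t_ n - p) t).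
rewrite sqrrB sqrrD; move: (n.+1%:R^-1) h1 h3 h4 h5 h6 e'E => i; set x := a (f - t_ n) t; set y := a (t_ n - p) t.
by rewrite -[_ *+ 2]mulr_natl => *; lra.
Qed.

End nonneg_theory.
End bilinear_forms.

(** * Construction of the spectrum *)

Lemma left_kernel_neq0 (F : fieldType) (m n : nat) (A : 'M[F]_(m, n)) :
  (n < m)%N -> exists2 x : 'rV[F]_m, x != 0 & x *m A = 0.
Proof.
move=> nm; have : kermx A != 0.
  by rewrite -mxrank_eq0 mxrank_ker -lt0n subn_gt0 (leq_ltn_trans (rank_leq_col A)).
by case/rowV0Pn => x /sub_kermxP xA x0; exists x.
Qed.

Section spectral.
Context {R : realType} {V : lmodType R}.
Implicit Types (a S T X : set V) (u v w : V).

Section closed_subspaces.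
Variables (X : set V) (q : V -> V -> R).
Hypotheses (sX : subspace X) (Hq : sbilin q) (q0 : nonneg_on X q).
Hypothesis cX : complete_for q X.

(** The functional [a _ w] is [q]-continuous because [q] dominates [a]. *)
Lemma complete_orthogonal (a : V -> V -> R) (C : R) w : sbilin a -> nonneg_on setT a ->
  (forall v, X v -> a v v <= C * q v v) ->
  subspace [set v | X v /\ a v w = 0] /\
  complete_for q [set v | X v /\ a v w = 0].
Proof.
move=> Ha a0 aq; split.
  split; first by split; [exact: subspace0|rewrite (sbilin0l Ha)].
  move=> k u v [Xu u0] [Xv v0]; split; first by case: sX => _; exact.
  by rewrite !(sbilinE Ha) u0 v0 mulr0 addr0.
move=> u Tu Cu; have [l Xl ul] := cX (fun n => (Tu n).1) Cu.
exists l => //; split => //.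
apply/eqP; rewrite -sqrf_eq0 eq_le sqr_ge0 andbT; apply/ler_addgt0Pr => e e0.
rewrite add0r; have ww := a0 w I.
pose e' := e / ((`|C| + 1) * (a w w + 1)).
have C1 : 0 < `|C| + 1 by rewrite ltr_wpDl.
have w1 : 0 < a w w + 1 by rewrite ltr_wpDl.
have e'0 : 0 < e' by rewrite divr_gt0// mulr_gt0.
have [n /(_ n (leqnn _)) h] := ul _ e'0.
have -> : a l w = - a (u n - l) w by rewrite (sbilinBl Ha) (Tu n).2 sub0r opprK.
rewrite sqrrN; apply: le_trans (cauchy_schwarz subspaceT Ha a0 I I) _.
have Xul : X (u n - l) by apply: subspaceB => //; exact: (Tu n).1.
have -> : e = ((`|C| + 1) * e') * (a w w + 1).
  by rewrite /e' mulrAC mulrCA divff ?mulr1// mulf_neq0 ?gt_eqF.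
apply: ler_pM => //; [exact: a0| |by rewrite lerDl].
apply: le_trans (aq _ Xul) _; apply: le_trans (ler_norm _) _; rewrite normrM.
rewrite (ger0_norm (q0 _))//; apply: ler_pM; rewrite ?lerDl// ?q0//.
exact: ltW.
Qed.

Lemma complete_equivalent (a : V -> V -> R) (d : R) : 0 < d ->
  (forall v, X v -> d * q v v <= a v v) -> (forall v, X v -> a v v <= q v v) ->
  complete_for a X.
Proof.
move=> d0 qa aq u Xu Cu.
have [|l Xl ul] := cX Xu.
  move=> e e0; have [n0 h] := Cu _ (mulr_gt0 d0 e0); exists n0 => m n hm hn.
  rewrite -(ltr_pM2l d0); apply: le_lt_trans (qa _ _) (h _ _ hm hn).
  exact: subspaceB.
exists l => // e e0; have [n0 h] := ul _ e0; exists n0 => n hn.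
by apply: le_lt_trans (aq _ _) (h _ hn); exact: subspaceB.
Qed.

End closed_subspaces.

Variables (q b : V -> V -> R) (c0 : R).
Hypotheses (Hq : sbilin q) (Hb : sbilin b).
Hypotheses (q0 : nonneg_on setT q) (b0 : nonneg_on setT b).
Hypotheses (c0p : 0 < c0) (bq : forall v, c0 * b v v <= q v v).

Let q0' X : nonneg_on X q. Proof. by move=> u _; exact: q0. Qed.
Let b0' X : nonneg_on X b. Proof. by move=> u _; exact: b0. Qed.

Lemma dominated v : b v v <= c0^-1 * q v v.
Proof. by rewrite mulrC ler_pdivlMr// mulrC. Qed.

Definition shifted (lam : R) u v := q u v - lam * b u v.

Lemma sbilin_shifted lam : sbilin (shifted lam).
Proof.
split=> [u v|k u v w]; first by rewrite /shifted (sbilinC Hq) (sbilinC Hb).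
by rewrite /shifted !(sbilinE Hq) !(sbilinE Hb); ring.
Qed.

Definition coercive_on X lam :=
  exists2 d : R, 0 < d & forall v, X v -> d * q v v <= shifted lam v v.

Definition has_null X lam := exists z, [/\ X z, 0 < q z z & shifted lam z z = 0].

(** Adding one dimension to a space where [q - lam b] is coercive: the
    [q - lam b]-orthogonal complement is a line, and the form is either zero
    or positive on it. *)
Lemma coercive_step X w lam : subspace X -> complete_for q X -> 0 <= lam ->
  nonneg_on X (shifted lam) ->
  coercive_on [set v | X v /\ q v w = 0] lam ->
  has_null X lam \/ coercive_on X lam.
Proof.
move=> sX cX lam0 a0 [d d0 hd].
set T := [set v | X v /\ q v w = 0].
have [[f [Xf fw]]|noX] := pselect (exists f, X f /\ q f w = 1); last first.
  right; exists d => // v Xv; apply: hd; split => //.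
  apply/eqP/negP => /negP qvw; apply: noX; exists ((q v w)^-1 *: v); split.
    exact: subspaceZ.
  by rewrite (sbilinZl Hq) mulVf.
have [sT cT] : subspace T /\ complete_for q T.
  have h v : X v -> q v v <= 1 * q v v by rewrite mul1r.
  exact: (complete_orthogonal sX (@q0' _) cX w Hq q0 h).
have TX : T `<=` X by move=> v [].
have caT : complete_for (shifted lam) T.
  apply: (complete_equivalent sT cT d0 hd) => v Tv.
  by rewrite /shifted lerBlDr lerDl mulr_ge0// b0.
have Ha := sbilin_shifted lam.
have [p Tp hp] := orthogonal_projection sX Ha a0 sT TX caT Xf.
set g := f - p in hp.
have Xg : X g by apply: subspaceB => //; exact: TX.
have gw : q g w = 1 by rewrite (sbilinBl Hq) fw Tp.2 subr0.
have Qg : 0 < q g g.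
  rewrite lt_neqAle q0// andbT eq_sym; apply/eqP => qg.
  have := null_orthogonal subspaceT Hq q0 (I : setT g) (I : setT w) qg.
  by rewrite gw => /eqP; rewrite oner_eq0.
have [ag|ag] := eqVneq (shifted lam g g) 0; first by left; exists g.
have {}ag : 0 < shifted lam g g by rewrite lt_neqAle eq_sym ag a0.
right; pose A := shifted lam g g / (2 * q g g).
have A0 : 0 < A by rewrite divr_gt0// mulr_gt0.
pose d' := Num.min A (d / 2).
have d'0 : 0 < d' by rewrite lt_min A0 divr_gt0.
exists d' => // v Xv.
pose s := q v w; pose t := v - s *: g.
have Tt : T t.
  split; first by apply: subspaceB => //; exact: subspaceZ.
  by rewrite (sbilinBl Hq) (sbilinZl Hq) gw mulr1 subrr.
have -> : v = s *: g + t by rewrite /t addrC subrK.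
rewrite (sbilin_sqD Ha) (sbilin_sqZ Ha) (sbilinZl Ha) (hp _ Tt) !mulr0 addr0.
have h1 : q (s *: g + t) (s *: g + t) <= 2 * (s ^+ 2 * q g g) + 2 * q t t.
  by rewrite -(sbilin_sqZ Hq); exact: (sqD_le subspaceT Hq q0).
have h2 := hd _ Tt.
have h3 : d' * (2 * (s ^+ 2 * q g g)) <= s ^+ 2 * shifted lam g g.
  have -> : s ^+ 2 * shifted lam g g = A * (2 * (s ^+ 2 * q g g)).
    by rewrite /A; field; rewrite gt_eqF.
  rewrite ler_wpM2r ?ge_min ?lexx//; apply: mulr_ge0 => //.
  by apply: mulr_ge0; rewrite ?sqr_ge0 ?q0.
have h4 : d' * (2 * q t t) <= d * q t t.
  have -> : d * q t t = (d / 2) * (2 * q t t) by field.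
  by rewrite ler_wpM2r ?ge_min ?lexx ?orbT//; apply: mulr_ge0; rewrite ?q0.
apply: le_trans (ler_wpM2l (ltW d'0) h1) _; rewrite mulrDr.
by apply: lerD => //; exact: le_trans h4 h2.
Qed.

(** The constraints are lifted one at a time, and either some stage produces a
    null vector or coercivity survives on the whole space. *)
Lemma coercive_extend (s : seq V) X lam : subspace X -> complete_for q X -> 0 <= lam ->
  nonneg_on X (shifted lam) ->
  coercive_on [set v | X v /\ forall w, w \in s -> q v w = 0] lam ->
  has_null X lam \/ coercive_on X lam.
Proof.
elim: s X => [|w s IH] X sX cX lam0 a0 [d d0 hd].
  by right; exists d => // v Xv; apply: hd.
have [sT cT] : subspace [set v | X v /\ q v w = 0] /\
    complete_for q [set v | X v /\ q v w = 0].
  have h v : X v -> q v v <= 1 * q v v by rewrite mul1r.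
  exact: (complete_orthogonal sX (@q0' _) cX w Hq q0 h).
have [||[z [[Xz _] qz az]]|cvx] := IH _ sT cT lam0.
- by move=> v [Xv _]; exact: a0.
- exists d => // v [[Xv vw] vs]; apply: hd; split => // x.
  by rewrite inE => /predU1P[->//|]; exact: vs.
- by left; exists z.
- exact: coercive_step cvx.
Qed.

(** Compactness of the embedding of the [q]-space into the [b]-space, in a form
    without weak limits: up to an arbitrarily small multiple of [q], the form
    [b] is controlled by finitely many bounded functionals. *)
Definition relatively_compact := forall eta : R, 0 < eta ->
  exists s : seq V, forall v, b v v <= eta * q v v + \sum_(w <- s) q v w ^+ 2.

Hypothesis bcomp : relatively_compact.

(** Let [lam] be the infimum of the Rayleigh quotient. By compactness the form
    [q - lam b] is coercive where finitely many functionals vanish. If it were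
    coercive on the whole space then [lam] could be increased; so it has a null
    vector, and a null vector of a nonnegative form is orthogonal to everything. *)
Lemma rayleigh_attained X : subspace X -> complete_for q X ->
  (exists2 v, X v & 0 < b v v) ->
  exists e, [/\ X e, b e e = 1, (forall v, X v -> q e v = q e e * b e v) &
    forall v, X v -> q e e * b v v <= q v v].
Proof.
move=> sX cX [v0 Xv0 bv0].
pose D := [set q v v | v in [set v | X v /\ b v v = 1]].
have unit v : X v -> 0 < b v v ->
    [/\ X ((Num.sqrt (b v v))^-1 *: v),
     b ((Num.sqrt (b v v))^-1 *: v) ((Num.sqrt (b v v))^-1 *: v) = 1 &
     q ((Num.sqrt (b v v))^-1 *: v) ((Num.sqrt (b v v))^-1 *: v) = (b v v)^-1 * q v v].
  move=> Xv bv; have E : ((Num.sqrt (b v v))^-1) ^+ 2 = (b v v)^-1.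
    by rewrite exprVn sqr_sqrtr// ltW.
  split; [exact: subspaceZ| |]; rewrite ?(sbilin_sqZ Hb) ?(sbilin_sqZ Hq) E//.
  by rewrite mulVf// gt_eqF.
have Dinf : has_inf D.
  have [Xu bu _] := unit _ Xv0 bv0.
  split; first by eexists; exists ((Num.sqrt (b v0 v0))^-1 *: v0).
  by exists 0 => _ [v _ <-]; exact: q0.
pose lam := inf D.
have lamc : c0 <= lam.
  apply: lb_le_inf; first by case: Dinf.
  by move=> _ [v [_ bv] <-]; have := bq v; rewrite bv mulr1.
have lam0 : 0 < lam by exact: lt_le_trans lamc.
have lamle v : X v -> lam * b v v <= q v v.
  move=> Xv; have [bv|bv] := eqVneq (b v v) 0; first by rewrite bv mulr0 q0.
  have {}bv : 0 < b v v by rewrite lt_neqAle eq_sym bv b0.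
  have [Xu bu qu] := unit _ Xv bv.
  rewrite -ler_pdivlMr// mulrC -qu; apply: ge_inf; first by case: Dinf.
  by eexists; first split; [exact: Xu|exact: bu|].
have a0 : nonneg_on X (shifted lam) by move=> v Xv; rewrite /shifted subr_ge0 lamle.
have eta0 : 0 < (2 * lam)^-1 by rewrite invr_gt0 mulr_gt0.
have [s hs] := bcomp eta0.
have [|[z [Xz qz az]]|[d d0 hd]] := @coercive_extend s X lam sX cX (ltW lam0) a0.
- exists 2^-1 => [|v [Xv vs]]; first by rewrite invr_gt0.
  have := hs v; rewrite big1_seq ?addr0; last by move=> w /vs ->; rewrite expr0n.
  move=> h; have {}h : lam * b v v <= 2^-1 * q v v.
    apply: le_trans (ler_wpM2l (ltW lam0) h) _.
    by rewrite mulrA invfM mulrCA divff ?mulr1// gt_eqF.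
  by rewrite /shifted; lra.
- have bz : 0 < b z z.
    rewrite lt_neqAle b0// andbT eq_sym; apply/eqP => bz; move: az qz.
    by rewrite /shifted bz mulr0 subr0 => ->; rewrite ltxx.
  have [Xe be qe] := unit _ Xz bz.
  set e := _ *: z in Xe be qe.
  have qe' : q e e = lam.
    rewrite qe; move/eqP: az; rewrite subr_eq0 => /eqP ->.
    by rewrite mulrCA mulVf ?mulr1// gt_eqF.
  exists e; split => // v Xv; rewrite qe'; last exact: lamle.
  apply/eqP; rewrite -subr_eq0; apply/eqP.
  apply: (null_orthogonal sX (sbilin_shifted lam) a0 Xe Xv).
  by rewrite /shifted be qe' mulr1 subrr.
- have [_ [v [Xv bv] <-] hv] := inf_adherent (mulr_gt0 d0 lam0) Dinf.
  have := hd _ Xv; rewrite /shifted bv mulr1 => h.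
  have := lamle _ Xv; rewrite bv mulr1 => h'.
  have : d * lam <= d * q v v by rewrite ler_pM2l.
  by move: hv; rewrite -/lam; lra.
Qed.

Definition infinite_dimensional S := forall n, exists f : 'I_n -> V,
  (forall i, S (f i)) /\ forall i j, b (f i) (f j) = (i == j)%:R.

Lemma orthonormal_sq n (f : 'I_n -> V) (x : 'I_n -> R) :
  (forall i j, b (f i) (f j) = (i == j)%:R) ->
  b (\sum_i x i *: f i) (\sum_i x i *: f i) = \sum_i x i ^+ 2.
Proof.
move=> bf; rewrite (sbilin_suml Hb); apply: eq_bigr => i _.
rewrite (sbilinZl Hb) (sbilin_sumr Hb) (bigD1 i)//= big1 => [|j ji].
  by rewrite (sbilinZr Hb) bf eqxx mulr1 addr0 expr2.
by rewrite (sbilinZr Hb) bf eq_sym (negPf ji) mulr0.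
Qed.

Lemma sumsq_gt0 n (x : 'rV[R]_n) : x != 0 -> 0 < \sum_i x ord0 i ^+ 2.
Proof.
move=> x0; rewrite lt_neqAle eq_sym sumr_ge0 ?andbT; last by move=> i _; exact: sqr_ge0.
apply: contra x0 => /eqP h; apply/eqP/rowP => i; rewrite mxE.
apply/eqP; rewrite -sqrf_eq0; apply/eqP.
by move: h => /psumr_eq0P ->// j _; exact: sqr_ge0.
Qed.

(** Fewer linear constraints than dimensions leave a nonzero combination. *)
Lemma combination_orthogonal m n (f : 'I_m -> V) (g : 'I_n -> V) : (n < m)%N ->
  exists x : 'I_m -> R, 0 < \sum_i x i ^+ 2 /\
    forall j, b (\sum_i x i *: f i) (g j) = 0.
Proof.
move=> nm; have [x x0 xA] := left_kernel_neq0 (\matrix_(i, j) b (f i) (g j)) nm.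
exists (x ord0); split; first exact: sumsq_gt0.
move=> j; have /matrixP/(_ ord0 j) := xA; rewrite !mxE => h.
by rewrite (sbilin_suml Hb) -[RHS]h; apply: eq_bigr => i _; rewrite mxE (sbilinZl Hb).
Qed.

(** The last clause is the variational characterization: [lam n] is the minimum
    of the Rayleigh quotient on the [b]-orthogonal complement of the previous
    eigenvectors. It carries the information that the list is exhaustive. *)
Definition eigenbasis S (e : nat -> V) (lam : nat -> R) :=
  [/\ forall n, S (e n), forall i j, b (e i) (e j) = (i == j)%:R,
    forall n v, S v -> q (e n) v = lam n * b (e n) v &
    forall n v, S v -> (forall j, (j < n)%N -> b v (e j) = 0) ->
      lam n * b v v <= q v v].

(** The Rayleigh quotient is minimized on the complement [X] of [l], which still
    contains a vector of positive [b]-norm since [S] is infinite dimensional. *)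
Lemma next_eigenvector S (l : seq V) : subspace S -> complete_for q S ->
  infinite_dimensional S ->
  exists e, [/\ S e, b e e = 1, (forall x, x \in l -> b e x = 0),
    (forall v, S v -> (forall x, x \in l -> b v x = 0) -> q e v = q e e * b e v) &
    forall v, S v -> (forall x, x \in l -> b v x = 0) -> q e e * b v v <= q v v].
Proof.
move=> sS cS iS; pose X := [set v | S v /\ forall x, x \in l -> b v x = 0].
have [sX cX] : subspace X /\ complete_for q X.
  rewrite /X {X}; elim: l => [|x l [sX cX]].
    by rewrite (_ : [set v | _] = S)//; apply/seteqP; split => v // [].
  pose X := [set v | S v /\ forall y, y \in l -> b v y = 0].
  suff -> : [set v | S v /\ forall y, y \in x :: l -> b v y = 0] =
      [set v | X v /\ b v x = 0].
    exact: (complete_orthogonal sX (@q0' _) cX x Hb b0 (fun v _ => dominated v)).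
  apply/seteqP; split => v /= [].
    move=> Sv vl; split; last by apply: vl; rewrite mem_head.
    by split => // y yl; apply: vl; rewrite inE yl orbT.
  by move=> [Sv vl] vx; split => // y; rewrite inE => /predU1P[->//|]; exact: vl.
have [f [Sf bf]] := iS (size l).+1.
have [x [x0 hx]] := @combination_orthogonal _ (size l) f
  (fun j => nth 0 l j) (leqnn _).
have [|e [[Se el] be qe qle]] := @rayleigh_attained X sX cX; last first.
- exists e; split => // v Sv vl; [exact: qe|exact: qle].
- exists (\sum_i x i *: f i); last by rewrite orthonormal_sq.
  split; first by apply: subspace_sum => // i _; exact: subspaceZ.
  move=> y yl; have yi : (index y l < size l)%N by rewrite index_mem.
  by have := hx (Ordinal yi); rewrite /= nth_index.
Qed.

(** A minimizer on the complement of the previous eigenvectors satisfies the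
    eigenvalue equation only against that complement; against the previous
    eigenvectors both sides vanish, by their own equations. *)
Lemma eigenbasis_exists S : subspace S -> complete_for q S ->
  infinite_dimensional S -> exists e lam, eigenbasis S e lam.
Proof.
move=> sS cS iS.
have /choice[nxt Hn] := fun l => next_eigenvector l sS cS iS.
pose L := fix L n := if n is k.+1 then rcons (L k) (nxt (L k)) else [::].
pose e n := nxt (L n).
have memL n j : (j < n)%N -> e j \in L n.
  elim: n => // n IH; rewrite ltnS leq_eqVlt /= mem_rcons inE => /predU1P[->|/IH ->].
    by rewrite eqxx.
  by rewrite orbT.
have Lmem n x : x \in L n -> exists2 j, (j < n)%N & x = e j.
  elim: n => // n IH; rewrite /= mem_rcons inE => /predU1P[->|/IH[j jn ->]].
    by exists n.
  by exists j => //; exact: ltnW.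
have Se n : S (e n) by case: (Hn (L n)).
have ltb i j : (i < j)%N -> b (e j) (e i) = 0.
  by move=> ij; case: (Hn (L j)) => _ _ h _ _; exact/h/memL.
have bee i j : b (e i) (e j) = (i == j)%:R.
  have [ij|ij|->] := ltngtP i j; [by rewrite (sbilinC Hb) ltb|by rewrite ltb|].
  by case: (Hn (L j)).
have ortho n v : S v -> (forall j, (j < n)%N -> b v (e j) = 0) ->
    forall x, x \in L n -> b v x = 0 by move=> Sv h x /Lmem[j jn ->]; exact: h.
exists e, (fun n => q (e n) (e n)); split => //; last first.
  move=> n v Sv h; case: (Hn (L n)) => _ _ _ _ /(_ _ Sv (ortho _ _ Sv h)).
  exact.
elim/ltn_ind => n IH v Sv.
pose p := \sum_(j < n) b v (e j) *: e j.
have Sp : S p by apply: subspace_sum => // i _; exact: subspaceZ.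
have -> : v = p + (v - p) by rewrite addrC subrK.
have qp : q (e n) p = 0.
  rewrite (sbilin_sumr Hq) big1// => j _; rewrite (sbilinZr Hq) (sbilinC Hq) IH//.
  by rewrite bee ltn_eqF// !mulr0.
have bp : b (e n) p = 0.
  rewrite (sbilin_sumr Hb) big1// => j _; rewrite (sbilinZr Hb) bee.
  by rewrite gtn_eqF// mulr0.
rewrite (sbilinDr Hq) (sbilinDr Hb) qp bp !add0r.
have Svp : S (v - p) by exact: subspaceB.
case: (Hn (L n)) => _ _ _ h _; apply: h => //; apply: ortho => // j jn.
rewrite (sbilinBl Hb) (sbilin_suml Hb) (bigD1 (Ordinal jn))//= big1 => [|i ij].
  by rewrite (sbilinZl Hb) bee eqxx mulr1 addr0 subrr.
rewrite (sbilinZl Hb) bee.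
by rewrite (_ : (i == j :> nat) = false) ?mulr0//; apply: contraNF ij.
Qed.

End spectral.

(** * Variational characterization of eigenvalues *)

Section eigenbasis_theory.
Context {R : realType} {V : lmodType R}.
Implicit Types (S T X : set V) (u v w : V).
Variables (q b : V -> V -> R) (c0 : R).
Hypotheses (Hq : sbilin q) (Hb : sbilin b).
Hypotheses (q0 : nonneg_on setT q) (b0 : nonneg_on setT b).
Hypotheses (c0p : 0 < c0) (bq : forall v, c0 * b v v <= q v v).

(** A Cauchy-Schwarz inequality for combinations: expand the nonnegative sum of
    the [a]-squares of [g i - t x_i G] and choose for [t] the inverse of the sum
    of the [x_i ^ 2]. *)
Lemma sq_sum_le (a : V -> V -> R) n (x : 'I_n -> R) (g : 'I_n -> V) :
  sbilin a -> nonneg_on setT a ->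
  a (\sum_i x i *: g i) (\sum_i x i *: g i) <= (\sum_i x i ^+ 2) * \sum_i a (g i) (g i).
Proof.
move=> Ha a0; set G := \sum_i x i *: g i; set s := \sum_i x i ^+ 2.
have key t : 0 <= a G G * t ^+ 2 * s - 2 * a G G * t + \sum_i a (g i) (g i).
  have -> : a G G * t ^+ 2 * s - 2 * a G G * t + \sum_i a (g i) (g i) =
      \sum_i a (g i - (t * x i) *: G) (g i - (t * x i) *: G).
    under [RHS]eq_bigr => i _ do
      rewrite (sbilin_sqB Ha) (sbilin_sqZ Ha) (sbilinZr Ha) -addrA addrC exprMn.
    rewrite big_split /=; congr (_ + _); rewrite big_split /= addrC; congr (_ + _).
      by rewrite /s mulr_sumr; apply: eq_bigr => i _; ring.
    rewrite [X in 2 * X](sbilin_suml Ha) mulr_sumr mulr_suml -sumrN.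
    by apply: eq_bigr => i _; rewrite (sbilinZl Ha); ring.
  by apply: sumr_ge0 => i _; exact: a0.
have s0 : 0 <= s by apply: sumr_ge0 => i _; exact: sqr_ge0.
have [s0'|sn0] := eqVneq s 0.
  have := key (\sum_i a (g i) (g i) + 1).
  have : 0 <= \sum_i a (g i) (g i) by apply: sumr_ge0 => i _; exact: a0.
  have : forall i, x i = 0.
    move=> i; apply/eqP; rewrite -sqrf_eq0; apply/eqP.
    by move/psumr_eq0P : s0' => ->// j _; exact: sqr_ge0.
  move=> x0 _ _; rewrite s0' mul0r /G big1 ?(sbilin0l Ha)// => i _.
  by rewrite x0 scale0r.
have sp : 0 < s by rewrite lt_neqAle eq_sym sn0.
have := key s^-1.
have -> : a G G * s^-1 ^+ 2 * s - 2 * a G G * s^-1 = - (a G G / s) by field.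
by rewrite addrC subr_ge0 ler_pdivrMr// mulrC.
Qed.

Lemma projection_nearest S f p p' : subspace S -> S p -> S p' ->
  (forall t, S t -> q (f - p) t = 0) -> q (f - p) (f - p) <= q (f - p') (f - p').
Proof.
move=> sS Sp Sp' h.
have -> : f - p' = (f - p) + (p - p') by rewrite addrA subrK.
rewrite (sbilin_sqD Hq (f - p)) [q (f - p) (p - p')]h; last exact: subspaceB.
by rewrite mulr0 addr0 lerDl q0.
Qed.

Section one_basis.
Variables (S : set V) (e : nat -> V) (lam : nat -> R).
Hypothesis E : eigenbasis q b S e lam.

Let Se n : S (e n). Proof. by case: E. Qed.
Let be i j : b (e i) (e j) = (i == j)%:R. Proof. by case: E. Qed.

Lemma eigenbasis_q i j : q (e i) (e j) = lam i * (i == j)%:R.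
Proof. by case: E => _ _ h _; rewrite h// be. Qed.

Lemma eigenvalue_ge n : c0 <= lam n.
Proof. by have := bq (e n); rewrite eigenbasis_q be eqxx !mulr1. Qed.

Lemma eigenvalue_gt0 n : 0 < lam n.
Proof. exact: lt_le_trans (eigenvalue_ge n). Qed.

Lemma eigenvalue_le m n : (m <= n)%N -> lam m <= lam n.
Proof.
move=> mn; case: E => _ _ _ /(_ m (e n) (Se n)).
rewrite eigenbasis_q be eqxx !mulr1; apply => j jm.
by rewrite be gtn_eqF// (leq_trans jm).
Qed.

Lemma combination_b n (x : 'I_n -> R) :
  b (\sum_i x i *: e i) (\sum_i x i *: e i) = \sum_i x i ^+ 2.
Proof. by rewrite (orthonormal_sq Hb)// => i j; rewrite be. Qed.

Lemma combination_q n (x : 'I_n -> R) :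
  q (\sum_i x i *: e i) (\sum_i x i *: e i) = \sum_i x i ^+ 2 * lam i.
Proof.
rewrite (sbilin_suml Hq); apply: eq_bigr => i _.
rewrite (sbilinZl Hq) (sbilin_sumr Hq) (bigD1 i)//= big1 => [|j ji].
  by rewrite (sbilinZr Hq) eigenbasis_q eqxx mulr1 addr0 mulrA expr2.
rewrite (sbilinZr Hq) eigenbasis_q (_ : (i == j :> nat) = false) ?mulr0//.
by apply: contraNF ji => /eqP /val_inj ->.
Qed.

(** The vectors [e i] are [q]-orthogonal with [q]-square [lam i]. *)
Lemma bessel n w : \sum_(i < n) q (e i) w ^+ 2 / lam i <= q w w.
Proof.
pose x (i : 'I_n) := q (e i) w / lam i.
have := q0 (I : setT (w - \sum_i x i *: e i)).
rewrite (sbilin_sqB Hq) combination_q (sbilinC Hq w) (sbilin_suml Hq).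
have -> : \sum_i q (x i *: e i) w = \sum_(i < n) q (e i) w ^+ 2 / lam i.
  by apply: eq_bigr => i _; rewrite (sbilinZl Hq) /x mulrAC expr2.
have -> : \sum_(i < n) x i ^+ 2 * lam i = \sum_(i < n) q (e i) w ^+ 2 / lam i.
  by apply: eq_bigr => i _; rewrite /x; field; rewrite gt_eqF// eigenvalue_gt0.
lra.
Qed.

(** Were all eigenvalues at most [A], compactness with [eta = 1 / (2 A)] would
    bound half of the [b]-mass of [e 0, ..., e (n - 1)], which is [n / 2], by
    finitely many sums that Bessel's inequality bounds independently of [n]. *)
Lemma eigenvalue_unbounded A : relatively_compact q b -> exists n, A < lam n.
Proof.
move=> bcomp; apply: contrapT => /forallNP h.
have {}h n : lam n <= A by rewrite leNgt; apply/negP.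
have A0 : 0 < A by exact: lt_le_trans (eigenvalue_gt0 0) (h 0%N).
have [s hs] : exists s : seq V, forall v,
    b v v <= (2 * A)^-1 * q v v + \sum_(w <- s) q v w ^+ 2.
  by apply: bcomp; rewrite invr_gt0 mulr_gt0.
pose C := \sum_(w <- s) q w w.
have key n : n%:R <= n%:R / 2 + A * C.
  have -> : n%:R = \sum_(i < n) b (e i) (e i).
    under eq_bigr do rewrite be eqxx.
    by rewrite sumr_const card_ord.
  apply: (@le_trans _ _ (\sum_(i < n) (2^-1 + \sum_(w <- s) q (e i) w ^+ 2))).
    apply: ler_sum => i _; apply: le_trans (hs _) _; rewrite lerD2r.
    rewrite eigenbasis_q eqxx mulr1 invfM -mulrA.
    rewrite -[leRHS]mulr1 ler_wpM2l ?invr_ge0// mulrC ler_pdivrMr// mul1r.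
    exact: h.
  rewrite big_split /= sumr_const card_ord lerD//.
    by under eq_bigr do rewrite be eqxx; rewrite sumr_const card_ord mulr_natl.
  rewrite exchange_big /= /C mulr_sumr; apply: ler_sum => w _.
  apply: le_trans (ler_wpM2l (ltW A0) (bessel n w)).
  rewrite mulr_sumr; apply: ler_sum => i _; rewrite mulrCA -[leLHS]mulr1.
  rewrite ler_wpM2l ?sqr_ge0// mulrC.
  by rewrite ler_pdivlMl ?eigenvalue_gt0// mulr1 h.
have C0 : 0 <= A * C by rewrite mulr_ge0 ?(ltW A0)//; apply: sumr_ge0 => w _; exact: q0.
have := key (Num.bound (2 * (A * C))).
have := archi_boundP (mulr_ge0 (ler0n R 2) C0).
move: (Num.bound _)%:R => x; lra.
Qed.

End one_basis.

(** Min-max argument: some combination of the first [n + 1] eigenvectors of [S] is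
    orthogonal to the first [n] eigenvectors of [T]. *)
Lemma eigenvalue_antimono S T e lam f mu n : subspace S -> S `<=` T ->
  eigenbasis q b S e lam -> eigenbasis q b T f mu -> mu n <= lam n.
Proof.
move=> sS ST Ee Ef.
have [x [x0 hx]] := @combination_orthogonal _ _ b Hb n.+1 n e f (ltnSn n).
have Sv : S (\sum_(i < n.+1) x i *: e i).
  by apply: subspace_sum => // i _; apply: subspaceZ => //; case: Ee.
case: (Ef) => _ _ _ /(_ n _ (ST _ Sv)) h.
have {}h := h (fun j jn => hx (Ordinal jn)).
rewrite -(ler_pM2r x0) -(combination_b Ee).
apply: le_trans h _; rewrite (combination_b Ee) (combination_q Ee) mulr_sumr.
apply: ler_sum => i _; rewrite mulrC ler_wpM2r ?sqr_ge0//.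
by apply: (eigenvalue_le Ee); rewrite -ltnS.
Qed.

(** Trial space for an upper bound: some combination [v] of the projections of
    the first eigenvectors [f i] is orthogonal to the first eigenvectors of [S].
    Projecting decreases [q], and changes [b] by a small amount only. *)
Lemma eigenvalue_upper S e lam f mu (p : nat -> V) j (d rho : R) :
  subspace S -> eigenbasis q b S e lam -> eigenbasis q b setT f mu ->
  (forall i, S (p i)) -> (forall i t, S t -> q (f i - p i) t = 0) ->
  (forall i, (i <= j)%N -> q (f i - p i) (f i - p i) <= d) ->
  0 <= rho -> j.+1%:R * d <= c0 * (rho / 2) ^+ 2 ->
  lam j * (1 - rho) <= mu j.
Proof.
move=> sS Ee Ef Sp qp hd rho0 hrho.
have [x [s0 hx]] := @combination_orthogonal _ _ b Hb j.+1 j p e (ltnSn j).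
set s := \sum_i _ in s0; set v := \sum_i _ in hx.
pose F := \sum_(i < j.+1) x i *: f i.
pose g := \sum_(i < j.+1) x i *: (f i - p i).
have Fv : F = v + g.
  rewrite /F /v /g -big_split; apply: eq_bigr => i _.
  by rewrite /= -scalerDr addrC subrK.
have Sv : S v by apply: subspace_sum => // i _; exact: subspaceZ.
have qgv : q g v = 0.
  by rewrite (sbilin_suml Hq) big1// => i _; rewrite (sbilinZl Hq) qp// mulr0.
have qF : q F F <= mu j * s.
  rewrite (combination_q Ef) mulr_sumr; apply: ler_sum => i _.
  by rewrite mulrC ler_wpM2r ?sqr_ge0// (eigenvalue_le Ef)// -ltnS.
have qv : q v v <= q F F.
  by rewrite Fv (sbilin_sqD Hq) (sbilinC Hq v) qgv mulr0 addr0 lerDl q0.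
have lv : lam j * b v v <= q v v.
  case: Ee => _ _ _ /(_ j _ Sv); apply => i ij.
  exact: (hx (Ordinal ij)).
have bF : b F F = s by exact: (combination_b Ef).
have bg : b g g <= s * (rho / 2) ^+ 2.
  rewrite -(ler_pM2l c0p); apply: le_trans (bq _) _.
  apply: le_trans (sq_sum_le _ _ Hq q0) _.
  rewrite mulrCA -/s ler_pM2l//; apply: le_trans hrho.
  rewrite mulr_natl -[j.+1 in leRHS]card_ord -sumr_const; apply: ler_sum => i _.
  by apply: hd; rewrite -ltnS.
have bFg : b F g <= s * (rho / 2).
  have r2 : 0 <= s * (rho / 2) by rewrite mulr_ge0 ?(ltW s0)// divr_ge0.
  apply: le_trans (ler_norm _) _; rewrite -(ler_sqr (x := `|_|)) ?nnegrE//.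
  rewrite real_normK ?num_real//.
  apply: le_trans (cauchy_schwarz subspaceT Hb b0 I I) _.
  by rewrite bF exprMn expr2 -mulrA ler_pM2l.
have bv : s * (1 - rho) <= b v v.
  have -> : v = F - g by rewrite Fv addrK.
  rewrite (sbilin_sqB Hb) bF; have := b0 (I : setT g); lra.
rewrite -(ler_pM2r s0) -mulrA [_ * s]mulrC.
apply: le_trans (le_trans qv qF); apply: le_trans lv.
by rewrite ler_wpM2l// ltW// (eigenvalue_gt0 Ee).
Qed.

End eigenbasis_theory.

(** * Multiplicities *)

(** At the first index where the two lists differ, the list with the smaller
    value takes this value more often than the other one. *)
Lemma nondecreasing_card_eq (R : realType) (f g : nat -> R) :
  (forall m n, (m <= n)%N -> f m <= f n) -> (forall m n, (m <= n)%N -> g m <= g n) ->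
  (forall l, exists m, ([set n | f n = l] #= `I_m)%card /\ ([set n | g n = l] #= `I_m)%card) ->
  forall n, f n = g n.
Proof.
have main (f' g' : nat -> R) n :
  (forall m n, (m <= n)%N -> g' m <= g' n) ->
  (forall l, exists m, ([set n | f' n = l] #= `I_m)%card /\ ([set n | g' n = l] #= `I_m)%card) ->
  (forall i, (i < n)%N -> f' i = g' i) -> f' n < g' n -> False.
  move=> gle cnt IH lt; have [m [fm gm]] := cnt (f' n).
  have ff : finite_set [set i | f' i = f' n] by exists m.
  have gf : finite_set [set i | g' i = f' n] by exists m.
  have sub : (fset_set [set i | g' i = f' n] `<=` fset_set [set i | f' i = f' n])%fset.
    apply/fsubsetP => i; rewrite !in_fset_set// !inE /= => gi.
    rewrite IH//; rewrite ltnNge; apply/negP => ni.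
    by have := gle _ _ ni; rewrite gi leNgt lt.
  have /eqP eqs : (fset_set [set i | g' i = f' n] == fset_set [set i | f' i = f' n])%fset.
    by rewrite eqEfcard sub (card_fset_set fm) (card_fset_set gm) leqnn.
  have : n \in fset_set [set i | f' i = f' n] by rewrite in_fset_set// inE.
  by rewrite -eqs in_fset_set// inE /= => h; move: lt; rewrite h ltxx.
move=> fle gle cnt; elim/ltn_ind => n IH.
have [lt|lt|//] := ltgtP (f n) (g n); exfalso.
- exact: (main f g n).
- apply: (main g f n) => //; last by move=> i /IH.
  by move=> l; have [m [? ?]] := cnt l; exists m.
Qed.

Lemma card_eq1_unique (A : set nat) i j : (A #= `I_1)%card -> A i -> A j -> i = j.
Proof.
move=> A1 Ai Aj; have fA : finite_set A by exists 1%N.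
have /eqP/cardfs1P[x xE] := card_fset_set A1.
have in1 k : A k -> k = x.
  by move=> Ak; apply/eqP; rewrite -in_fset1 -xE in_fset_set// mem_set.
by rewrite (in1 _ Ai) (in1 _ Aj).
Qed.

Section dimension.
Context {R : realType} {V : lmodType R}.
Implicit Types (S T X E : set V) (u v w : V).
Variables (b : V -> V -> R).
Hypotheses (Hb : sbilin b) (b0 : nonneg_on setT b).

(** Dimension modulo the null vectors of [b]. *)
Definition has_dim_mod E m := exists f : 'I_m -> V,
  [/\ forall i, E (f i),
    forall a : 'I_m -> R, b (\sum_i a i *: f i) (\sum_i a i *: f i) = 0 ->
      forall i, a i = 0 &
    forall u, E u -> exists a : 'I_m -> R,
      b (u - \sum_i a i *: f i) (u - \sum_i a i *: f i) = 0].

Lemma has_dim_mod_unique E m n : has_dim_mod E m -> has_dim_mod E n -> m = n.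
Proof.
have main m' n' : has_dim_mod E m' -> has_dim_mod E n' -> (n' <= m')%N.
  move=> [f [Ef _ sf]] [g [Eg ig _]]; rewrite leqNgt; apply/negP => mn.
  have /choice[M HM] : forall j, exists a : 'I_m' -> R,
      b (g j - \sum_i a i *: f i) (g j - \sum_i a i *: f i) = 0.
    by move=> j; exact: sf.
  have [x x0 xM] := left_kernel_neq0 (\matrix_(j, i) M j i) mn.
  have gM j w : b (g j) w = \sum_i M j i * b (f i) w.
    have := null_orthogonal subspaceT Hb b0 I (I : setT w) (HM j).
    move/eqP; rewrite (sbilinBl Hb) subr_eq0 => /eqP ->.
    by rewrite (sbilin_suml Hb); apply: eq_bigr => i _; rewrite (sbilinZl Hb).
  move/negP : x0; apply; apply/eqP/rowP => j; rewrite mxE.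
  move: j; apply: (ig (x ord0)); set G := \sum_i _.
  rewrite {1}/G (sbilin_suml Hb).
  under eq_bigr => j _ do rewrite (sbilinZl Hb) gM mulr_sumr.
  rewrite exchange_big /= big1// => i _.
  have /matrixP/(_ ord0 i) := xM; rewrite !mxE => h.
  transitivity ((\sum_j x ord0 j * M j i) * b (f i) G).
    by rewrite mulr_suml; apply: eq_bigr => j _; rewrite mulrA.
  have -> : \sum_j x ord0 j * M j i = 0.
    by rewrite -[RHS]h; apply: eq_bigr => j _; rewrite mxE.
  by rewrite mul0r.
by move=> h1 h2; apply/eqP; rewrite eqn_leq !main.
Qed.

End dimension.

Section eigenspaces.
Context {R : realType} {V : lmodType R}.
Implicit Types (S T X : set V) (u v w : V).
Variables (q b : V -> V -> R) (c0 : R).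
Hypotheses (Hq : sbilin q) (Hb : sbilin b).
Hypotheses (q0 : nonneg_on setT q) (b0 : nonneg_on setT b).
Hypotheses (c0p : 0 < c0) (bq : forall v, c0 * b v v <= q v v).
Hypothesis bcomp : relatively_compact q b.

Definition eigenspace_in S (l : R) : set V :=
  [set u | S u /\ forall v, S v -> q u v = l * b u v].

(** An eigenvector for [l] is orthogonal to the [e n] with another eigenvalue.
    After subtracting its components along those with eigenvalue [l] it is
    orthogonal to every [e n], so it is a null vector because the eigenvalues
    are unbounded. *)
Lemma eigenspace_dim S e lam l : subspace S -> eigenbasis q b S e lam ->
  exists2 m, has_dim_mod b (eigenspace_in S l) m & ([set n | lam n = l] #= `I_m)%card.
Proof.
move=> sS Ee; have [N hN] := eigenvalue_unbounded Hq q0 c0p bq Ee l bcomp.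
have ltN n : lam n = l -> (n < N)%N.
  move=> nl; rewrite ltnNge; apply/negP => Nn.
  by have := eigenvalue_le Ee Nn; rewrite nl leNgt hN.
pose s := [seq n <- iota 0 N | lam n == l].
have us : uniq s by rewrite filter_uniq// iota_uniq.
have mems n : (n \in s) = (lam n == l).
  rewrite mem_filter mem_iota add0n /=; case: eqP => //= /ltN ->//.
exists (size s); last first.
  rewrite (_ : [set n | lam n = l] = [set` [fset n in s]%fset]).
    by apply/card_eq_fsetP; rewrite card_fseq undup_id.
  by apply/seteqP; split => n /=; rewrite !inE mems => /eqP.
pose f (i : 'I_(size s)) := e (nth 0%N s i).
have lf (i : 'I_(size s)) : lam (nth 0%N s i) = l.
  by apply/eqP; rewrite -mems mem_nth.
case: (Ee) => Se be qe le.
have bf i j : b (f i) (f j) = (i == j)%:R by rewrite /f be nth_uniq ?ltn_ord.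
exists f; split.
- move=> i; split; first exact: Se.
  by move=> v Sv; rewrite /f qe// lf.
- move=> a; rewrite (orthonormal_sq Hb)// => /psumr_eq0P h i.
  by apply/eqP; rewrite -sqrf_eq0; apply/eqP; apply: h => // j _; exact: sqr_ge0.
- move=> u [Su qu]; exists (fun i => b u (f i)).
  set w := u - _.
  have Sw : S w.
    apply: subspaceB => //; apply: subspace_sum => // i _.
    by apply: subspaceZ => //; exact: Se.
  have bw n : b w (e n) = 0.
    rewrite (sbilinBl Hb) (sbilin_suml Hb); have [nl|nl] := eqVneq (lam n) l.
      have ns : n \in s by rewrite mems nl.
      have ni : (index n s < size s)%N by rewrite index_mem.
      rewrite (bigD1 (Ordinal ni))//= big1 => [|i ii].
        by rewrite (sbilinZl Hb) /f /= nth_index// be eqxx mulr1 addr0 subrr.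
      rewrite (sbilinZl Hb) /f be; case: eqP => [h|_]; rewrite ?mulr0//.
      case/eqP: ii; apply/val_inj => /=.
      by rewrite -h index_uniq.
    have /eqP : (lam n - l) * b u (e n) = 0.
      by rewrite mulrBl -qu// -(sbilinC Hb (e n)) -qe// (sbilinC Hq) subrr.
    rewrite mulf_eq0 subr_eq0 (negPf nl) /= => /eqP ->.
    rewrite big1 ?subr0// => i _; rewrite (sbilinZl Hb) /f be.
    case: eqP => [h|_]; rewrite ?mulr0//.
    by move/eqP : nl; rewrite -h lf.
  apply/eqP; rewrite eq_le b0// andbT leNgt; apply/negP => bww.
  have [n hn] := eigenvalue_unbounded Hq q0 c0p bq Ee (q w w / b w w) bcomp.
  have := le n _ Sw (fun j _ => bw j); rewrite leNgt => /negP; apply.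
  by rewrite -ltr_pdivrMr.
Qed.

End eigenspaces.

(** * Perturbation of a simple eigenvalue *)

Lemma common_small (R : realFieldType) (l : seq (R * R)) :
  all (fun p => (0 <= p.1) && (0 < p.2)) l ->
  exists2 d : R, 0 < d & forall p, p \in l -> p.1 * d <= p.2.
Proof.
elim: l => [|[x y] l IH]; first by exists 1.
move=> /=/andP[/andP[x0 y0] hl]; have [d d0 hd] := IH hl.
have d'0 : 0 < Num.min d (y / (x + 1)) by rewrite lt_min d0 divr_gt0//; lra.
exists (Num.min d (y / (x + 1))) => // p; rewrite inE => /predU1P[->|pl] /=.
  apply: (@le_trans _ _ (x * (y / (x + 1)))).
    by rewrite ler_wpM2l// ge_min lexx orbT.
  rewrite mulrCA -[leRHS]mulr1 ler_wpM2l ?(ltW y0)// ler_pdivrMr; lra.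
apply: le_trans (hd _ pl); rewrite ler_wpM2l ?ge_min ?lexx//.
by have /andP[] := allP hl _ pl.
Qed.

Section perturbation.
Context {R : realType} {V : lmodType R}.
Implicit Types (S T X : set V) (u v w : V).
Variables (q b : V -> V -> R) (c0 : R).
Hypotheses (Hq : sbilin q) (Hb : sbilin b).
Hypotheses (q0 : nonneg_on setT q) (b0 : nonneg_on setT b).
Hypotheses (c0p : 0 < c0) (bq : forall v, c0 * b v v <= q v v).
Hypothesis bcomp : relatively_compact q b.

Section gap.
Variables (S : set V) (e : nat -> V) (lam : nat -> R) (k : nat).
Variables (l g : R) (phi p : V).
Hypotheses (sS : subspace S) (Ee : eigenbasis q b S e lam).
Hypothesis g0 : 0 < g.
Hypotheses (below : forall j, (j < k)%N -> lam j <= l - g) (above : l + g <= lam k.+1).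
Hypotheses (qphi : forall v, q phi v = l * b phi v).
Hypotheses (Sp : S p) (qp : forall t, S t -> q (phi - p) t = 0).

Let r := p - b p (e k) *: e k.

(** The projection [p] of the unperturbed eigenvector solves the perturbed
    eigenvalue equation up to the error [l * b (phi - p) _]; testing with the
    reflection of [r] that changes the sign of its low modes turns the
    spectral gap into coercivity. *)
Lemma gap_estimate : b r r <= (l / g) ^+ 2 * b (phi - p) (phi - p).
Proof.
case: (Ee) => Se be qe le.
pose r1 := \sum_(j < k) b r (e j) *: e j; pose r2 := r - r1.
have Sr : S r by apply: subspaceB => //; exact: subspaceZ.
have Sr1 : S r1 by apply: subspace_sum => // j _; exact: subspaceZ.
have Sr2 : S r2 by exact: subspaceB.
have brk : b r (e k) = 0.
  by rewrite (sbilinBl Hb) (sbilinZl Hb) be eqxx mulr1 subrr.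
have br1 j : (j < k)%N -> b r1 (e j) = b r (e j).
  move=> jk; rewrite (sbilin_suml Hb) (bigD1 (Ordinal jk))//= big1 => [|i ij].
    by rewrite (sbilinZl Hb) be eqxx mulr1 addr0.
  rewrite (sbilinZl Hb) be; case: eqP => [h|_]; rewrite ?mulr0//.
  by case/eqP: ij; exact/val_inj.
have br1k : b r1 (e k) = 0.
  by rewrite (sbilin_suml Hb) big1// => j _; rewrite (sbilinZl Hb) be ltn_eqF// mulr0.
have br2 j : (j < k.+1)%N -> b r2 (e j) = 0.
  rewrite ltnS leq_eqVlt => /predU1P[->|jk].
    by rewrite (sbilinBl Hb) brk br1k subrr.
  by rewrite (sbilinBl Hb) br1// subrr.
have b12 : b r1 r2 = 0.
  rewrite (sbilin_suml Hb) big1// => j _; rewrite (sbilinZl Hb) (sbilinC Hb _ r2) br2 ?mulr0//.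
  by rewrite ltnS ltnW ?ltn_ord.
have q12 : q r1 r2 = 0.
  rewrite (sbilin_suml Hq) big1// => j _; rewrite (sbilinZl Hq) qe// (sbilinC Hb _ r2) br2 ?mulr0//.
  by rewrite ltnS ltnW ?ltn_ord.
have q1 : q r1 r1 <= (l - g) * b r1 r1.
  rewrite (combination_q Hq Ee) (combination_b Hb Ee) mulr_sumr; apply: ler_sum => j _.
  by rewrite mulrC ler_wpM2r ?sqr_ge0// below.
have q2 : (l + g) * b r2 r2 <= q r2 r2.
  apply: le_trans (le k.+1 _ Sr2 br2); rewrite ler_wpM2r//; exact: b0.
have rE : r = r1 + r2 by rewrite /r2 addrC subrK.
have brr : b r r = b r1 r1 + b r2 r2.
  by rewrite {1 2}rE (sbilin_sqD Hb) b12 mulr0 addr0.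
pose t := r2 - r1.
have St : S t by exact: subspaceB.
have btt : b t t = b r r.
  by rewrite brr (sbilin_sqB Hb) (sbilinC Hb r2) b12 mulr0 subr0 addrC.
have btk : b t (e k) = 0 by rewrite (sbilinBl Hb) br2// br1k subrr.
have qrt : q r t = q r2 r2 - q r1 r1.
  by rewrite {1}rE /t (sbilin_DB Hq).
have brt : b r t = b r2 r2 - b r1 r1.
  by rewrite {1}rE /t (sbilin_DB Hb).
have main : q r t - l * b r t = l * b (phi - p) t.
  have qpt : q p t = l * b phi t.
    by rewrite -qphi; apply/eqP; rewrite eq_sym -subr_eq0 -(sbilinBl Hq) qp.
  have ekt : b (e k) t = 0 by rewrite (sbilinC Hb).
  clearbody t.
  by rewrite /r !(sbilinBl Hq) !(sbilinBl Hb) (sbilinZl Hq) (sbilinZl Hb)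
    qe// ekt qpt; ring.
have h1 : g * b r r <= l * b (phi - p) t.
  by rewrite -main qrt brt brr; lra.
have h2 := cauchy_schwarz subspaceT Hb b0 (I : setT (phi - p)) (I : setT t).
rewrite btt in h2.
have brr0 : 0 <= b r r by exact: b0.
have [->|brn] := eqVneq (b r r) 0.
  by rewrite mulr_ge0 ?sqr_ge0//; exact: b0.
have brp : 0 < b r r by rewrite lt_neqAle eq_sym brn.
rewrite -(ler_pM2r brp).
have -> : (l / g) ^+ 2 * b (phi - p) (phi - p) * b r r =
   (l / g) ^+ 2 * (b (phi - p) (phi - p) * b r r) by rewrite mulrA.
apply: le_trans (ler_wpM2l (sqr_ge0 _) h2); rewrite -exprMn -expr2.
rewrite ler_sqr ?nnegrE//.
  by rewrite mulrAC ler_pdivlMr// mulrC.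
by rewrite mulrAC divr_ge0 ?(ltW g0)//; apply: le_trans h1; rewrite mulr_ge0// ltW.
Qed.

End gap.

(** Arithmetic of the expansion, with [D] the shift of the eigenvalue, [kap] the
    [q]-square of [phi - p], [x] and [y] the [b]-pairings of [phi - p] with
    [phi] and with itself, [z] and [w] those of the remainder [r]. The
    equations combine into [(D - kap) (1 - E) = kap E - l (y + w)] where
    [E = 2 x + z - y - w] is small. *)
Lemma expansion_arith (l D kap x y z w theta : R) : 0 < l -> 0 <= kap ->
  kap = l * x -> D * (1 - x - z) = (l + D) * (x - y - w) ->
  0 <= theta <= 2^-1 -> `|2 * x + z - y - w| <= theta ->
  `|l * (y + w)| <= theta * kap -> `|D - kap| <= 4 * theta * kap.
Proof.
move=> l0 kap0 kx hD /andP[t0 t1]; set E := 2 * x + z - y - w => hE hyw.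
have key : (D - kap) * (1 - E) = kap * E - l * (y + w).
  by rewrite kx /E; have : D * (1 - x - z) - (l + D) * (x - y - w) = 0 by [rewrite hD subrr|]; lra.
have E1 : 2^-1 <= `|1 - E|.
  by apply: le_trans (ler_norm _); move: hE; rewrite ler_norml => /andP[]; lra.
have h : `|D - kap| * `|1 - E| <= 2 * theta * kap.
  rewrite -normrM key; apply: le_trans (ler_normB _ _) _.
  rewrite normrM (ger0_norm kap0).
  have : kap * `|E| <= kap * theta by rewrite ler_wpM2l.
  lra.
have : `|D - kap| * 2^-1 <= `|D - kap| * `|1 - E| by rewrite ler_wpM2l.
lra.
Qed.

Lemma norm_le_sq (x y : R) : 0 <= y -> x ^+ 2 <= y ^+ 2 -> `|x| <= y.
Proof.
by move=> y0 h; rewrite -(ler_sqr (x := `|x|)) ?nnegrE// real_normK ?num_real.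
Qed.

(** Let [U = phi - p] and let [u = e k] be the perturbed eigenvector. Comparing
    the equations of [phi] and [u] gives [(lam k - l) b phi u = lam k b U u].
    The component [r] of [p] off [u] is controlled by [b U U] through the
    spectral gap, and [b U U] is negligible against [q U U] by compactness;
    since [l * b U phi = q U U], the leading term is [q U U]. The subspace has
    to approximate finitely many vectors [W] only: [phi], the vectors that
    represent the compactness functionals, and the lower eigenvectors, which
    keep the lower eigenvalues away. *)
Theorem eigenvalue_expansion f mu k phi : eigenbasis q b setT f mu ->
  (forall j, (j < k)%N -> mu j < mu k) -> mu k < mu k.+1 ->
  (forall v, q phi v = mu k * b phi v) -> b phi phi = 1 ->
  forall eta : R, 0 < eta -> exists2 d : R, 0 < d & exists W : seq V,
    forall S e lam p, subspace S -> complete_for q S ->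
      (forall w, w \in W -> exists2 s, S s & q (w - s) (w - s) <= d) ->
      eigenbasis q b S e lam -> S p -> (forall t, S t -> q (phi - p) t = 0) ->
      `|lam k - mu k - q (phi - p) (phi - p)| <= eta * q (phi - p) (phi - p).
Proof.
move=> Ef low high qphi bphi eta eta0.
set l := mu k; have l0 : 0 < l by exact: (eigenvalue_gt0 c0p bq Ef).
have [g g0 [glow ghigh]] : exists2 g, 0 < g &
    (forall j, (j < k)%N -> mu j <= l - g) /\ l + g <= mu k.+1.
  have [k0|k0] := posnP k.
    exists (mu k.+1 - l); first by rewrite subr_gt0.
    by split; [move=> j; rewrite k0|rewrite addrC subrK].
  exists (Num.min (l - mu k.-1) (mu k.+1 - l)).
    by rewrite lt_min !subr_gt0 high andbT low// prednK.
  split=> [j jk|].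
    have : Num.min (l - mu k.-1) (mu k.+1 - l) <= l - mu k.-1 by rewrite ge_min lexx.
    have : mu j <= mu k.-1 by apply: (eigenvalue_le Ef); rewrite -ltnS prednK.
    lra.
  have : Num.min (l - mu k.-1) (mu k.+1 - l) <= mu k.+1 - l by rewrite ge_min lexx orbT.
  lra.
pose rho := Num.min 2^-1 (g / (2 * l)).
have rho0 : 0 < rho by rewrite lt_min invr_gt0 ltr0n divr_gt0// mulr_gt0.
have rho1 : rho <= 2^-1 by rewrite ge_min lexx.
have rhol : rho * l <= g / 2.
  have -> : g / 2 = g / (2 * l) * l by field; rewrite gt_eqF.
  by rewrite ler_wpM2r ?(ltW l0)// ge_min lexx orbT.
pose M := l / (g / 2).
have M0 : 0 < M by rewrite divr_gt0// divr_gt0.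
pose theta := Num.min 2^-1 (eta / 4).
have theta0 : 0 < theta by rewrite lt_min invr_gt0 ltr0n divr_gt0.
have theta1 : theta <= 2^-1 by rewrite ge_min lexx.
have theta2 : 4 * theta <= eta.
  have : theta <= eta / 4 by rewrite ge_min lexx orbT.
  lra.
pose tau := Num.min 1 (theta / (l * (1 + M))).
have tau0 : 0 < tau by rewrite lt_min ltr01 divr_gt0// mulr_gt0//; lra.
have tau1 : tau <= 1 by rewrite ge_min lexx.
have tau2 : l * (1 + M) * tau <= theta.
  have lM : 0 < l * (1 + M) by rewrite mulr_gt0//; lra.
  rewrite -(ler_pdivlMl _ _ lM) mulrC; by rewrite ge_min lexx orbT.
have [s hs] := bcomp (divr_gt0 tau0 (ltr0n R 2)).
have t20 : 0 < tau / 2 by rewrite divr_gt0.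
have t40 : 0 < theta / 4 by rewrite divr_gt0.
have l20 : 0 <= 2 / l by rewrite divr_ge0// ltW.
have c20 : 0 < c0 * (rho / 2) ^+ 2 by rewrite mulr_gt0// exprn_gt0// divr_gt0.
have M1 : 0 <= 1 + M by lra.
have allpos : all (fun p => (0 <= p.1) && (0 < p.2)) [:: ((size s)%:R, tau / 2);
    (2 / l, theta / 4); (1 + M, theta / 4); (M ^+ 2, (theta / 4) ^+ 2);
    (k%:R, c0 * (rho / 2) ^+ 2)].
  by rewrite /= !ler0n t20 l20 t40 M1 sqr_ge0 c20 exprn_gt0.
have [d d0 hd] := @common_small R [:: ((size s)%:R, tau / 2); (2 / l, theta / 4);
    (1 + M, theta / 4); (M ^+ 2, (theta / 4) ^+ 2);
    (k%:R, c0 * (rho / 2) ^+ 2)] allpos.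
have hd1 : (size s)%:R * d <= tau / 2 by apply: (hd (_, _)); rewrite !inE eqxx.
have hd2 : 2 / l * d <= theta / 4 by apply: (hd (_, _)); rewrite !inE eqxx ?orbT.
have hd3 : (1 + M) * d <= theta / 4 by apply: (hd (_, _)); rewrite !inE eqxx ?orbT.
have hd4 : M ^+ 2 * d <= (theta / 4) ^+ 2 by apply: (hd (_, _)); rewrite !inE eqxx ?orbT.
have hd5 : k%:R * d <= c0 * (rho / 2) ^+ 2 by apply: (hd (_, _)); rewrite !inE eqxx ?orbT.
exists d => //; exists (phi :: s ++ mkseq f k) => S e lam p sS cS near Ee Sp qp.
have /choice[P HP] : forall v, exists p, S p /\ forall t, S t -> q (v - p) t = 0.
  move=> v; have [] := orthogonal_projection subspaceT Hq q0 sS _ cS (I : setT v).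
    by [].
  by move=> pv Spv h; exists pv.
set U := phi - p; set kap := q U U.
have proj_small w : w \in phi :: s ++ mkseq f k -> forall pw, S pw ->
    (forall t, S t -> q (w - pw) t = 0) -> q (w - pw) (w - pw) <= d.
  move=> wW pw Spw h; have [s' Ss' hs'] := near _ wW.
  exact: le_trans (projection_nearest Hq q0 sS Spw Ss' h) hs'.
have kapd : kap <= d by apply: proj_small => //; rewrite mem_head.
have kap0 : 0 <= kap by exact: q0.
(* the projections of the low eigenvectors form the trial space *)
have below j : (j < k)%N -> lam j <= l - g / 2.
  move=> jk; have : lam j * (1 - rho) <= mu j.
    apply: (@eigenvalue_upper _ _ q b c0 Hq Hb q0 b0 c0p bq S e lam f mu
      (fun i => P (f i)) j d rho sS Ee Ef); rewrite ?(ltW rho0)//.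
    - by move=> i; case: (HP (f i)).
    - by move=> i t St; case: (HP (f i)) => _; exact.
    - move=> i ij; case: (HP (f i)) => SP h; apply: proj_small => //.
      by rewrite inE mem_cat orbCA map_f ?orbT// mem_iota add0n /= (leq_ltn_trans ij).
    - by apply: le_trans hd5; rewrite ler_wpM2r ?(ltW d0)// ler_nat.
  have := glow _ jk => h1 h2.
  have r1 : 0 < 1 - rho by lra.
  rewrite -(ler_pM2r r1); apply: le_trans h2 _; apply: le_trans h1 _.
  have : rho * (g / 2) >= 0 by rewrite mulr_ge0 ?(ltW rho0)// divr_ge0// ltW.
  have : (l - g / 2) * (1 - rho) = l - g / 2 - rho * l + rho * (g / 2) by ring.
  lra.
have above : l + g / 2 <= lam k.+1.
  have : mu k.+1 <= lam k.+1 by apply: eigenvalue_antimono sS _ Ee Ef.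
  lra.
have g20 : 0 < g / 2 by rewrite divr_gt0.
have gap := gap_estimate sS Ee g20 below above qphi Sp qp.
case: (Ee) => Se be qe le.
set beta := b p (e k) in gap; set r := p - _ in gap; rewrite -/M -/U in gap.
pose x := b U phi; pose y := b U U; pose z := b r phi; pose w := b r U.
have y0 : 0 <= y by exact: b0.
have kx : kap = l * x.
  rewrite /kap {2}/U (sbilinBr Hq) [q U p]qp// subr0 (sbilinC Hq) qphi.
  by rewrite (sbilinC Hb).
have ytau : y <= tau * kap.
  apply: le_trans (hs U) _.
  have -> : tau * kap = tau / 2 * kap + tau / 2 * kap by field.
  rewrite lerD2l; apply: (@le_trans _ _ (\sum_(v <- s) d * kap)).
    rewrite big_seq [leRHS]big_seq; apply: ler_sum => v vs; case: (HP v) => SP h.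
    have -> : q U v = q U (v - P v).
      by rewrite (sbilinBr Hq) [q U (P v)]qp// subr0.
    apply: le_trans (cauchy_schwarz subspaceT Hq q0 I I) _.
    rewrite mulrC ler_wpM2r//; apply: proj_small => //.
    by rewrite inE mem_cat vs orbT.
  rewrite big_const_seq count_predT iter_addr_0 -mulrnAl -[d *+ _]mulr_natl.
  exact: ler_wpM2r.
have yd : y <= d.
  apply: le_trans ytau _; apply: le_trans kapd; rewrite -[leRHS]mul1r.
  exact: ler_wpM2r.
have zle : `|z| <= theta / 4.
  apply: norm_le_sq; first by rewrite divr_ge0// ltW.
  apply: le_trans (cauchy_schwarz subspaceT Hb b0 I I) _.
  rewrite bphi mulr1; apply: le_trans gap _; apply: le_trans hd4.
  by rewrite ler_wpM2l// sqr_ge0.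
have wle : `|w| <= M * y.
  apply: norm_le_sq; first by rewrite mulr_ge0// ltW.
  apply: le_trans (cauchy_schwarz subspaceT Hb b0 I I) _.
  by rewrite exprMn [y ^+ 2]expr2 mulrA ler_wpM2r.
have xle : 0 <= 2 * x <= theta / 4.
  have xE : x = kap / l by rewrite kx mulrC mulKf// gt_eqF.
  rewrite xE; apply/andP; split.
    by rewrite mulr_ge0// divr_ge0// ltW.
  apply: le_trans hd2; rewrite mulrA mulrAC ler_wpM2l//.
have ymle : y + M * y <= theta / 4.
  apply: le_trans hd3; have -> : y + M * y = (1 + M) * y by ring.
  by rewrite ler_wpM2l//; lra.
apply: (@le_trans _ _ (4 * theta * kap)); last by rewrite ler_wpM2r.
apply: (@expansion_arith l _ kap x y z w) => //.
- have pE : p = beta *: e k + r by rewrite /r addrC subrK.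
  have i1 : l * b phi (e k) = lam k * (b phi (e k) - b U (e k)).
    have -> : b phi (e k) - b U (e k) = b p (e k).
      by rewrite /U (sbilinBl Hb) opprB addrC subrK.
    rewrite -qphi (sbilinC Hb p) -qe// (sbilinC Hq (e k)).
    by apply/eqP; rewrite -subr_eq0 -(sbilinBl Hq) qp.
  have i2 : beta * b phi (e k) = 1 - x - z.
    have -> : beta * b phi (e k) = b (p - r) phi.
      by rewrite pE addrK (sbilinZl Hb) (sbilinC Hb phi).
    rewrite (sbilinBl Hb) -/z; congr (_ - _).
    by rewrite /x /U (sbilinBl Hb) bphi; ring.
  have i3 : beta * b U (e k) = x - y - w.
    have -> : beta * b U (e k) = b (p - r) U.
      by rewrite pE addrK (sbilinZl Hb) (sbilinC Hb U).
    rewrite (sbilinBl Hb) -/w; congr (_ - _).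
    have -> : p = phi - U by rewrite /U opprB addrC subrK.
    by rewrite (sbilinBl Hb) /x (sbilinC Hb phi).
  have lk : l + (lam k - l) = lam k by rewrite addrC subrK.
  rewrite lk -i2 -i3 -/l; move: i1; set A := b phi _; set B := b U _ => i1.
  have : beta * (l * A) = beta * (lam k * (A - B)) by rewrite i1.
  lra.
- by rewrite (ltW theta0) theta1.
- have -> : 2 * x + z - y - w = (2 * x) + z - (y + w) by ring.
  have := wle; have := zle; rewrite !ler_norml => /andP[? ?] /andP[? ?].
  move/andP: xle => [? ?].
  by apply/andP; split; lra.
- rewrite normrM (gtr0_norm l0).
  have h1 : `|y + w| <= (1 + M) * y.
    by apply: le_trans (ler_normD _ _) _; rewrite (ger0_norm y0); lra.
  apply: le_trans (ler_wpM2l (ltW l0) h1) _.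
  rewrite mulrA; apply: (@le_trans _ _ (l * (1 + M) * (tau * kap))).
    by rewrite ler_wpM2l// mulr_ge0 ?(ltW l0)//; lra.
  by rewrite mulrA ler_wpM2r.
Qed.

End perturbation.

(** * Lebesgue measure on boxes, topology and translations *)

Section sup_norm.
Context {R : realType} {n : nat}.
Implicit Types x : 'rV[R]_n.

Lemma rV_normE x : `|x| = \big[Num.max/0]_(ij : 'I_1 * 'I_n) `|x ij.1 ij.2|.
Proof. by rewrite -mx_normrE. Qed.

Lemma coord_le_norm x i : `|x ord0 i| <= `|x|.
Proof.
by rewrite rV_normE; apply: (le_bigmax _ (fun ij : 'I_1 * 'I_n => `|x ij.1 ij.2|) (ord0, i)).
Qed.

Lemma rV_norm_lt x e : 0 < e -> (forall i, `|x ord0 i| < e) -> `|x| < e.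
Proof.
move=> e0 h; rewrite rV_normE; apply/bigmax_ltP; split => //= -[i j] _ /=.
by rewrite (ord1 i).
Qed.

Lemma rV_norm_le x e : 0 <= e -> (forall i, `|x ord0 i| <= e) -> `|x| <= e.
Proof.
move=> e0 h; rewrite rV_normE; apply/bigmax_leP; split => //= -[i j] _ /=.
by rewrite (ord1 i).
Qed.

End sup_norm.

Section boxes.
Context {R : realType} {n : nat}.
Local Notation mu := (@lebesgue_rV R n).

Definition obox (a b : 'rV[R]_n) : set 'rV[R]_n :=
  [set x | forall i, a ord0 i < x ord0 i < b ord0 i].

Definition oboxes : set (set 'rV[R]_n) := [set A | exists a b, A = obox a b].

Lemma oboxI a b a' b' : obox a b `&` obox a' b' =
  obox (\row_i Num.max (a ord0 i) (a' ord0 i)) (\row_i Num.min (b ord0 i) (b' ord0 i)).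
Proof.
apply/seteqP; split => x /=.
  move=> [h1 h2] i; have /andP[? ?] := h1 i; have /andP[? ?] := h2 i.
  by rewrite !mxE gt_max lt_min; apply/andP; split; apply/andP; split.
move=> h; split=> i; have := h i; rewrite !mxE gt_max lt_min;
  by move=> /andP[/andP[? ?] /andP[? ?]]; apply/andP; split.
Qed.

Lemma oboxes_setI_closed : setI_closed oboxes.
Proof. by move=> _ _ [a [b ->]] [a' [b' ->]]; rewrite oboxI; do 2 eexists. Qed.

Lemma obox_measure a b : measurable (obox a b) /\
  mu (obox a b) = (\prod_(i < n) Num.max 0 (b ord0 i - a ord0 i))%:E.
Proof.
have [] := @lebesgue_rV_box R n (fun i => [set` `]a ord0 i, b ord0 i[]).
  by move=> i; exact: measurable_itv.
rewrite (_ : [set _ | _] = obox a b); last first.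
  apply/seteqP; split => x /= h i; have := h i; rewrite ?in_itv//=.
move=> mB ->; split => //; rewrite -prodEFin; apply: eq_bigr => i _.
rewrite lebesgue_measure_itv /= lte_fin; case: ltP => h.
  by rewrite -EFinB max_r// subr_ge0 ltW.
by rewrite max_l// subr_le0.
Qed.

Lemma measurable_obox a b : measurable (obox a b).
Proof. by case: (obox_measure a b). Qed.

Lemma obox_cover : \bigcup_k obox (const_mx (- k%:R)) (const_mx k%:R) = [set: 'rV[R]_n].
Proof.
apply/seteqP; split => // x _.
exists (Num.bound (\sum_i `|x ord0 i|)) => // i; rewrite !mxE -ltr_norml.
apply: le_lt_trans (archi_boundP _); last by apply: sumr_ge0.
by rewrite (bigD1 i)//= lerDl; apply: sumr_ge0.
Qed.

(** A half-space bounded by a coordinate hyperplane is a countable union of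
    boxes. *)
Lemma measurable_rVE : measurable = <<s oboxes>> :> set (set 'rV[R]_n).
Proof.
apply/seteqP; split; last first.
  apply: smallest_sub; first exact: sigma_algebra_measurable.
  by move=> _ [a [b ->]]; exact: measurable_obox.
apply: smallest_sub; first exact: smallest_sigma_algebra.
rewrite -bigcup_seq => _ [i _ [C mC <-]]; rewrite setTI.
have mi : @measurable_fun _ _ (g_sigma_algebraType oboxes) R setT (rV_coord i).
  apply: (measurability _ (RGenOInfty.measurableE R)) => //.
  move=> _ [_ [x ->] <-]; rewrite setTI.
  rewrite (_ : _ @^-1` _ = \bigcup_k obox
      (\row_j (if j == i then x else - k%:R)) (const_mx k%:R)).
    by apply: bigcupT_measurable => k; apply: sub_sigma_algebra; do 2 eexists.
  apply/seteqP; split => y /=; rewrite in_itv/= andbT /rV_coord.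
    move=> xy; have : (\bigcup_k obox (const_mx (- k%:R)) (const_mx k%:R)) y.
      by rewrite obox_cover.
    move=> [k _ hk]; exists k => // j; have := hk j; rewrite !mxE.
    by case: eqP => [->|//]; rewrite xy => /andP[].
  by move=> [k _ /(_ i)]; rewrite !mxE eqxx => /andP[].
by have := mi measurableT C mC; rewrite setTI.
Qed.

(** The boxes with rational centre and radius [1 / (k + 1)]: the same countable
    family serves all open sets. *)
Lemma open_box_cover : exists a b : 'rV[rat]_n * nat -> 'rV[R]_n,
  forall U : set 'rV[R]_n, open U -> U = \bigcup_p
    (if `[< forall x : 'rV[R]_n, (forall i, a p ord0 i <= x ord0 i <= b p ord0 i) -> U x >]
     then obox (a p) (b p) else set0).
Proof.
pose a (p : 'rV[rat]_n * nat) : 'rV[R]_n := \row_i (ratr (p.1 ord0 i) - p.2.+1%:R^-1).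
pose b (p : 'rV[rat]_n * nat) : 'rV[R]_n := \row_i (ratr (p.1 ord0 i) + p.2.+1%:R^-1).
exists a, b => U oU.
apply/seteqP; split => [x Ux|x [p _]]; last first.
  case: asboolP => // h hx; apply: h => i.
  by have /andP[? ?] := hx i; apply/andP; split; exact: ltW.
have /nbhs_ballP[e /= e0 he] : nbhs x U by apply: open_nbhs_nbhs.
have [k hk] : exists k : nat, 2 * k.+1%:R^-1 < e.
  have [k hk] := inv_nat_lt (divr_gt0 e0 (ltr0n R 2)).
  by exists k; have := hk k (leqnn _); rewrite ltr_pdivlMr// mulrC.
have k0 : (0 : R) < k.+1%:R^-1 by rewrite invr_gt0.
have /choice[r hr] : forall i, exists r : rat, x ord0 i - k.+1%:R^-1 < ratr r < x ord0 i + k.+1%:R^-1.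
  move=> i; have /rat_in_itvoo[r] : x ord0 i - k.+1%:R^-1 < x ord0 i + k.+1%:R^-1.
    by rewrite ltrBlDr -addrA ltrDl addr_gt0.
  by rewrite in_itv /= => h; exists r.
exists (\row_i r i, k) => //; rewrite asboolT.
  move=> i; rewrite !mxE.
  by have := hr i; move: (k.+1%:R^-1) => c /andP[? ?]; apply/andP; split; lra.
move=> y By; apply: he; rewrite mx_norm_ball /ball_ /=.
apply: rV_norm_lt => // j.
rewrite !mxE; have := By j; have := hr j; rewrite !mxE ltr_norml.
by move: (k.+1%:R^-1) hk => c hk /andP[? ?] /andP[? ?]; apply/andP; split; lra.
Qed.

Lemma open_measurable_rV (U : set 'rV[R]_n) : open U -> measurable U.
Proof.
move=> oU; have [a [b /(_ _ oU) ->]] := open_box_cover.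
apply: countable_bigcupT_measurable => [|p]; first exact: countableP.
by case: ifP => // _; exact: measurable_obox.
Qed.

Lemma continuous_measurable_rV (f : 'rV[R]_n -> R) : continuous f -> measurable_fun setT f.
Proof.
move=> /continuousP cf.
apply: (measurability _ (RGenOpens.measurableE R)).
move=> _ [_ [a [b ->] <-]]; rewrite setTI; apply: open_measurable_rV.
exact/cf/interval_open.
Qed.

Definition rV_shift (t x : 'rV[R]_n) := x + t.

Lemma measurable_rV_shift t : measurable_fun setT (rV_shift t).
Proof.
apply: measurable_fun_rV => i; under eq_fun do rewrite mxE.
by apply: measurable_funD => //; exact: measurable_rV_coord.
Qed.

HB.instance Definition _ t := isMeasurableFun.Build _ _ _ _ _ (measurable_rV_shift t).

(** Both sides are measures that agree on boxes, and boxes are stable under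
    intersection and generate the Borel sets. *)
Lemma lebesgue_rV_shift t (A : set 'rV[R]_n) : measurable A ->
  mu (rV_shift t @^-1` A) = mu A.
Proof.
have E a b : mu (rV_shift t @^-1` obox a b) = mu (obox a b).
  rewrite (_ : _ @^-1` _ = obox (a - t) (b - t)).
    have [_ ->] := obox_measure (a - t) (b - t); have [_ ->] := obox_measure a b.
    by congr (_%:E); apply: eq_bigr => i _; rewrite !mxE; congr (Num.max _ _); ring.
  apply/seteqP; split => x /= h i; have := h i; rewrite !mxE ltrBlDr ltrBrDr//.
apply: (@measure_unique _ _ _ oboxes (fun k => obox (const_mx (- k%:R)) (const_mx k%:R))
  measurable_rVE oboxes_setI_closed _ obox_cover (pushforward mu (rV_shift t)) mu).
- by move=> i; do 2 eexists.
- by move=> _ [a [b ->]]; exact: E.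
- by move=> k; rewrite /= /pushforward E (obox_measure _ _).2 ltry.
Qed.

Local Open Scope ereal_scope.
Lemma ge0_integral_rV_shift t (f : 'rV[R]_n -> \bar R) (D : set 'rV[R]_n) :
  measurable D -> measurable_fun D f -> (forall x, D x -> 0 <= f x) ->
  \int[mu]_(x in D) f x = \int[mu]_(x in rV_shift t @^-1` D) f (x + t)%R.
Proof.
move=> mD mf f0.
rewrite -(ge0_integral_pushforward (measurable_rV_shift t) mu mD mf).
  apply: eq_measure_integral => A mA _; exact/esym/lebesgue_rV_shift.
by move=> x; rewrite inE; exact: f0.
Qed.

Lemma integral_rV_shift t (f : 'rV[R]_n -> R) :
  mu.-integrable setT (EFin \o f) ->
  mu.-integrable setT (EFin \o (fun x => f (x + t)%R)) /\
  \int[mu]_x (f (x + t)%R)%:E = \int[mu]_x (f x)%:E.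
Proof.
move=> fi.
have mf := measurable_int _ fi.
have [/integrableP[_ fy]] := fi.
have mft : measurable_fun setT (EFin \o (fun x => f (x + t)%R)).
  exact: (measurableT_comp mf (measurable_rV_shift t)).
have fit : mu.-integrable setT (EFin \o (fun x => f (x + t)%R)).
  apply/integrableP; split => //.
  have := @ge0_integral_rV_shift t (fun x => `|(f x)%:E|) setT measurableT _ _.
  rewrite preimage_setT => <- //.
  exact: measurableT_comp.
split => //.
rewrite [RHS](@eq_measure_integral _ _ _ _ (pushforward mu (rV_shift t))).
  rewrite (integral_pushforward (measurable_rV_shift t))//.
by move=> A mA _; exact/esym/lebesgue_rV_shift.
Qed.

Local Close Scope ereal_scope.

Lemma obox_gt0 (a b : 'rV[R]_n) : (forall i, a ord0 i < b ord0 i) -> (0 < mu (obox a b))%E.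
Proof.
move=> ab; rewrite (obox_measure a b).2 lte_fin; apply: prodr_gt0 => i _.
by rewrite lt_max subr_gt0 ab orbT.
Qed.

Lemma bounded_measure_finite (A : set 'rV[R]_n) : measurable A -> bounded_set A -> (mu A < +oo)%E.
Proof.
move=> mA [M [Mr hM]].
have AB : A `<=` obox (const_mx (- (`|M| + 2))) (const_mx (`|M| + 2)).
  move=> x Ax i; rewrite !mxE -ltr_norml.
  have := hM (`|M| + 1) _ x Ax; rewrite (le_lt_trans (ler_norm M)) ?ltrDl// => /(_ isT).
  move=> h; apply: (@le_lt_trans _ _ (`|M| + 1)); last by rewrite ltrD2l ltr1n.
  exact: le_trans (coord_le_norm _ _) h.
apply: (@le_lt_trans _ _ (mu (obox (const_mx (- (`|M| + 2))) (const_mx (`|M| + 2))))).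
  by apply: le_measure; rewrite ?inE//; exact: measurable_obox.
by rewrite (obox_measure _ _).2 ltry.
Qed.

End boxes.

(** * Smooth functions *)

Section directional.
Context {R : realType} {n : nat}.
Implicit Types (f g : 'rV[R]_n -> R) (x v : 'rV[R]_n).

Local Notation ei i := (delta_mx ord0 i : 'rV[R]_n).

Lemma is_deriveP (V : normedModType R) (f : V -> R) (x v : V) d : is_derive x v f d <->
  (fun h : R => h^-1 * (f (h *: v + x) - f x)) @ 0^' --> d.
Proof.
split=> [[df <-]//|h].
by apply: DeriveDef; [apply/cvg_ex; exists d|exact: cvg_lim].
Qed.

Lemma is_derive_line (V : normedModType R) (f : V -> R) (x v : V) d t :
  is_derive (t *: v + x) v f d <-> is_derive (t : R) 1 (fun s : R => f (s *: v + x)) d.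
Proof.
have E : (fun h : R => h^-1 * (f (h *: v + (t *: v + x)) - f (t *: v + x))) =
    (fun h : R => h^-1 * (f ((h *: 1 + t) *: v + x) - f (t *: v + x))).
  by apply/funext => h; rewrite [h *: 1]mulr1 scalerDl addrA.
by split=> /is_deriveP h; apply/is_deriveP; [rewrite -E|rewrite E].
Qed.

Lemma mean_value (g dg : R -> R) (r : R) : (forall t : R, is_derive t 1 g (dg t)) ->
  exists2 c, `|c| <= `|r| & g r - g 0 = dg c * r.
Proof.
move=> gd; have cg a b : {within `[a, b], continuous g}.
  apply: continuous_subspaceT => t; apply: differentiable_continuous.
  by apply/derivable1_diffP; case: (gd t).
have [r0|r0|->] := ltgtP r 0; last by exists 0; rewrite ?mulr0 ?subrr.
  have [c] := MVT r0 (fun t _ => gd t) (cg _ _).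
  rewrite in_itv/= => /andP[rc c0]; rewrite sub0r mulrN => h; exists c.
    by rewrite !ltr0_norm// lerN2 ltW.
  by rewrite -opprB h opprK.
have [c] := MVT r0 (fun t _ => gd t) (cg _ _).
rewrite in_itv/= => /andP[c0 cr]; rewrite subr0 => h; exists c => //.
by rewrite !gtr0_norm// ltW.
Qed.

(** The increment along [k *: e] is computed by the mean value theorem, and its
    limit by the continuity of the derivative along [e]. *)
Lemma is_derive_add_direction f x u e (k d : R) : is_derive x u f d ->
  (forall y, derivable f y e) -> {for x, continuous (fun y => 'D_e f y)} ->
  is_derive x (u + k *: e) f (d + k * 'D_e f x).
Proof.
move=> /is_deriveP fu fe ce; apply/is_deriveP.
have /choice[xi Hxi] : forall h : R, exists c, `|c| <= `|h * k| /\
    f (h *: (u + k *: e) + x) - f (h *: u + x) = 'D_e f (c *: e + (h *: u + x)) * (h * k).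
  move=> h; pose g (t : R) := f (t *: e + (h *: u + x)).
  have gd (t : R) : is_derive t 1 g ('D_e f (t *: e + (h *: u + x))).
    apply: (@is_derive_line _ f (h *: u + x) e _ t).1.
    exact: derivableP (fe _).
  have [c hc gE] := mean_value (h * k) gd; exists c; split => //.
  rewrite -gE /g scale0r add0r; congr (f _ - _).
  by rewrite scalerDr scalerA addrCA addrA.
have xi0 : xi h @[h --> 0^'] --> (0 : R).
  apply/cvgrPdist_le => e' e'0; near=> h; rewrite sub0r normrN.
  apply: le_trans (Hxi h).1 _; rewrite normrM.
  have : `|h| <= e' / (`|k| + 1).
    near: h; apply: (@dnbhs0_le _ R); by rewrite divr_gt0// ltr_wpDl.
  rewrite ler_pdivlMr; last by rewrite ltr_wpDl.
  by apply: le_trans; rewrite ler_wpM2l// lerDl.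
have id0 : (h : R) @[h --> 0^'] --> (0 : R) by exact: cvg_within.
have L : xi h *: e + (h *: u + x) @[h --> 0^'] --> x.
  rewrite -[X in _ --> X](_ : 0 *: e + (0 *: u + x) = _); last first.
    by rewrite !scale0r !add0r.
  apply: cvgD; first exact: cvgZr_tmp.
  by apply: cvgD; [exact: cvgZr_tmp|exact: cvg_cst].
have key : 'D_e f (xi h *: e + (h *: u + x)) @[h --> 0^'] --> 'D_e f x.
  exact: (cvg_comp _ _ L ce).
have E : {near (0:R)^', (fun h : R => h^-1 * (f (h *: u + x) - f x) +
     k * 'D_e f (xi h *: e + (h *: u + x))) =1
    (fun h : R => h^-1 * (f (h *: (u + k *: e) + x) - f x))}.
  near=> h => /=.
  have h0 : h != 0 by near: h; exact: nbhs_dnbhs_neq.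
  have := (Hxi h).2 => E; have -> : f (h *: (u + k *: e) + x) - f x =
    (f (h *: (u + k *: e) + x) - f (h *: u + x)) + (f (h *: u + x) - f x) by ring.
  by rewrite E; field.
apply: cvg_trans; first exact: (near_eq_cvg E).
apply: cvgD; first exact: fu.
exact: cvgMl_tmp.
Unshelve. all: by end_near. Qed.

Lemma is_derive_partials f x v :
  (forall i y, derivable f y (ei i)) -> (forall i, continuous (pderiv i f)) ->
  is_derive x v f (\sum_i v ord0 i * pderiv i f x).
Proof.
move=> df cf; rewrite {1}(row_sum_delta v).
elim: (index_enum _) => [|i s IH]; first by rewrite !big_nil; exact: is_derive0.
rewrite !big_cons addrC [_ * _ + _]addrC; apply: is_derive_add_direction => //.
exact: cf.
Qed.

(** Smoothness is proved by exhibiting a class of differentiable functions that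
    contains its partial derivatives. *)
Lemma smooth_class (P : set ('rV[R]_n -> R)) :
  (forall f, P f -> continuous f /\ forall i x, derivable f x (ei i)) ->
  (forall f i, P f -> P (pderiv i f)) -> forall f, P f -> smooth f.
Proof.
move=> Pc Pd f Pf s; apply: Pc.
by elim: s => //= i s; exact: Pd.
Qed.

Lemma smooth_continuous f : smooth f -> continuous f.
Proof. by move=> /(_ [::])[]. Qed.

Lemma smooth_derivable f i x : smooth f -> derivable f x (ei i).
Proof. by move=> /(_ [::])[_]; exact. Qed.

Lemma smooth_pderiv f i : smooth f -> smooth (pderiv i f).
Proof. by move=> sf s; have := sf (rcons s i); rewrite foldr_rcons. Qed.

Lemma smooth_derive f x v : smooth f -> is_derive x v f (\sum_i v ord0 i * pderiv i f x).
Proof.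
move=> sf; apply: is_derive_partials => i; first by move=> y; exact: smooth_derivable.
exact/smooth_continuous/smooth_pderiv.
Qed.

Lemma pderivM f g i : smooth f -> smooth g ->
  pderiv i (f \* g) = (pderiv i f \* g) \+ (f \* pderiv i g).
Proof.
move=> sf sg; apply/funext => x; rewrite /pderiv deriveM; try exact: smooth_derivable.
by rewrite /= addrC mulrC.
Qed.

Lemma pderiv_cst k i : pderiv i (cst k : 'rV[R]_n -> R) = cst 0.
Proof. by apply/funext => x; rewrite /pderiv derive_cst. Qed.

(** By the Leibniz rule the algebra generated by smooth functions is stable
    under partial derivatives. *)
Inductive smooth_alg : ('rV[R]_n -> R) -> Prop :=
| smooth_alg_base f of smooth f : smooth_alg f
| smooth_alg_add f g of smooth_alg f & smooth_alg g : smooth_alg (f \+ g)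
| smooth_alg_mul f g of smooth_alg f & smooth_alg g : smooth_alg (f \* g).

Lemma smooth_alg_smooth f : smooth_alg f -> smooth f.
Proof.
have der g : smooth_alg g -> continuous g /\ forall i x, derivable g x (ei i).
  elim=> [{}g sg|g1 g2 _ [c1 d1] _ [c2 d2]|g1 g2 _ [c1 d1] _ [c2 d2]].
  - by split; [exact: smooth_continuous|move=> i x; exact: smooth_derivable].
  - split; first by move=> x; exact: (cvgD (c1 x) (c2 x)).
    by move=> i x; exact: derivableD.
  - split; first by move=> x; exact: (cvgM (c1 x) (c2 x)).
    by move=> i x; exact: derivableM.
apply: smooth_class => // g i; elim=> [{}g sg|g1 g2 h1 d1 h2 d2|g1 g2 h1 d1 h2 d2].
- exact/smooth_alg_base/smooth_pderiv.
- rewrite (_ : pderiv i _ = pderiv i g1 \+ pderiv i g2); first exact: smooth_alg_add.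
  apply/funext => x; rewrite /pderiv deriveD//.
    by case: (der _ h1).
  by case: (der _ h2).
- rewrite (_ : pderiv i _ = (pderiv i g1 \* g2) \+ (g1 \* pderiv i g2)).
    by apply: smooth_alg_add; exact: smooth_alg_mul.
  apply/funext => x; rewrite /pderiv deriveM; first by rewrite /= addrC mulrC.
    by case: (der _ h1).
  by case: (der _ h2).
Qed.

Lemma smoothD f g : smooth f -> smooth g -> smooth (f \+ g).
Proof.
by move=> sf sg; apply: smooth_alg_smooth; apply: smooth_alg_add; exact: smooth_alg_base.
Qed.

Lemma smoothM f g : smooth f -> smooth g -> smooth (f \* g).
Proof.
by move=> sf sg; apply: smooth_alg_smooth; apply: smooth_alg_mul; exact: smooth_alg_base.
Qed.

Lemma smooth_cst k : smooth (cst k : 'rV[R]_n -> R).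
Proof.
apply: (smooth_class (P := [set f | exists k, f = cst k])) => [_ [k' ->]|_ i [k' ->]|].
- split; first exact: cst_continuous.
  by move=> i x; exact: derivable_cst.
- by exists 0; exact: pderiv_cst.
- by exists k.
Qed.

Lemma smoothZ k f : smooth f -> smooth (cst k \* f).
Proof. by move=> sf; apply: smoothM => //; exact: smooth_cst. Qed.

Lemma smooth_prod (I : Type) (s : seq I) (F : I -> 'rV[R]_n -> R) :
  (forall i, smooth (F i)) -> smooth (fun x => \prod_(i <- s) F i x).
Proof.
move=> sF; elim: s => [|i s IH].
  rewrite (_ : (fun _ => _) = cst 1); first exact: smooth_cst.
  by apply/funext => x; rewrite big_nil.
rewrite (_ : (fun _ => _) = F i \* (fun x => \prod_(j <- s) F j x)).
  exact: smoothM.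
by apply/funext => x; rewrite big_cons.
Qed.

(** * Supports *)

Lemma supp_out f x : ~ supp f x -> f x = 0.
Proof.
move=> h; apply/eqP/negP => /negP fx; apply: h; apply: subset_closure; exact: fx.
Qed.

Lemma supp_near f x : ~ supp f x -> \forall y \near x, f y = 0.
Proof.
move=> h; have := open_nbhs_nbhs (conj (closed_openC (@closed_closure _ [set x | f x != 0])) h).
apply: filterS => y; exact: supp_out.
Qed.

Lemma supp_sub f (C : set 'rV[R]_n) : closed C -> (forall x, ~ C x -> f x = 0) -> supp f `<=` C.
Proof.
move=> cC h; rewrite /supp closureE => x; apply; split => // y /= fy.
by apply: contrapT => /h; apply/eqP.
Qed.

Lemma supp_pderiv f i : supp (pderiv i f) `<=` supp f.
Proof.
apply: supp_sub; first exact: closed_closure.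
move=> x /supp_near h; rewrite /pderiv (near_eq_derive _ (g := cst 0)).
  exact: derive_cst.
by [].
Qed.

Lemma supp_mul f g : supp (f \* g) `<=` supp f.
Proof.
apply: supp_sub; first exact: closed_closure.
by move=> x /supp_out /= ->; rewrite mul0r.
Qed.

Lemma supp_add f g : supp (f \+ g) `<=` supp f `|` supp g.
Proof.
apply: supp_sub; first by apply: closedU; exact: closed_closure.
by move=> x /not_orP[/supp_out h1 /supp_out h2] /=; rewrite h1 h2 addr0.
Qed.

Lemma closed_sub_compact (A B : set 'rV[R]_n) : closed A -> compact B -> A `<=` B -> compact A.
Proof. by move=> cA cB AB; exact: subclosed_compact cB AB. Qed.

Lemma test_mul U f g : smooth g -> test_function U f -> test_function U (f \* g).
Proof.
move=> sg [sf cf fU]; split; first exact: smoothM.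
  by apply: (closed_sub_compact (@closed_closure _ _) cf); exact: supp_mul.
exact: subset_trans (@supp_mul f g) fU.
Qed.

Lemma test_add U f g : test_function U f -> test_function U g -> test_function U (f \+ g).
Proof.
move=> [sf cf fU] [sg cg gU]; split; first exact: smoothD.
  apply: (closed_sub_compact (@closed_closure _ _) (compactU cf cg)).
  exact: supp_add.
by apply: subset_trans (@supp_add f g) _ => x [/fU|/gU].
Qed.

Lemma test_scale U k f : test_function U f -> test_function U (cst k \* f).
Proof.
rewrite (_ : cst k \* f = f \* cst k); last by apply/funext => x; rewrite /= mulrC.
by move=> tf; apply: test_mul => //; exact: smooth_cst.
Qed.

Lemma test_sub U U' f : U `<=` U' -> test_function U f -> test_function U' f.
Proof. by move=> UU' [sf cf fU]; split => //; exact: subset_trans UU'. Qed.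

Lemma test_cst0 U : test_function U (cst 0 : 'rV[R]_n -> R).
Proof.
have s0 : supp (cst 0 : 'rV[R]_n -> R) = set0.
  rewrite /supp (_ : [set _ | _] = set0) ?closure0//.
  by apply/seteqP; split => x //=; rewrite eqxx.
split; first exact: smooth_cst.
  by rewrite s0; exact: compact0.
by rewrite s0.
Qed.

Lemma compact_support_bounded f : continuous f -> compact (supp f) ->
  exists M, forall x, `|f x| <= M.
Proof.
move=> cf cs; have : compact (f @` supp f).
  by apply: continuous_compact => //; exact: continuous_subspaceT.
move/compact_bounded => [M [Mr hM]]; exists (`|M| + 1) => x.
have [sx|/supp_out ->] := pselect (supp f x); last by rewrite normr0 addr_ge0.
apply: (hM (`|M| + 1)); last by exists x.
by rewrite (le_lt_trans (ler_norm M))// ltrDl.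
Qed.

End directional.

(** * Bump functions *)

Section cutoff.
Context {R : realType}.

Lemma power_le_expR (s : R) m : 0 < s ->
  exists2 C : R, 0 <= C & forall y, 0 <= y -> y ^+ m <= C * expR (s * y).
Proof.
move=> s0; case: m => [|m].
  exists 1 => // y y0; rewrite expr0 mul1r; apply: le_trans (expR_ge1Dx _).
  by rewrite lerDl mulr_ge0// ltW.
exists (m.+1`!%:R / s ^+ m.+1); first by rewrite divr_ge0// exprn_ge0// ltW.
move=> y y0; have := @expR_ge1Dxn R (s * y) m (mulr_ge0 (ltW s0) y0) => h.
have {}h : (s * y) ^+ m.+1 / m.+1`!%:R <= expR (s * y).
  by apply: le_trans h; rewrite lerDr.
have f0 : (0 : R) < m.+1`!%:R by rewrite ltr0n fact_gt0.
move: h; rewrite ler_pdivrMr// exprMn => h.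
rewrite -mulrA mulrCA ler_pdivlMl ?exprn_gt0//.
by rewrite [_`!%:R * _]mulrC.
Qed.

Lemma poly_le_expR (P : {poly R}) (s : R) : 0 < s ->
  exists2 C : R, 0 <= C & forall y, 0 <= y -> `|P.[y]| <= C * expR (s * y).
Proof.
elim/poly_ind: P s => [|P c IH] s s0.
  by exists 0 => // y _; rewrite horner0 normr0 mul0r.
have s2 : 0 < s / 2 by rewrite divr_gt0.
have [C C0 hC] := IH _ s2; have [D D0 hD] := power_le_expR 1 s2.
exists (C * D + `|c|); first by rewrite addr_ge0// mulr_ge0.
move=> y y0; rewrite hornerMXaddC mulrDl; apply: le_trans (ler_normD _ _) _.
apply: lerD.
  rewrite normrM (ger0_norm y0).
  have -> : C * D * expR (s * y) = (C * expR (s / 2 * y)) * (D * expR (s / 2 * y)).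
    have -> : s * y = s / 2 * y + s / 2 * y by field.
    by rewrite expRD; ring.
  by apply: ler_pM => //; [exact: hC|have := hD _ y0; rewrite expr1].
rewrite -[leLHS]mulr1 ler_wpM2l//; apply: le_trans (expR_ge1Dx _).
by rewrite lerDl mulr_ge0// ltW.
Qed.

(** The functions [P(1/t) exp(-s/t)] on the positive axis, extended by 0: a
    family that is closed under derivation. *)
Definition flat (s : R) (P : {poly R}) (t : R) : R :=
  if 0 < t then P.[t^-1] * expR (- (s * t^-1)) else 0.

(** The quadratic bound at the origin gives differentiability there. *)
Lemma flat_bound s P : 0 < s -> exists2 C, 0 <= C & forall t, `|flat s P t| <= C * t ^+ 2.
Proof.
move=> s0; have [C C0 hC] := poly_le_expR (P * 'X^2) s0; exists C => // t.
rewrite /flat; case: ltP => [t0|_]; last by rewrite normr0 mulr_ge0// sqr_ge0.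
have ti : 0 <= t^-1 by rewrite invr_ge0 ltW.
have := hC _ ti; rewrite hornerM hornerXn normrM (ger0_norm (sqr_ge0 _)) => h.
rewrite normrM (ger0_norm (expR_ge0 _)) expRN ler_pdivrMr ?expR_gt0//.
have -> : C * t ^+ 2 * expR (s * t^-1) = t ^+ 2 * (C * expR (s * t^-1)) by ring.
apply: le_trans (ler_wpM2l (sqr_ge0 t) h); rewrite exprVn mulrCA divff ?mulr1//.
by rewrite expf_neq0// gt_eqF.
Qed.

Lemma is_derive_inv (t : R) : t != 0 -> is_derive t 1 (fun u : R => u^-1) (- t ^- 2).
Proof.
move=> t0; have d1 : derivable (id : R -> R) t 1 by exact: derivable_id.
apply: DeriveDef; first exact: (@derivableV _ _ id t 1).
by rewrite (@deriveV _ _ id t 1)// derive_id [_ *: 1]mulr1.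
Qed.

Lemma flat_derive s P (t : R) : 0 < s ->
  is_derive t 1 (flat s P) (flat s (s *: ('X^2 * P) - 'X^2 * P^`()) t).
Proof.
move=> s0; have [t0|t0|->] := ltgtP t 0.
- rewrite {2}/flat ltNge (ltW t0) /=.
  apply: (@near_eq_is_derive _ _ _ (cst 0)).
    near=> u; rewrite /flat ltNge (_ : u <= 0)//=.
    by apply: ltW; near: u; exact: lt_nbhsl.
- rewrite {2}/flat t0.
  have near_pos : \near t, P.[t^-1] * expR (- (s * t^-1)) = flat s P t.
    by near=> u; rewrite /flat (_ : 0 < u)//; near: u; exact: lt_nbhsr.
  apply: (near_eq_is_derive near_pos).
  have tn : t != 0 by rewrite gt_eqF.
  have d1 := is_derive_inv tn.
  have d2 : is_derive t 1 (fun u : R => P.[u^-1]) (P^`().[t^-1] * (- t ^- 2)).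
    exact: (@is_derive1_comp _ (horner P) (fun u => u^-1)).
  have d3 : is_derive t 1 (fun u : R => - (s * u^-1)) (s * t ^- 2).
    rewrite (_ : (fun u : R => _) = (- s) \*: (fun u : R => u^-1)).
      by apply: is_derive_eq; rewrite /GRing.scale /= mulrNN.
    by apply/funext => u; rewrite /= /GRing.scale /= mulNr.
  have d4 : is_derive t 1 (fun u : R => expR (- (s * u^-1)))
      (expR (- (s * t^-1)) * (s * t ^- 2)).
    exact: (@is_derive1_comp _ expR (fun u => - (s * u^-1))).
  have d5 := is_deriveM d2 d4.
  apply: (is_derive_eq d5).
  rewrite !hornerE /GRing.scale /=.
  by move: (expR _) (P.[_]) (P^`().[_]) => E A B; field.
rewrite {2}/flat ltxx; apply/is_deriveP.
have [C C0 hC] := flat_bound P s0.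
apply/cvgrPdist_le => e e0; near=> h; rewrite sub0r normrN addr0 [h *: 1]mulr1.
rewrite {2}/flat ltxx subr0 normrM normfV.
have h0 : h != 0 by near: h; exact: nbhs_dnbhs_neq.
rewrite ler_pdivrMl ?normr_gt0//; apply: le_trans (hC h) _.
rewrite -real_normK ?num_real// expr2 mulrCA ler_wpM2l//.
have : `|h| <= e / (C + 1).
  by near: h; apply: (@dnbhs0_le _ R); rewrite divr_gt0// ltr_wpDl.
rewrite ler_pdivlMr; last by rewrite ltr_wpDl.
by rewrite mulrC; apply: le_trans; rewrite ler_wpM2r// lerDl.
Unshelve. all: by end_near. Qed.

Lemma flat_continuous s P : 0 < s -> continuous (flat s P).
Proof.
move=> s0 t; apply: differentiable_continuous; apply/derivable1_diffP.
by case: (flat_derive P t s0).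
Qed.

(** The parameter [s] is meant to tend to 0, where [exp(-s/t)] increases to the
    indicator of the positive axis. *)
Definition cutoff (s t : R) := flat s 1 t.

Lemma cutoffE s t : cutoff s t = if 0 < t then expR (- (s * t^-1)) else 0.
Proof. by rewrite /cutoff /flat hornerE mul1r. Qed.

Lemma cutoff_ge0 s t : 0 <= cutoff s t.
Proof. by rewrite cutoffE; case: ifP => // _; exact: expR_ge0. Qed.

Lemma cutoff_gt0 s t : 0 < t -> 0 < cutoff s t.
Proof. by rewrite cutoffE => ->; exact: expR_gt0. Qed.

Lemma cutoff_le1 s t : 0 < s -> cutoff s t <= 1.
Proof.
move=> s0; rewrite cutoffE; case: ltP => // t0.
by rewrite expR_le1 oppr_le0 mulr_ge0 ?invr_ge0// ltW.
Qed.

Lemma cutoff_out s t : t <= 0 -> cutoff s t = 0.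
Proof. by rewrite cutoffE ltNge => ->. Qed.

Lemma cutoff_cvg t : cutoff k.+1%:R^-1 t @[k --> \oo] --> ((0 < t)%R%:R : R).
Proof.
case: ltP => t0; last first.
  by under eq_cvg do rewrite cutoff_out//; exact: cvg_cst.
under eq_cvg do rewrite cutoffE t0.
have L : - (k.+1%:R^-1 * t^-1) @[k --> \oo] --> (0 : R).
  rewrite -[X in _ --> X]oppr0; apply: cvgN.
  rewrite -[X in _ --> X](mul0r t^-1); apply: cvgMr_tmp.
  exact: cvg_harmonic.
have := cvg_comp _ _ L (@continuous_expR R 0).
by rewrite expR0.
Qed.

End cutoff.

Section bumps.
Context {R : realType} {n : nat}.
Local Notation ei i := (delta_mx ord0 i : 'rV[R]_n).

Lemma smooth_flat_coord (s : R) P i (k c : R) : 0 < s ->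
  smooth (fun x : 'rV[R]_n => flat s P (k * x ord0 i + c)).
Proof.
move=> s0.
pose C := [set f : 'rV[R]_n -> R | exists Q, f = fun x => flat s Q (k * x ord0 i + c)].
have der Q j x : is_derive x (ei j) (fun x : 'rV[R]_n => flat s Q (k * x ord0 i + c))
    (k * (i == j)%:R * flat s (s *: ('X^2 * Q) - 'X^2 * Q^`()) (k * x ord0 i + c)).
  pose F (x : 'rV[R]_n) := flat s Q (k * x ord0 i + c).
  set d := k * _ * _.
  suff L : is_derive (0 : R) 1 (fun u : R => F (u *: ei j + x)) d.
    by have := (is_derive_line F x (ei j) d 0).2 L; rewrite scale0r add0r.
  pose g (u : R) := u * (k * (i == j)%:R) + (k * x ord0 i + c).
  have g0 : g 0 = k * x ord0 i + c by rewrite /g mul0r add0r.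
  rewrite (_ : (fun _ => _) = flat s Q \o g); last first.
    apply/funext => u; rewrite /F /g /=; congr (flat _ _ _).
    by rewrite !mxE eqxx /=; ring.
  have d1 : is_derive (0 : R) 1 g (k * (i == j)%:R).
    by apply: is_derive_eq; rewrite scaler0 add0r addr0 [_ *: 1]mulr1.
  have d2 := flat_derive Q (g 0) s0.
  by apply: is_derive_eq; rewrite g0 mulrC.
apply: (smooth_class (P := C)); last by exists P.
- move=> _ [Q ->]; split; last by move=> j x; case: (der Q j x).
  move=> x; have L : (k * y ord0 i + c) @[y --> x] --> k * x ord0 i + c.
    have h := @coord_continuous R 1 n ord0 i x.
    exact: (cvgD (cvgMl_tmp (a := k) h) (cvg_cst c)).
  exact: (cvg_comp _ _ L (@flat_continuous _ s Q s0 _)).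
- move=> _ j [Q ->]; exists ((k * (i == j)%:R) *: (s *: ('X^2 * Q) - 'X^2 * Q^`())).
  apply/funext => x; rewrite /pderiv; have [_ ->] := der Q j x.
  rewrite /flat; case: ifP => _; last by rewrite mulr0.
  by rewrite hornerZ mulrA.
Qed.

Definition bump (s : R) (a b x : 'rV[R]_n) : R :=
  \prod_(i < n) (cutoff s (x ord0 i - a ord0 i) * cutoff s (b ord0 i - x ord0 i)).

Lemma smooth_bump s a b : 0 < s -> smooth (bump s a b).
Proof.
move=> s0; apply: smooth_prod => i.
apply: (@smoothM _ _ (fun x => cutoff s (x ord0 i - a ord0 i))
  (fun x => cutoff s (b ord0 i - x ord0 i))).
  have := @smooth_flat_coord s 1 i 1 (- a ord0 i) s0.
  by under eq_fun do rewrite mul1r.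
have := @smooth_flat_coord s 1 i (-1) (b ord0 i) s0.
by under eq_fun do rewrite mulN1r addrC.
Qed.

Lemma bump_ge0 s a b x : 0 <= bump s a b x.
Proof. by apply: prodr_ge0 => i _; rewrite mulr_ge0 ?cutoff_ge0. Qed.

Lemma bump_le1 s a b x : 0 < s -> bump s a b x <= 1.
Proof.
move=> s0; rewrite -(big1_eq (op := *%R) (index_enum 'I_n) xpredT).
apply: ler_prod => i _; rewrite mulr_ge0 ?cutoff_ge0//=.
by rewrite mulr_ile1 ?cutoff_ge0 ?cutoff_le1.
Qed.

Lemma bump_gt0 s a b x : obox a b x -> 0 < bump s a b x.
Proof.
move=> h; apply: prodr_gt0 => i _; have /andP[? ?] := h i.
by rewrite mulr_gt0// cutoff_gt0// subr_gt0.
Qed.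

Lemma bump_out s a b x : ~ obox a b x -> bump s a b x = 0.
Proof.
move=> /existsNP[i /negP]; rewrite negb_and -!leNgt => /orP hi.
rewrite /bump (bigD1 i)//=; case: hi => hi.
  by rewrite (@cutoff_out _ _ (x ord0 i - _)) ?mul0r// subr_le0.
by rewrite (@cutoff_out _ _ (_ - x ord0 i)) ?mulr0 ?mul0r// subr_le0.
Qed.

Definition cbox (a b : 'rV[R]_n) : set 'rV[R]_n :=
  [set x | forall i, a ord0 i <= x ord0 i <= b ord0 i].

Lemma cbox_compact a b : compact (cbox a b).
Proof.
have := @rV_compact R n (fun i => [set` `[a ord0 i, b ord0 i]]).
rewrite (_ : [set _ | _] = cbox a b); first by apply => i; exact: segment_compact.
by apply/seteqP; split => x /= h i; have := h i; rewrite ?in_itv.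
Qed.

Lemma cbox_closed a b : closed (cbox a b).
Proof. by apply: compact_closed; [exact: norm_hausdorff|exact: cbox_compact]. Qed.

Lemma obox_cbox a b : obox a b `<=` cbox a b.
Proof. by move=> x h i; have /andP[? ?] := h i; apply/andP; split; exact: ltW. Qed.

Lemma test_bump s a b U : 0 < s -> cbox a b `<=` U -> test_function U (bump s a b).
Proof.
move=> s0 abU.
have sub : supp (bump s a b) `<=` cbox a b.
  apply: supp_sub; first exact: cbox_closed.
  by move=> x h; apply: bump_out => /obox_cbox.
split; first exact: smooth_bump.
  by apply: closed_sub_compact sub; [exact: closed_closure|exact: cbox_compact].
exact: subset_trans abU.
Qed.

Lemma bump_cvg a b x : bump k.+1%:R^-1 a b x @[k --> \oo] --> (\1_(obox a b) x : R).
Proof.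
have -> : (\1_(obox a b) x : R) = \prod_(i < n) (((0 < x ord0 i - a ord0 i)%R%:R : R) *
    (0 < b ord0 i - x ord0 i)%R%:R).
  rewrite indicE; have [h|h] := pselect (obox a b x).
    rewrite mem_set// big1// => i _; have /andP[h1 h2] := h i.
    by rewrite !subr_gt0 h1 h2 mulr1.
  rewrite memNset//; move: h => /existsNP[i /negP]; rewrite negb_and => hi.
  rewrite (bigD1 i)//= !subr_gt0; case/orP: hi => /negPf ->; by rewrite ?mulr0 !mul0r.
rewrite /bump; elim: (index_enum _) => [|i r IH].
  under eq_cvg do rewrite big_nil.
  by rewrite big_nil; exact: cvg_cst.
under eq_cvg do rewrite big_cons.
rewrite big_cons; apply: cvgM => //.
by apply: cvgM; exact: cutoff_cvg.
Qed.

End bumps.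

(** * Square integrable functions *)

Section L2_theory.
Context {R : realType} {n : nat}.
Local Notation mu := (@lebesgue_rV R n).
Implicit Types (u v w g : 'rV[R]_n -> R).
Variable D : set 'rV[R]_n.
Hypothesis mD : measurable D.

Lemma L2P u : L2 D u <->
  measurable_fun D u /\ mu.-integrable D (EFin \o (fun x => u x ^+ 2)).
Proof.
have sqE : (fun x => (u \_ D) x ^+ 2) = (fun x => u x ^+ 2) \_ D.
  by apply/funext => x; rewrite !patchE; case: ifP => // _; rewrite expr0n.
split=> [L2u|[mu_ iu]].
  have mu_ : measurable_fun D u.
    apply/(measurable_restrictT _ mD).
    by move: L2u; rewrite /L2 inE => /andP[/[!inE]].
  split => //; apply/(integrable_mkcond _ mD).
  by rewrite restrict_EFin -sqE; exact: Lfun2_integrable_sqr.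
have mr : measurable_fun setT (u \_ D) by exact/(measurable_restrictT _ mD).
rewrite /L2 inE; apply/andP; split; rewrite inE//=.
rewrite /finite_norm unlock poweR_lty//.
move/(integrable_mkcond _ mD) : iu; rewrite restrict_EFin -sqE => /integrableP[_].
apply: le_lt_trans; rewrite le_eqVlt; apply/orP; left; apply/eqP.
apply: eq_integral => x _; rewrite /= [in RHS]ger0_norm ?sqr_ge0//.
by rewrite powR_mulrn// real_normK// num_real.
Qed.

Lemma L2_measurable u : L2 D u -> measurable_fun D u.
Proof. by move=> /L2P[]. Qed.

Lemma L2_sq_integrable u : L2 D u -> mu.-integrable D (EFin \o (fun x => u x ^+ 2)).
Proof. by move=> /L2P[]. Qed.

Lemma L2_mul_integrable u v : L2 D u -> L2 D v ->
  mu.-integrable D (EFin \o (fun x => u x * v x)).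
Proof.
move=> Lu Lv; apply/(integrable_mkcond _ mD).
have := Lfun2_mul_Lfun1 Lu Lv; move/Lfun1_integrable.
rewrite restrict_EFin (_ : u \_ D \* v \_ D = (fun x => u x * v x) \_ D)//.
by apply/funext => x; rewrite /= !patchE; case: ifP => // _; rewrite mulr0.
Qed.

Lemma L2_closed k u v : L2 D u -> L2 D v -> L2 D (fun x => k * u x + v x).
Proof.
move=> Lu Lv; rewrite /L2 (_ : _ \_ D = k *: (u \_ D) + v \_ D).
  have p1 : (1 <= 2%:E :> \bar R)%E by rewrite lee_fin ler1n.
  by apply: (Lfun_submod_closed mu p1).2.
apply/funext => x; rewrite -[RHS]/(k * (u \_ D) x + (v \_ D) x) !patchE.
by case: ifP => // _; rewrite [point](_ : _ = 0)// mulr0 addr0.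
Qed.

Lemma L2_0 : L2 D (cst 0).
Proof.
have p1 : (1 <= 2%:E :> \bar R)%E by rewrite lee_fin ler1n.
rewrite /L2 (_ : (cst 0) \_ D = 0); first exact: (Lfun_submod_closed mu p1).1.
by apply/funext => x; rewrite patchE; case: ifP.
Qed.

Lemma L2D u v : L2 D u -> L2 D v -> L2 D (u \+ v).
Proof.
move=> Lu Lv; rewrite (_ : u \+ v = (fun x => 1 * u x + v x)); first exact: L2_closed.
by apply/funext => x; rewrite mul1r.
Qed.

Lemma L2Z k u : L2 D u -> L2 D (cst k \* u).
Proof.
move=> Lu; rewrite (_ : cst k \* u = (fun x => k * u x + cst 0 x)).
  exact: L2_closed Lu L2_0.
by apply/funext => x; rewrite addr0.
Qed.

Lemma L2B u v : L2 D u -> L2 D v -> L2 D (u \- v).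
Proof.
move=> Lu Lv; rewrite (_ : u \- v = u \+ (cst (-1) \* v)).
  by apply: L2D => //; exact: L2Z.
by apply/funext => x /=; rewrite mulN1r.
Qed.

Lemma dotL2C u v : dotL2 D u v = dotL2 D v u.
Proof. by apply: eq_Rintegral => x _; rewrite mulrC. Qed.

Lemma dotL2Dl u v w : L2 D u -> L2 D v -> L2 D w ->
  dotL2 D (u \+ v) w = dotL2 D u w + dotL2 D v w.
Proof.
move=> Lu Lv Lw; rewrite -RintegralD//; try exact: L2_mul_integrable.
by apply: eq_Rintegral => x _; rewrite /= mulrDl.
Qed.

Lemma dotL2Zl k u w : L2 D u -> L2 D w -> dotL2 D (cst k \* u) w = k * dotL2 D u w.
Proof.
move=> Lu Lw; rewrite -RintegralZl//; last exact: L2_mul_integrable.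
by apply: eq_Rintegral => x _; rewrite /= mulrA.
Qed.

Lemma dotL2Bl u v w : L2 D u -> L2 D v -> L2 D w ->
  dotL2 D (u \- v) w = dotL2 D u w - dotL2 D v w.
Proof.
move=> Lu Lv Lw; rewrite (_ : u \- v = u \+ (cst (-1) \* v)).
  by rewrite dotL2Dl ?dotL2Zl ?mulN1r//; exact: L2Z.
by apply/funext => x /=; rewrite mulN1r.
Qed.

Lemma dotL2_ge0 u : 0 <= dotL2 D u u.
Proof. by apply: Rintegral_ge0 => x _; rewrite -expr2 sqr_ge0. Qed.

Lemma dotL2_sqE u : L2 D u -> (dotL2 D u u)%:E = (\int[mu]_(x in D) (u x ^+ 2)%:E)%E.
Proof.
move=> Lu; rewrite /dotL2 /Rintegral fineK.
  by apply: eq_integral => x _; rewrite expr2.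
by have /integrable_fin_num := L2_mul_integrable Lu Lu; apply.
Qed.

Lemma ae_eq_L2 u v w : L2 D u -> L2 D v -> L2 D w -> ae_eq mu D u v ->
  dotL2 D u w = dotL2 D v w.
Proof.
move=> Lu Lv Lw uv; rewrite /dotL2 /Rintegral; congr fine.
apply: ae_eq_integral => //.
- by have /measurable_int := L2_mul_integrable Lu Lw.
- by have /measurable_int := L2_mul_integrable Lv Lw.
- by apply: filterS uv => x /= h Dx; rewrite h.
Qed.

Lemma dotL2_eq0 u : L2 D u -> dotL2 D u u = 0 <-> ae_eq mu D u (cst 0).
Proof.
move=> Lu; split=> [h|h]; last first.
  rewrite (ae_eq_L2 Lu L2_0 Lu h) /dotL2.
  under eq_Rintegral do rewrite mul0r.
  by rewrite /Rintegral integral0.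
have mf : measurable_fun D (fun x => (u x ^+ 2)%:E).
  by have /measurable_int := L2_sq_integrable Lu.
have : (\int[mu]_(x in D) `|(u x ^+ 2)%:E| = 0)%E.
  under eq_integral do rewrite gee0_abs ?lee_fin ?sqr_ge0//.
  by rewrite -dotL2_sqE// h.
move/(ae_eq_integral_abs _ mD mf); apply: filterS => x /= h' Dx.
by have /eqP := h' Dx; rewrite eqe sqrf_eq0 => /eqP.
Qed.

Lemma bounded_L2 u (M : R) : (mu D < +oo)%E -> measurable_fun D u ->
  (forall x, D x -> `|u x| <= M) -> L2 D u.
Proof.
move=> fD mu_ bu; apply/L2P; split => //.
apply: measurable_bounded_integrable => //; first exact: measurable_funX.
exists (M ^+ 2); split; first exact: num_real.
move=> y My x Dx; rewrite /= normrX; apply: le_trans (ltW My).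
by rewrite ler_sqr ?nnegrE// ?bu// (le_trans _ (bu _ Dx)).
Qed.

End L2_theory.

Section integration_by_parts.
Context {R : realType} {n : nat}.
Local Notation mu := (@lebesgue_rV R n).
Implicit Types (f g phi psi : 'rV[R]_n -> R).
Local Notation ei i := (delta_mx ord0 i : 'rV[R]_n).

Lemma bounded_in_obox (A : set 'rV[R]_n) : bounded_set A ->
  exists M, A `<=` obox (const_mx (- M)) (const_mx M) /\ 0 <= M.
Proof.
move=> [M [Mr hM]]; exists (`|M| + 2); split; last by rewrite addr_ge0.
move=> x Ax i; rewrite !mxE -ltr_norml.
have := hM (`|M| + 1) _ x Ax; rewrite (le_lt_trans (ler_norm M)) ?ltrDl// => /(_ isT) h.
apply: (@le_lt_trans _ _ (`|M| + 1)); last by rewrite ltrD2l ltr1n.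
exact: le_trans (coord_le_norm _ _) h.
Qed.

Lemma integrable_compact_support f : continuous f -> compact (supp f) ->
  mu.-integrable setT (EFin \o f).
Proof.
move=> cf sf; have [M hM] := compact_support_bounded cf sf.
have [A [sA _]] := bounded_in_obox (compact_bounded sf).
set B := obox _ _ in sA.
have mB : measurable B by exact: measurable_obox.
have fB : (mu B < +oo)%E by rewrite (obox_measure _ _).2 ltry.
have -> : EFin \o f = (EFin \o f) \_ B.
  apply/funext => x; rewrite patchE; case: ifPn => //; rewrite notin_setE => Bx.
  by rewrite /= supp_out// => /sA.
apply/(integrable_mkcond _ mB); apply: measurable_bounded_integrable => //.
  exact: measurable_funTS (continuous_measurable_rV cf).
by exists M; split; [exact: num_real|move=> y My x _; apply: le_trans (hM x) (ltW My)].
Qed.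

(** The difference quotients have integral 0 by translation invariance, and they
    converge to the derivative with a common bound and support. *)
Lemma integral_pderiv0 f i : smooth f -> compact (supp f) ->
  (\int[mu]_x (pderiv i f x)%:E = 0)%E.
Proof.
move=> sf cf.
have cdf : continuous (pderiv i f) by exact/smooth_continuous/smooth_pderiv.
have cs : compact (supp (pderiv i f)).
  by apply: (closed_sub_compact (@closed_closure _ _) cf); exact: supp_pderiv.
have [M hM] := compact_support_bounded cdf cs.
have [A [sA A0]] := bounded_in_obox (compact_bounded cf).
pose B := obox (const_mx (- (A + 1))) (const_mx (A + 1)) : set 'rV[R]_n.
have mB : measurable B by exact: measurable_obox.
have fB : (mu B < +oo)%E by rewrite (obox_measure _ _).2 ltry.
have M0 : 0 <= M by apply: le_trans (hM 0).
pose h (k : nat) : R := k.+1%:R^-1.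
have h0 k : 0 < h k by rewrite invr_gt0.
have h1 k : h k <= 1 by rewrite invf_le1 ?ler1n.
pose F k (x : 'rV[R]_n) : R := (h k)^-1 * (f (x + h k *: ei i) - f x).
have fint := integrable_compact_support (smooth_continuous sf) cf.
have F0 k : (\int[mu]_x (F k x)%:E = 0)%E.
  have [fs fsE] := integral_rV_shift (h k *: ei i) fint.
  under eq_integral do rewrite EFinM EFinB.
  rewrite integralZl//; last exact: (@integrableB _ _ _ _ setT measurableT _ _ fs fint).
  rewrite (@integralB _ _ _ _ setT measurableT _ _ fs fint).
  by rewrite /comp fsE subee ?mule0//; exact: (integrable_fin_num measurableT fint).
have line (x : 'rV[R]_n) : forall t : R, is_derive t 1 (fun s : R => f (s *: ei i + x)) (pderiv i f (t *: ei i + x)).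
  move=> t; apply: (@is_derive_line _ _ f x (ei i) _ t).1; apply: derivableP.
  exact: smooth_derivable.
have Fb k (x : 'rV[R]_n) : `|F k x| <= M * \1_B x.
  rewrite indicE; case: (boolP (x \in B)) => [xB|]; last first.
    rewrite notin_setE => /existsNP[j hj].
    have out (y : 'rV[R]_n) : `|y ord0 j - x ord0 j| <= 1 -> f y = 0.
      move=> yx; apply: supp_out => /sA /(_ j); rewrite !mxE => /andP[h2 h3].
      apply: hj; rewrite !mxE; move: yx; rewrite ler_norml => /andP[? ?].
      by apply/andP; split; lra.
    rewrite mulr0 /F !out ?subrr ?mulr0 ?normr0//.
    rewrite !mxE addrAC subrr add0r normrM (gtr0_norm (h0 _)).
    apply: mulr_ile1; rewrite ?(ltW (h0 _))//.
    by case: (_ && _); rewrite /= ?normr1 ?normr0.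
  rewrite mulr1 /F; have [c _] := mean_value (h k) (line x).
  rewrite scale0r add0r [_ *: _ + x]addrC => ->.
  rewrite mulrCA mulVf ?mulr1 ?gt_eqF//.
have cvgF (x : 'rV[R]_n) : F k x @[k --> \oo] --> pderiv i f x.
  have /is_deriveP := derivableP (@smooth_derivable _ _ f i x sf).
  rewrite -/(pderiv i f x) => L.
  have hc : h k @[k --> \oo] --> (0:R)^'.
    move=> P; rewrite /nbhs /= => /nbhs_ballP[e /= e0 eP].
    have [k0 hk0] := inv_nat_lt e0.
    exists k0 => // k /= k0k; apply: eP.
      by rewrite /ball /= sub0r normrN gtr0_norm// hk0.
    by rewrite gt_eqF.
  have := cvg_comp _ _ hc L; apply: cvg_trans; apply: near_eq_cvg.
  by near=> k => /=; rewrite /F [x + _]addrC.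
have [|||||_ _ lim] := @dominated_convergence _ _ _ mu setT measurableT
  (fun k x => (F k x)%:E) (fun x => (pderiv i f x)%:E) (fun x => (M * \1_B x)%:E).
- move=> k; apply/measurable_EFinP; apply: measurable_funM => //.
  apply: measurable_funB; last exact: continuous_measurable_rV (smooth_continuous sf).
  exact: (measurableT_comp (continuous_measurable_rV (smooth_continuous sf)) (measurable_rV_shift _)).
- by apply/measurable_EFinP; exact: continuous_measurable_rV.
- by apply: aeW => x _; apply: cvg_EFin; [exact: nearW|exact: cvgF].
- rewrite (_ : (fun x => _) = (EFin \o cst M) \_ B); last first.
    apply/funext => x; rewrite patchE indicE.
    by case: (x \in B); rewrite /= ?mulr1 ?mulr0.
  apply/(integrable_mkcond _ mB); apply: measurable_bounded_integrable => //.
  by exists M; split; [exact: num_real|move=> y My x _; rewrite /= ger0_norm// ltW].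
- by apply: aeW => x k _; rewrite lee_fin.
have E : [sequence (\int[mu]_x (F k x)%:E)%E]_k = cst 0%E.
  by apply/funext => k; exact: F0.
by rewrite -(cvg_lim (@ereal_hausdorff R) lim) E lim_cst.
Unshelve. all: by end_near. Qed.

(** The derivative of the product [psi * phi], which has compact support, has
    integral 0. *)
Lemma integration_by_parts_test (Omega : set 'rV[R]_n) phi psi i :
  measurable Omega -> smooth phi -> test_function Omega psi ->
  dotL2 Omega phi (pderiv i psi) = - dotL2 Omega (pderiv i phi) psi.
Proof.
move=> mO sphi [spsi cpsi psiO].
have out x : ~ Omega x -> psi x = 0 /\ pderiv i psi x = 0.
  move=> Ox; split; apply: supp_out; first by move/psiO.
  by move/supp_pderiv/psiO.
have i1 : mu.-integrable setT (EFin \o (pderiv i psi \* phi)).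
  apply: integrable_compact_support.
    exact: smooth_continuous (smoothM (smooth_pderiv i spsi) sphi).
  apply: (closed_sub_compact (@closed_closure _ _) cpsi).
  exact: subset_trans (@supp_mul _ _ _ _) (@supp_pderiv _ _ psi i).
have i2 : mu.-integrable setT (EFin \o (psi \* pderiv i phi)).
  apply: integrable_compact_support.
    exact: smooth_continuous (smoothM spsi (smooth_pderiv i sphi)).
  by apply: (closed_sub_compact (@closed_closure _ _) cpsi); exact: supp_mul.
have := @integral_pderiv0 (psi \* phi) i (smoothM spsi sphi) _.
rewrite pderivM// => /(_ _) H.
have {}H : (\int[mu]_x ((pderiv i psi \* phi) \+ (psi \* pderiv i phi)) x)%R = 0.
  rewrite /Rintegral H//.
  by apply: (closed_sub_compact (@closed_closure _ _) cpsi); exact: supp_mul.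
apply/eqP; rewrite -addr_eq0 -[X in _ == X]H; apply/eqP.
rewrite /= RintegralD//; congr (_ + _).
  rewrite /dotL2 Rintegral_mkcond; apply: eq_Rintegral => x _.
  rewrite patchE; case: ifPn => [_|]; first by rewrite mulrC.
  by rewrite notin_setE => /out[_ ->]; rewrite mul0r.
rewrite /dotL2 Rintegral_mkcond; apply: eq_Rintegral => x _.
rewrite patchE; case: ifPn => [_|]; first by rewrite mulrC.
by rewrite notin_setE => /out[-> _]; rewrite mul0r.
Qed.

End integration_by_parts.

(** * Weak derivatives *)

Section fundamental_lemma.
Context {R : realType} {n : nat}.
Local Notation mu := (@lebesgue_rV R n).
Implicit Types (f g u v phi psi : 'rV[R]_n -> R).
Variable Omega : set 'rV[R]_n.
Hypotheses (oO : open Omega) (bO : bounded_set Omega).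

Let mO : measurable Omega. Proof. exact: open_measurable_rV. Qed.
Let fO : (mu Omega < +oo)%E. Proof. exact: bounded_measure_finite. Qed.

Lemma L2_integrable g : L2 Omega g -> mu.-integrable Omega (EFin \o g).
Proof.
move=> Lg; have L1 : L2 Omega (cst 1).
  by apply: (bounded_L2 mO (M := 1)) => // x _; rewrite /= normr1.
have := L2_mul_integrable mO Lg L1; apply: eq_integrable => // x _ /=.
by rewrite mulr1.
Qed.

Lemma smooth_bounded f : smooth f -> exists M, forall x, Omega x -> `|f x| <= M.
Proof.
move=> sf; have [A [sA A0]] := bounded_in_obox bO.
have : compact (f @` cbox (const_mx (- A)) (const_mx A)).
  apply: continuous_compact; last exact: cbox_compact.
  by apply: continuous_subspaceT; exact: smooth_continuous.
move/compact_bounded => [M [Mr hM]]; exists (`|M| + 1) => x Ox.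
apply: (hM (`|M| + 1)); first by rewrite (le_lt_trans (ler_norm M))// ltrDl.
by exists x => //; apply/obox_cbox/sA.
Qed.

Lemma smooth_L2 f : smooth f -> L2 Omega f.
Proof.
move=> sf; have [M hM] := smooth_bounded sf.
apply: (bounded_L2 mO fO _ hM).
by apply: measurable_funTS; apply: continuous_measurable_rV; exact: smooth_continuous.
Qed.

(** The bumps of the box increase to its indicator. *)
Lemma integral_box0 g a b : L2 Omega g ->
  (forall psi, test_function Omega psi -> dotL2 Omega g psi = 0) ->
  cbox a b `<=` Omega -> (\int[mu]_(x in obox a b) (g x)%:E = 0)%E.
Proof.
move=> Lg h abO; have ig := L2_integrable Lg.
pose F (k : nat) x := g x * bump k.+1%:R^-1 a b x.
have k0 k : (0 : R) < k.+1%:R^-1 by rewrite invr_gt0.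
have sb k : smooth (bump k.+1%:R^-1 a b) by exact: smooth_bump.
have mg : measurable_fun Omega g := L2_measurable mO Lg.
have oab : obox a b `<=` Omega by apply: subset_trans abO; exact: obox_cbox.
have mb : measurable (obox a b) by exact: measurable_obox.
have F0 k : (\int[mu]_(x in Omega) (F k x)%:E = 0)%E.
  have := h _ (test_bump (k0 k) abO); rewrite /dotL2 /Rintegral => hk.
  rewrite -[LHS]fineK ?hk//.
  have iF := L2_mul_integrable mO Lg (smooth_L2 (sb k)).
  exact: (integrable_fin_num mO iF).
have [|||||_ _ lim] := @dominated_convergence _ _ _ mu Omega mO
  (fun k x => (F k x)%:E) (fun x => (g x * \1_(obox a b) x)%:E) (fun x => `|(g x)%:E|)%E.
- move=> k; apply/measurable_EFinP; apply: measurable_funM => //.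
  by apply: measurable_funTS; exact: continuous_measurable_rV (smooth_continuous (sb k)).
- by apply/measurable_EFinP; apply: measurable_funM => //; exact: measurable_indic.
- apply: aeW => x _ Ox; apply: cvg_EFin; first exact: nearW.
  by apply: cvgMl_tmp; exact: bump_cvg.
- exact: integrable_abse.
- apply: aeW => x k Ox; rewrite lee_fin /F normrM -[leRHS]mulr1 ler_wpM2l//.
  by rewrite ger0_norm ?bump_ge0 ?bump_le1.
have E : [sequence (\int[mu]_(x in Omega) (F k x)%:E)%E]_k = cst 0%E.
  by apply/funext => k; exact: F0.
have := cvg_lim (@ereal_hausdorff R) lim; rewrite E lim_cst// => h0.
rewrite -(setIidr oab) integral_mkcondr; rewrite [RHS]h0; apply: eq_integral => x _.
rewrite patchE indicE; case: ifPn => _; last by rewrite mulr0.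
by rewrite mulr1.
Qed.

(** The integral vanishes on boxes, hence on Borel subsets of boxes by Dynkin's
    argument, so the function vanishes almost everywhere on each box of the
    countable family that covers the open set. *)
Lemma fundamental_lemma g : L2 Omega g ->
  (forall psi, test_function Omega psi -> dotL2 Omega g psi = 0) ->
  ae_eq mu Omega g (cst 0).
Proof.
move=> Lg h; have ig := L2_integrable Lg.
have mg : measurable_fun Omega g := L2_measurable mO Lg.
have box a b : cbox a b `<=` Omega -> ae_eq mu (obox a b) (EFin \o g) (cst 0%E).
  move=> abO; set J := obox a b.
  have JO : J `<=` Omega by apply: subset_trans abO; exact: obox_cbox.
  have mJ : measurable J by exact: measurable_obox.
  have iJ : mu.-integrable J (EFin \o g) by exact: integrableS ig.
  have all0 A : measurable A -> (\int[mu]_(x in A `&` J) (g x)%:E = 0)%E.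
    move=> mA; apply: (@dynkin_induction _ _ oboxes
      [set A | (\int[mu]_(x in A `&` J) (g x)%:E = 0)%E]
      measurable_rVE oboxes_setI_closed) => //=.
    - by rewrite setTI; exact: integral_box0.
    - move=> _ [a' [b' ->]]; rewrite /= oboxI; apply: integral_box0 => //.
      apply: subset_trans abO => x hx i; have := hx i; rewrite !mxE.
      by rewrite ge_max le_min => /andP[/andP[_ ->] /andP[_ ->]].
    - move=> S mS S0; have := integral_box0 Lg h abO.
      have JE : J = (S `&` J) `|` (~` S `&` J).
        by rewrite -setIUl setUv setTI.
      have mSJ : measurable (S `&` J) by exact: measurableI.
      have mCJ : measurable (~` S `&` J) by apply: measurableI => //; exact: measurableC.
      rewrite -/J {1}JE integral_setU//; first by rewrite S0 add0e.
        by rewrite -JE; exact: (measurable_int _ iJ).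
      by apply/disj_set2P; rewrite setIACA setICr set0I.
    - move=> F mF tF F0; rewrite setI_bigcupl integral_bigcup.
      + by apply: eseries0 => i _ _; exact: F0.
      + by apply: trivIset_setIr.
      + by move=> k; exact: measurableI.
      + apply: integrableS iJ => //; last by move=> x [k _ []].
        by apply: bigcupT_measurable => k; exact: measurableI.
    - by rewrite -measurable_rVE.
  apply: integral_ae_eq => // E EJ mE.
  by rewrite integral0 -(setIidl EJ); exact: all0.
have [a [b cover]] := @open_box_cover R n.
have : \forall x \ae mu, forall k : nat,
    if unpickle k is Some p then
      (forall y : 'rV[R]_n, (forall i, a p ord0 i <= y ord0 i <= b p ord0 i) -> Omega y) ->
      obox (a p) (b p) x -> g x = 0 else True.
  apply: ae_foralln => k; case: (unpickle k) => [p|]; last exact: aeW.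
  have [abO|nabO] := pselect (cbox (a p) (b p) `<=` Omega); last first.
    by apply: aeW => x abO; exfalso; apply: nabO => y; exact: abO.
  apply: filterS (box _ _ abO) => x /= hx _ /hx /eqP.
  by rewrite eqe => /eqP.
apply: filterS => x /= hx; rewrite {1}(cover _ oO) => -[p _].
case: asboolP => // abO xab.
by have := hx (pickle p); rewrite pickleK; apply.
Qed.

Lemma weak_partial_unique i u g g' : L2 Omega g -> L2 Omega g' ->
  weak_partial Omega i u g -> weak_partial Omega i u g' -> ae_eq mu Omega g g'.
Proof.
move=> Lg Lg' wg wg'.
have : ae_eq mu Omega (g \- g') (cst 0).
  apply: fundamental_lemma; first exact: L2B.
  move=> psi tpsi; have Lpsi : L2 Omega psi by apply: smooth_L2; case: tpsi.
  rewrite dotL2Bl//; have := wg _ tpsi; rewrite wg'// => /oppr_inj ->.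
  by rewrite subrr.
by apply: filterS => x /= h Ox; apply/eqP; rewrite -subr_eq0 h.
Qed.

Lemma wpdP i u : H1 Omega u -> L2 Omega (wpd Omega i u) /\ weak_partial Omega i u (wpd Omega i u).
Proof.
move=> [_ /(_ i)[g Lg wg]].
by have := @xgetPex _ (cst 0) [set g | L2 Omega g /\ weak_partial Omega i u g]; apply; exists g.
Qed.

Lemma wpd_unique i u g : H1 Omega u -> L2 Omega g -> weak_partial Omega i u g ->
  ae_eq mu Omega (wpd Omega i u) g.
Proof. by move=> /(wpdP i)[L w] Lg wg; exact: (weak_partial_unique L Lg w wg). Qed.

Lemma smooth_weak_partial i f : smooth f -> weak_partial Omega i f (pderiv i f).
Proof. by move=> sf psi tpsi; exact: integration_by_parts_test. Qed.

Lemma smooth_H1 f : smooth f -> H1 Omega f.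
Proof.
move=> sf; split; first exact: smooth_L2.
by move=> i; exists (pderiv i f); [exact/smooth_L2/smooth_pderiv|exact: smooth_weak_partial].
Qed.

Lemma wpd_smooth i f : smooth f -> ae_eq mu Omega (wpd Omega i f) (pderiv i f).
Proof.
move=> sf; apply: wpd_unique; first exact: smooth_H1.
  exact/smooth_L2/smooth_pderiv.
exact: smooth_weak_partial.
Qed.

Lemma weak_partial_linear i k u v g h : L2 Omega u -> L2 Omega v -> L2 Omega g -> L2 Omega h ->
  weak_partial Omega i u g -> weak_partial Omega i v h ->
  weak_partial Omega i ((cst k \* u) \+ v) ((cst k \* g) \+ h).
Proof.
move=> Lu Lv Lg Lh wu wv psi tpsi.
have Lpsi : L2 Omega psi by apply: smooth_L2; case: tpsi.
have Ldpsi : L2 Omega (pderiv i psi).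
  by apply/smooth_L2/smooth_pderiv; case: tpsi.
by rewrite !dotL2Dl ?dotL2Zl//; try exact: L2Z; rewrite wu// wv// mulrN opprD.
Qed.

Lemma H1_linear k u v : H1 Omega u -> H1 Omega v -> H1 Omega ((cst k \* u) \+ v).
Proof.
move=> Hu Hv; split; first by apply: L2D => //; [apply: L2Z => //; case: Hu|case: Hv].
move=> i; have [Lu wu] := wpdP i Hu; have [Lv wv] := wpdP i Hv.
exists ((cst k \* wpd Omega i u) \+ wpd Omega i v).
  by apply: L2D => //; exact: L2Z.
by apply: weak_partial_linear => //; [case: Hu|case: Hv].
Qed.

Lemma wpd_linear i k u v : H1 Omega u -> H1 Omega v ->
  ae_eq mu Omega (wpd Omega i ((cst k \* u) \+ v)) ((cst k \* wpd Omega i u) \+ wpd Omega i v).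
Proof.
move=> Hu Hv; have [Lu wu] := wpdP i Hu; have [Lv wv] := wpdP i Hv.
apply: wpd_unique; first exact: H1_linear.
  by apply: L2D => //; exact: L2Z.
by apply: weak_partial_linear => //; [case: Hu|case: Hv].
Qed.

End fundamental_lemma.

(** * Completeness of the space of square integrable functions *)

Section L2_completeness.
Context {R : realType} {n : nat}.
Local Notation mu := (@lebesgue_rV R n).
Implicit Types (u v w g : 'rV[R]_n -> R).
Variable D : set 'rV[R]_n.
Hypotheses (mD : measurable D) (fD : (mu D < +oo)%E).

Lemma sum_half K : \sum_(k < K) (2^-1 : R) ^+ k <= 2.
Proof.
suff : \sum_(k < K) (2^-1 : R) ^+ k = 2 - 2 * 2^-1 ^+ K.
  by move=> ->; rewrite lerBlDr lerDl mulr_ge0// exprn_ge0.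
elim: K => [|K IH]; first by rewrite big_ord0 expr0 mulr1 subrr.
by rewrite big_ord_recr /= IH exprS; lra.
Qed.

(** With [h k = 2 ^ - k], the weighted inequality [2 |d| <= h + d ^ 2 / h] bounds
    the sum of the increments by a series with finite integral on a set of
    finite measure. *)
Lemma fast_cauchy_ae (v : nat -> 'rV[R]_n -> R) : (forall k, L2 D (v k)) ->
  (forall k, dotL2 D (v k.+1 \- v k) (v k.+1 \- v k) <= (2^-1 ^+ k) ^+ 2) ->
  \forall x \ae mu, D x -> cvgn (fun k => v k x).
Proof.
move=> Lv hv; pose d k := v k.+1 \- v k.
have Ld k : L2 D (d k) by exact: L2B.
pose h (k : nat) : R := 2^-1 ^+ k.
have h0 k : 0 < h k by rewrite exprn_gt0// invr_gt0.
pose f k x : \bar R := (h k + (h k)^-1 * d k x ^+ 2)%:E.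
have f0 k x : (0 <= f k x)%E.
  by rewrite lee_fin addr_ge0 ?(ltW (h0 _))// mulr_ge0 ?sqr_ge0// invr_ge0 ltW.
have md k : measurable_fun D (d k) by exact: L2_measurable.
have mf k : measurable_fun D (f k).
  apply/measurable_EFinP; apply: measurable_funD => //.
  by apply: measurable_funM => //; exact: measurable_funX.
pose m := fine (mu D).
have mE : mu D = m%:E by rewrite fineK// ge0_fin_numE.
have m0 : 0 <= m by rewrite fine_ge0.
have If k : (\int[mu]_(x in D) f k x <= (h k * (m + 1))%:E)%E.
  under eq_integral do rewrite /f EFinD EFinM.
  rewrite ge0_integralD//; last 3 first.
  - by move=> x _; rewrite lee_fin ltW.
  - by move=> x _; rewrite -EFinM lee_fin mulr_ge0 ?sqr_ge0// invr_ge0 ltW.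
  - apply: measurable_funeM; apply/measurable_EFinP; exact: measurable_funX.
  have -> : (\int[mu]_(x in D) (h k)%:E = (h k * m)%:E)%E.
    transitivity ((h k)%:E * mu D)%E; first exact: integral_cst.
    by rewrite mE.
  rewrite ge0_integralZl//; last 3 first.
  - by apply/measurable_EFinP; exact: measurable_funX.
  - by move=> x _; rewrite lee_fin sqr_ge0.
  - by rewrite lee_fin invr_ge0 ltW.
  rewrite -dotL2_sqE// -!EFinM -EFinD lee_fin mulrDr mulr1 lerD2l.
  rewrite mulrC ler_pdivrMr// -expr2; exact: hv.
have sumI : (\int[mu]_(x in D) (\sum_(k <oo) f k x) < +oo)%E.
  rewrite integral_nneseries//.
  apply: (@le_lt_trans _ _ (2 * (m + 1))%:E); last exact: ltry.
  apply: lime_le; first by apply: is_cvg_nneseries => k _ _; exact: integral_ge0.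
  apply: nearW => K; rewrite big_mkord.
  apply: (@le_trans _ _ (\sum_(k < K) (h k * (m + 1))%:E)%E).
    by apply: lee_sum => k _; exact: If.
  by rewrite sumEFin lee_fin -mulr_suml ler_wpM2r ?sum_half// addr_ge0.
have mS : measurable_fun D (fun x => \sum_(k <oo) f k x)%E.
  by apply: ge0_emeasurable_sum => // k x _ _; exact: f0.
have iS : mu.-integrable D (fun x => \sum_(k <oo) f k x)%E.
  apply/integrableP; split => //; apply: le_lt_trans sumI.
  rewrite le_eqVlt; apply/orP; left; apply/eqP; apply: eq_integral => x _.
  by rewrite gee0_abs//; apply: nneseries_ge0 => k _ _; exact: f0.
apply: filterS (integrable_ae mD iS) => x h' Dx.
have fin := h' Dx.
suff cd : cvgn (series (fun k => d k x)).
  rewrite (_ : (fun k => v k x) = (fun k => v 0%N x + series (fun k => d k x) k)).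
    by apply: is_cvgD => //; exact: is_cvg_cst.
  apply/funext => k; have := eq_sum_telescope (fun k => v k x) k.
  by move=> ->.
apply: normed_cvg; apply: (@nnseries_is_cvg _ (fun k => `|d k x|)) => //.
apply: (@le_lt_trans _ _ (\sum_(k <oo) f k x)%E).
  apply: lee_nneseries => [k _ _|k _]; first by rewrite lee_fin.
  rewrite lee_fin; have : 0 <= (h k)^-1 * (h k - `|d k x|) ^+ 2.
    by rewrite mulr_ge0 ?sqr_ge0// invr_ge0 ltW.
  have -> : (h k)^-1 * (h k - `|d k x|) ^+ 2 = h k + (h k)^-1 * d k x ^+ 2 - 2 * `|d k x|.
    rewrite sqrrB real_normK ?num_real//; field; exact: lt0r_neq0.
  by have := normr_ge0 (d k x); lra.
by rewrite -ge0_fin_numE//; apply: nneseries_ge0 => k _ _; exact: f0.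
Qed.

Lemma dotL2_cauchy_schwarz u v : L2 D u -> L2 D v ->
  dotL2 D u v ^+ 2 <= dotL2 D u u * dotL2 D v v.
Proof.
move=> Lu Lv; apply: discr_le => [|s]; first exact: dotL2_ge0.
set w := (cst s \* u) \- v; have Lw : L2 D w by apply: L2B => //; exact: L2Z.
have E t : L2 D t -> dotL2 D w t = s * dotL2 D u t - dotL2 D v t.
  by move=> Lt; rewrite dotL2Bl ?dotL2Zl//; exact: L2Z.
have := dotL2_ge0 D w; rewrite E// (dotL2C D u w) (dotL2C D v w) !E//.
by rewrite (dotL2C D v u); lra.
Qed.

(** A fast subsequence converges almost everywhere, and Fatou's lemma turns the
    Cauchy estimates into estimates for the limit. *)
Theorem L2_complete (u : nat -> 'rV[R]_n -> R) : (forall k, L2 D (u k)) ->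
  (forall e : R, 0 < e -> exists n0 : nat, forall i j, (n0 <= i)%N -> (n0 <= j)%N ->
    dotL2 D (u i \- u j) (u i \- u j) < e) ->
  exists2 l, L2 D l & forall e : R, 0 < e -> exists n0 : nat, forall i, (n0 <= i)%N ->
    dotL2 D (u i \- l) (u i \- l) <= e.
Proof.
move=> Lu Cu.
have h0 k : 0 < ((2^-1 : R) ^+ k) ^+ 2 by rewrite !exprn_gt0// invr_gt0.
have /choice[N HN] := fun k => Cu _ (h0 k).
pose M k := (k + \sum_(j < k.+1) N j)%N.
have NM k j : (j <= k)%N -> (N j <= M k)%N.
  move=> jk; rewrite /M (bigD1 (Ordinal (jk : (j < k.+1)%N)))//= addnCA.
  exact: leq_addr.
pose v k := u (M k).
have Lv k : L2 D (v k) by exact: Lu.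
have mv k : measurable_fun D (v k) by exact: L2_measurable.
have mu_ k : measurable_fun D (u k) by exact: L2_measurable.
have hv k : dotL2 D (v k.+1 \- v k) (v k.+1 \- v k) <= (2^-1 ^+ k) ^+ 2.
  by apply/ltW/HN; exact: NM.
have ae := fast_cauchy_ae (fun k => Lu (M k)) hv.
pose l x := fine (limn_esup (fun k => (v k x)%:E)).
have ml : measurable_fun D l.
  apply: (@measurableT_comp _ _ _ _ _ _ fine); first exact: fine_measurable.
  apply: measurable_fun_limn_esup => k; exact/measurable_EFinP.
have vl : \forall x \ae mu, D x -> v k x @[k --> \oo] --> l x.
  apply: filterS ae => x cv Dx; have {}cv := cv Dx.
  have E : (v k x)%:E @[k --> \oo] --> (limn (fun k => v k x))%:E.
    by apply: cvg_EFin => //; exact: nearW.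
  by rewrite /l (cvg_limn_einf_sup E).2.
have key e i : 0 < e -> (forall j, (i <= j)%N -> dotL2 D (u j \- u i) (u j \- u i) <= e) ->
    (\int[mu]_(x in D) ((l x - u i x) ^+ 2)%:E <= e%:E)%E.
  move=> e0 he; pose F k x := ((v k x - u i x) ^+ 2)%:E.
  have mF k : measurable_fun D (F k).
    apply/measurable_EFinP; apply: measurable_funX.
    exact: measurable_funB.
  have := @fatou _ _ _ mu D mD F mF (fun k x _ => ltac:(by rewrite lee_fin sqr_ge0)).
  have -> : (\int[mu]_(x in D) limn_einf (F^~ x) = \int[mu]_(x in D) ((l x - u i x) ^+ 2)%:E)%E.
    apply: ae_eq_integral => //.
    - rewrite (_ : (fun x => limn_einf (F^~ x)) = (fun x => - limn_esup (fun k => - F k x))%E).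
        apply: measurableT_comp => //; apply: measurable_fun_limn_esup => k.
        exact: measurableT_comp.
      apply/funext => x; rewrite -limn_einfN; congr limn_einf.
      by apply/funext => k; rewrite /comp oppeK.
    - apply/measurable_EFinP; apply: measurable_funX.
      exact: measurable_funB.
    - apply: filterS vl => x cv Dx; have {}cv := cv Dx.
      have E : F k x @[k --> \oo] --> ((l x - u i x) ^+ 2)%:E.
        apply: cvg_EFin; first exact: nearW.
        have cB : v k x - u i x @[k --> \oo] --> l x - u i x.
          by apply: cvgB => //; exact: cvg_cst.
        exact: (cvgM cB cB).
      by rewrite (cvg_limn_einf_sup E).1.
  move=> h; apply: le_trans h _.
  rewrite limn_einf_lim; apply: lime_le; first exact: is_cvg_einfs.
  exists i => // k /= ik; rewrite /einfs /=.
  apply: le_trans (ereal_inf_lbound _) _; first by exists k => //=.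
  rewrite /F -(dotL2_sqE mD (u := v k \- u i)); last exact: L2B.
  by rewrite lee_fin; apply: he; rewrite /M (leq_trans ik)// leq_addr.
have Ll : L2 D l.
  have [n0 h] := Cu 1 ltr01.
  have L1 : L2 D (l \- u n0).
    apply/(L2P mD); split.
      exact: measurable_funB.
    apply/integrableP; split.
      apply/measurable_EFinP; apply: measurable_funX.
      exact: measurable_funB.
    apply: (@le_lt_trans _ _ 1%:E); last exact: ltry.
    under eq_integral do rewrite gee0_abs ?lee_fin ?sqr_ge0//.
    by apply: key => // j jn0; apply/ltW/h.
  rewrite (_ : l = (l \- u n0) \+ u n0); first exact: L2D.
  by apply/funext => x /=; rewrite subrK.
exists l => // e e0; have [n0 h] := Cu _ e0; exists n0 => i i0.
have -> : dotL2 D (u i \- l) (u i \- l) = dotL2 D (l \- u i) (l \- u i).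
  by apply: eq_Rintegral => x _ /=; ring.
rewrite -lee_fin dotL2_sqE//; last exact: L2B.
by apply: key => // j ij; apply/ltW/h => //; exact: leq_trans ij.
Qed.

End L2_completeness.

(** * The first Sobolev space *)

Section sobolev_forms.
Context {R : realType} {n : nat}.
Local Notation mu := (@lebesgue_rV R n).
Implicit Types (u v w g phi psi : 'rV[R]_n -> R) (K : set 'rV[R]_n).

(** Off a null set the potential takes values between [c0] and its essential
    supremum; it is truncated there. *)
Lemma bounded_representative (Omega : set 'rV[R]_n) (c : 'rV[R]_n -> R) (c0 : R) :
  c \in Lfun mu +oo%E -> {ae mu, forall x, c0 <= c x} -> (0 < mu setT)%E ->
  exists (c' : 'rV[R]_n -> R) (M : R), [/\ measurable_fun setT c',
    forall x, c0 <= c' x <= M & ae_eq mu Omega c c'].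
Proof.
rewrite inE => /andP[mc]; rewrite inE/= /finite_norm unlock => fc hc m0.
move: mc; rewrite inE/= => mc; move: fc; rewrite m0 => fc.
have := ess_sup_ge mu (abse \o (EFin \o c)).
move: fc; set s := ess_sup _ _ => fc hs.
have [M HM] : exists M : R, (s <= M%:E)%E.
  move: fc; case: s {hs} => [r _|//|_]; first by exists r.
  by exists 0; exact: leNye.
have {}hs : \forall x \ae mu, `|c x| <= M.
  apply: filterS hs => x /= hx; rewrite -lee_fin.
  exact: le_trans hx HM.
pose c' x := Num.min (Num.max (c x) c0) (Num.max M c0).
exists c', (Num.max M c0); split.
- by apply: measurable_minr => //; exact: measurable_maxr.
- move=> x; apply/andP; split; first by rewrite le_min !le_max !lexx !orbT.
  by rewrite ge_min lexx orbT.
- apply: filterS2 hc hs => x cx Mx _; rewrite /c' (max_l cx) min_l//.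
  by rewrite le_max (le_trans (ler_norm _) Mx).
Qed.

Lemma Rintegral_sum (D : set 'rV[R]_n) (I : Type) (s : seq I) (F : I -> 'rV[R]_n -> R) :
  measurable D -> (forall i, mu.-integrable D (EFin \o F i)) ->
  mu.-integrable D (EFin \o (fun x => \sum_(i <- s) F i x)) /\
  \int[mu]_(x in D) (\sum_(i <- s) F i x) = \sum_(i <- s) \int[mu]_(x in D) F i x.
Proof.
move=> mD iF; elim: s => [|i s [IH1 IH2]].
  rewrite (_ : (fun x => _) = cst 0); last by apply/funext => x; rewrite big_nil.
  by rewrite big_nil; split; [exact: integrable0|rewrite /Rintegral integral0].
rewrite (_ : (fun x => _) = (fun x => F i x + \sum_(j <- s) F j x)); last first.
  by apply/funext => x; rewrite big_cons.
rewrite big_cons -IH2 -RintegralD//; split => //.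
exact: (@integrableD _ _ _ mu D mD _ _ (iF i) IH1).
Qed.

Variable Omega : set 'rV[R]_n.
Hypotheses (oO : open Omega) (bO : bounded_set Omega).

Let mO : measurable Omega. Proof. exact: open_measurable_rV. Qed.
Let fO : (mu Omega < +oo)%E. Proof. exact: bounded_measure_finite. Qed.

Local Notation wpd := (wpd Omega).
Local Notation L2 := (L2 Omega).
Local Notation H1 := (H1 Omega).
Local Notation dotL2 := (dotL2 Omega).

Definition gradform u v := \sum_(i < n) dotL2 (wpd i u) (wpd i v).
Definition h1form u v := gradform u v + dotL2 u v.

Lemma H1_L2 u : H1 u -> L2 u. Proof. by case. Qed.
Lemma H1_wpd i u : H1 u -> L2 (wpd i u). Proof. by move=> /(wpdP i)[]. Qed.

Lemma gradformC u v : gradform u v = gradform v u.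
Proof. by apply: eq_bigr => i _; exact: dotL2C. Qed.

Lemma gradform_linear k u v w : H1 u -> H1 v -> H1 w ->
  gradform ((cst k \* u) \+ v) w = k * gradform u w + gradform v w.
Proof.
move=> Hu Hv Hw; rewrite /gradform mulr_sumr -big_split /=; apply: eq_bigr => i _.
have [Lu Lv Lw] := And3 (H1_wpd i Hu) (H1_wpd i Hv) (H1_wpd i Hw).
apply: (etrans (ae_eq_L2 mO (H1_wpd i (H1_linear oO bO k Hu Hv)) (L2D (L2Z k Lu) Lv) Lw
  (wpd_linear oO bO i k Hu Hv))).
apply: (etrans (dotL2Dl mO (L2Z k Lu) Lv Lw)).
by congr (_ + _); exact: (dotL2Zl mO k Lu Lw).
Qed.

Lemma gradform_ge0 u : 0 <= gradform u u.
Proof. by apply: sumr_ge0 => i _; exact: dotL2_ge0. Qed.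

Lemma gradform_smooth f g : smooth f -> smooth g ->
  gradform f g = \sum_(i < n) dotL2 (pderiv i f) (pderiv i g).
Proof.
move=> sf sg; apply: eq_bigr => i _.
have Lf := smooth_L2 oO bO (smooth_pderiv i sf).
have Lg := smooth_L2 oO bO (smooth_pderiv i sg).
have wf := H1_wpd i (smooth_H1 oO bO sf); have wg := H1_wpd i (smooth_H1 oO bO sg).
rewrite (ae_eq_L2 mO wf Lf wg (wpd_smooth oO bO i sf)) dotL2C.
by rewrite (ae_eq_L2 mO wg Lg Lf (wpd_smooth oO bO i sg)) dotL2C.
Qed.

Lemma sqnormH1E u : H1 u -> sqnormH1 Omega u = h1form u u.
Proof.
move=> Hu; rewrite /sqnormH1 /dotgrad.
have iw i : mu.-integrable Omega (EFin \o (fun x => wpd i u x * wpd i u x)).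
  by apply: L2_mul_integrable => //; exact: H1_wpd.
have [is1 is2] := Rintegral_sum (index_enum 'I_n) mO iw.
rewrite RintegralD//; last exact: L2_sq_integrable (H1_L2 Hu).
by rewrite is2.
Qed.

Lemma H10P K u : H10 Omega K u <-> H1 u /\ forall e, 0 < e ->
  exists2 phi, test_function (~` K) phi & h1form (u \- phi) (u \- phi) < e.
Proof.
have tH phi : test_function (~` K) phi -> H1 phi by case=> sphi _ _; exact: smooth_H1.
have HB v phi : H1 v -> H1 phi -> H1 (v \- phi).
  move=> Hv Hp; rewrite (_ : v \- phi = (cst (-1) \* phi) \+ v); first exact: H1_linear.
  by apply/funext => x /=; rewrite mulN1r addrC.
split=> -[Hu h]; split=> // e e0.
  have se : 0 < Num.sqrt e by rewrite sqrtr_gt0.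
  have [phi tphi hphi] := h _ se; exists phi => //.
  by move: hphi; rewrite sqnormH1E ?ltr_sqrt//; apply: HB => //; exact: tH.
have [phi tphi hphi] := h _ (exprn_gt0 2 e0); exists phi => //.
rewrite sqnormH1E; last by apply: HB => //; exact: tH.
rewrite -(ltr_sqr (x := Num.sqrt _)) ?nnegrE ?sqrtr_ge0 ?(ltW e0)// sqr_sqrtr//.
by rewrite addr_ge0 ?gradform_ge0 ?dotL2_ge0.
Qed.

Lemma H1_0 : H1 (cst 0).
Proof. exact/(smooth_H1 oO bO)/smooth_cst. Qed.

Lemma H1B u v : H1 u -> H1 v -> H1 (u \- v).
Proof.
move=> Hu Hv; rewrite (_ : u \- v = (cst (-1) \* v) \+ u); first exact: H1_linear.
by apply/funext => x /=; rewrite mulN1r addrC.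
Qed.

Lemma h1form_ge0 u : 0 <= h1form u u.
Proof. by rewrite addr_ge0 ?gradform_ge0 ?dotL2_ge0. Qed.

Lemma h1formC u v : h1form u v = h1form v u.
Proof. by rewrite /h1form gradformC dotL2C. Qed.

Let linear_regroup (k a b c d : R) : k * a + b + (k * c + d) = k * (a + c) + (b + d).
Proof. by ring. Qed.

Lemma h1form_linear k u v w : H1 u -> H1 v -> H1 w ->
  h1form ((cst k \* u) \+ v) w = k * h1form u w + h1form v w.
Proof.
move=> Hu Hv Hw; rewrite /h1form gradform_linear//.
have [Lu Lv Lw] := And3 (H1_L2 Hu) (H1_L2 Hv) (H1_L2 Hw).
have -> : dotL2 ((cst k \* u) \+ v) w = k * dotL2 u w + dotL2 v w.
  apply: (etrans (dotL2Dl mO (L2Z k Lu) Lv Lw)).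
  by congr (_ + _); exact: (dotL2Zl mO k Lu Lw).
exact: linear_regroup.
Qed.

(** Add the nonnegative square of [v - k u]. *)
Lemma h1form_sq_linear k u v : H1 u -> H1 v ->
  h1form ((cst k \* u) \+ v) ((cst k \* u) \+ v) <= 2 * k ^+ 2 * h1form u u + 2 * h1form v v.
Proof.
move=> Hu Hv; set w := (cst k \* u) \+ v; have Hw : H1 w by exact: H1_linear.
set z := (cst (- k) \* u) \+ v; have Hz : H1 z by exact: H1_linear.
have E t : H1 t -> h1form w t = k * h1form u t + h1form v t by exact: h1form_linear.
have F t : H1 t -> h1form z t = - k * h1form u t + h1form v t by exact: h1form_linear.
have := h1form_ge0 z; rewrite F// (h1formC u z) (h1formC v z) !F//.
rewrite E// (h1formC u w) (h1formC v w) !E// (h1formC v u); lra.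
Qed.

Lemma H10_H1 K u : H10 Omega K u -> H1 u. Proof. by case. Qed.

Lemma test_H10 K phi : test_function (~` K) phi -> H10 Omega K phi.
Proof.
move=> tphi; have sphi : smooth phi by case: tphi.
apply/H10P; split; first exact: smooth_H1.
move=> e e0; exists phi => //; rewrite (_ : phi \- phi = cst 0).
  have H0 := H1_0; have := h1form_linear 0 H0 H0 H0.
  rewrite mul0r add0r (_ : (cst 0 \* cst 0) \+ cst 0 = cst 0); last first.
    by apply/funext => x /=; rewrite mulr0 addr0.
  move=> _; have := h1form_linear (-1) H0 H0 H0.
  rewrite (_ : (cst (-1) \* cst 0) \+ cst 0 = cst 0); last first.
    by apply/funext => x /=; rewrite mulr0 addr0.
  by rewrite mulN1r addNr => ->.
by apply/funext => x /=; rewrite subrr.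
Qed.

Lemma H10_0 K : H10 Omega K (cst 0).
Proof. exact/test_H10/test_cst0. Qed.

Lemma H10_linear K k u v : H10 Omega K u -> H10 Omega K v ->
  H10 Omega K ((cst k \* u) \+ v).
Proof.
move=> /H10P[Hu hu] /H10P[Hv hv]; apply/H10P; split; first exact: H1_linear.
move=> e e0; pose e1 := e / (4 * (k ^+ 2 + 1)).
have k1 : 0 < k ^+ 2 + 1 by rewrite ltr_wpDl ?sqr_ge0.
have e10 : 0 < e1 by rewrite divr_gt0// mulr_gt0.
have [phi tphi hphi] := hu _ e10; have [psi tpsi hpsi] := hv _ (divr_gt0 e0 (ltr0n R 4)).
exists ((cst k \* phi) \+ psi); first by apply: test_add => //; exact: test_scale.
have tH f : test_function (~` K) f -> H1 f by case=> sf _ _; exact: smooth_H1.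
rewrite (_ : _ \- _ = (cst k \* (u \- phi)) \+ (v \- psi)); last first.
  by apply/funext => x /=; ring.
have Hup := H1B Hu (tH _ tphi); have Hvp := H1B Hv (tH _ tpsi).
apply: le_lt_trans (h1form_sq_linear k Hup Hvp) _.
have : k ^+ 2 * h1form (u \- phi) (u \- phi) <= (k ^+ 2 + 1) * e1.
  by apply: ler_pM; rewrite ?sqr_ge0 ?h1form_ge0 ?lerDl// ltW.
have -> : (k ^+ 2 + 1) * e1 = e / 4 by rewrite /e1; field; exact: lt0r_neq0.
lra.
Qed.

Lemma H10_closed K u : H1 u -> (forall e, 0 < e -> exists2 v, H10 Omega K v &
  h1form (u \- v) (u \- v) < e) -> H10 Omega K u.
Proof.
move=> Hu h; apply/H10P; split => // e e0.
have [v Hv0 hv] := h _ (divr_gt0 e0 (ltr0n R 4)).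
have /H10P[Hv /(_ _ (divr_gt0 e0 (ltr0n R 4)))[phi tphi hphi]] := Hv0.
exists phi => //; have Hp : H1 phi by case: tphi => sf _ _; exact: smooth_H1.
rewrite (_ : u \- phi = (cst 1 \* (u \- v)) \+ (v \- phi)); last first.
  by apply/funext => x /=; ring.
apply: le_lt_trans (h1form_sq_linear 1 (H1B Hu Hv) (H1B Hv Hp)) _.
by rewrite expr1n; lra.
Qed.

Lemma H10_sub K K' u : K `<=` K' -> H10 Omega K' u -> H10 Omega K u.
Proof.
move=> KK' /H10P[Hu h]; apply/H10P; split => // e e0.
have [phi tphi hphi] := h _ e0; exists phi => //.
by apply: test_sub tphi; exact: subsetC.
Qed.

(** The functions and their weak derivatives converge in the space of square
    integrable functions, and the weak derivatives pass to the limit by testing. *)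
Theorem H1_complete (u : nat -> 'rV[R]_n -> R) : (forall k, H1 (u k)) ->
  (forall e, 0 < e -> exists n0 : nat, forall i j, (n0 <= i)%N -> (n0 <= j)%N ->
    h1form (u i \- u j) (u i \- u j) < e) ->
  exists2 l, H1 l & forall e, 0 < e -> exists n0 : nat, forall i, (n0 <= i)%N ->
    h1form (u i \- l) (u i \- l) < e.
Proof.
move=> Hu Cu.
have Lu k : L2 (u k) by exact: H1_L2.
have Lw i k : L2 (wpd i (u k)) by exact: H1_wpd.
have wB i k l : H1 l -> ae_eq mu Omega (wpd i (u k \- l)) (wpd i (u k) \- wpd i l).
  move=> Hl; have := wpd_linear oO bO i (-1) Hl (Hu k).
  rewrite (_ : (cst (-1) \* l) \+ u k = u k \- l); last first.
    by apply/funext => x /=; rewrite mulN1r addrC.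
  by apply: filterS => x /= h Ox; rewrite h//= mulN1r addrC.
have dwB i k l : H1 l -> dotL2 (wpd i (u k \- l)) (wpd i (u k \- l)) =
    dotL2 (wpd i (u k) \- wpd i l) (wpd i (u k) \- wpd i l).
  move=> Hl; have L1 := H1_wpd i (H1B (Hu k) Hl).
  have L2' : L2 (wpd i (u k) \- wpd i l) by apply: L2B; exact: H1_wpd.
  rewrite (ae_eq_L2 mO L1 L2' L1 (wB i k l Hl)) dotL2C.
  by rewrite (ae_eq_L2 mO L1 L2' L2' (wB i k l Hl)).
have [l Ll ul] : exists2 l, L2 l & forall e : R, 0 < e -> exists n0 : nat, forall i,
    (n0 <= i)%N -> dotL2 (u i \- l) (u i \- l) <= e.
  apply: L2_complete => // e e0; have [n0 h] := Cu _ e0; exists n0 => i j hi hj.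
  by apply: le_lt_trans (h _ _ hi hj); rewrite lerDr gradform_ge0.
have /choice[g Hg] : forall i : 'I_n, exists g, L2 g /\ forall e : R, 0 < e ->
    exists n0 : nat, forall k, (n0 <= k)%N -> dotL2 (wpd i (u k) \- g) (wpd i (u k) \- g) <= e.
  move=> i; have [||g Lg hg] := @L2_complete R n Omega mO fO (fun k => wpd i (u k)).
  - by [].
  - move=> e e0; have [n0 h] := Cu _ e0; exists n0 => k j hk hj.
    apply: le_lt_trans (h _ _ hk hj); rewrite -dwB// /h1form /gradform (bigD1 i)//=.
    by rewrite -addrA lerDl addr_ge0 ?dotL2_ge0// sumr_ge0// => *; exact: dotL2_ge0.
  - by exists g.
have wg i : weak_partial Omega i l (g i).
  move=> psi tpsi; have [Lg hg] := Hg i.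
  have Lpsi : L2 psi by apply: smooth_L2 => //; case: tpsi.
  have Ldpsi : L2 (pderiv i psi) by apply/smooth_L2/smooth_pderiv => //; case: tpsi.
  apply/eqP; rewrite -addr_eq0 -sqrf_eq0 eq_le sqr_ge0 andbT.
  apply/ler_addgt0Pr => e e0; rewrite add0r.
  pose A := dotL2 (pderiv i psi) (pderiv i psi) + dotL2 psi psi + 1.
  have A0 : 0 < A by rewrite ltr_wpDl// addr_ge0 ?dotL2_ge0.
  have e10 : 0 < e / (2 * A) by rewrite divr_gt0// mulr_gt0.
  have [n1 h1] := ul _ e10; have [n2 h2] := hg _ e10.
  pose k := maxn n1 n2.
  have {}h1 := h1 k (leq_maxl _ _); have {}h2 := h2 k (leq_maxr _ _).
  have c1 := dotL2_cauchy_schwarz mO (L2B (Lu k) Ll) Ldpsi.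
  have c2 := dotL2_cauchy_schwarz mO (L2B (Lw i k) Lg) Lpsi.
  move: c1 c2; rewrite (dotL2Bl mO (Lu k) Ll Ldpsi) (dotL2Bl mO (Lw i k) Lg Lpsi).
  have -> : dotL2 (u k) (pderiv i psi) = - dotL2 (wpd i (u k)) psi.
    by have [_] := wpdP i (Hu k); apply.
  set a := dotL2 (wpd i (u k)) psi; set x := dotL2 l _; set y := dotL2 (g i) _.
  set P := dotL2 (pderiv i psi) _; set Q := dotL2 psi psi => c1 c2.
  have P0 : 0 <= P by exact: dotL2_ge0.
  have Q0 : 0 <= Q by exact: dotL2_ge0.
  have b1 : (- a - x) ^+ 2 <= e / (2 * A) * P.
    by apply: le_trans c1 _; rewrite ler_wpM2r.
  have b2 : (a - y) ^+ 2 <= e / (2 * A) * Q.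
    by apply: le_trans c2 _; rewrite ler_wpM2r.
  have : (x + y) ^+ 2 <= 2 * (- a - x) ^+ 2 + 2 * (a - y) ^+ 2.
    by have := sqr_ge0 ((- a - x) - (a - y)); rewrite !expr2; lra.
  have : e / (2 * A) * (P + Q) <= e / (2 * A) * A.
    by rewrite ler_pM2l// /A -/P -/Q lerDl.
  have -> : e / (2 * A) * A = e / 2 by field; exact: lt0r_neq0.
  rewrite mulrDr; lra.
have Hl : H1 l by split => // i; exists (g i); [case: (Hg i)|exact: wg].
have wl i : ae_eq mu Omega (wpd i l) (g i).
  by apply: wpd_unique => //; case: (Hg i).
exists l => // e e0.
have e10 : 0 < e / (n.+2)%:R by rewrite divr_gt0.
have /choice[N HN] : forall i : 'I_n, exists n0 : nat, forall k, (n0 <= k)%N ->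
    dotL2 (wpd i (u k \- l)) (wpd i (u k \- l)) <= e / (n.+2)%:R.
  move=> i; have [Lg hg] := Hg i; have [n0 h] := hg _ e10; exists n0 => k hk.
  rewrite dwB//; have L1 : L2 (wpd i (u k) \- wpd i l) by apply: L2B => //; exact: H1_wpd.
  have L2' : L2 (wpd i (u k) \- g i) by exact: L2B.
  have E : ae_eq mu Omega (wpd i (u k) \- wpd i l) (wpd i (u k) \- g i).
    by apply: filterS (wl i) => x /= h' Ox; rewrite h'.
  rewrite (ae_eq_L2 mO L1 L2' L1 E) dotL2C (ae_eq_L2 mO L1 L2' L2' E).
  exact: h.
have [n1 h1] := ul _ e10; exists (n1 + \sum_i N i)%N => k hk.
have Nk i : (N i <= k)%N.
  by apply: leq_trans hk; rewrite (bigD1 i)//= addnCA leq_addr.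
have n1k : (n1 <= k)%N by apply: leq_trans hk; exact: leq_addr.
rewrite /h1form; apply: (@le_lt_trans _ _ (\sum_(i < n) e / n.+2%:R + e / n.+2%:R)).
  by apply: lerD; [apply: ler_sum => i _; exact: HN|exact: h1].
rewrite sumr_const card_ord -mulrSr -[_ *+ n.+1]mulr_natl mulrCA.
by rewrite -[ltRHS]mulr1 ltr_pM2l// ltr_pdivrMr// mul1r ltr_nat.
Qed.

End sobolev_forms.

(** * Increments along segments *)

Section integral_tools.
Local Open Scope ereal_scope.

Lemma tonelli_sets d1 d2 (T1 : measurableType d1) (T2 : measurableType d2) (R : realType)
    (m1 : {sigma_finite_measure set T1 -> \bar R}) (m2 : {sigma_finite_measure set T2 -> \bar R})
    (A : set T1) (B : set T2) (F : T1 * T2 -> \bar R) :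
  measurable A -> measurable B -> measurable_fun setT F -> (forall x, 0 <= F x) ->
  \int[m1]_(x in A) \int[m2]_(y in B) F (x, y) = \int[m2]_(y in B) \int[m1]_(x in A) F (x, y).
Proof.
move=> mA mB mF F0; pose G := F \_ (A `*` B).
have mG : measurable_fun setT G by apply/(measurable_restrictT _ (measurableX mA mB))/measurable_funTS.
have G0 x : 0 <= G x by rewrite /G patchE; case: ifP.
have GE x y : G (x, y) = if (x \in A) && (y \in B) then F (x, y) else 0.
  by rewrite /G patchE in_setX.
transitivity (\int[m1]_x \int[m2]_y G (x, y)).
  rewrite integral_mkcond; apply: eq_integral => x _; rewrite patchE; case: ifPn => xA.
    rewrite integral_mkcond; apply: eq_integral => y _.
    by rewrite GE xA /= patchE.
  by rewrite -[LHS](@integral0 _ _ _ m2 setT); apply: eq_integral => y _; rewrite GE (negPf xA).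
transitivity (\int[m2]_y \int[m1]_x G (x, y)); first exact: fubini_tonelli.
symmetry; rewrite integral_mkcond; apply: eq_integral => y _; rewrite patchE; case: ifPn => yB.
  rewrite integral_mkcond; apply: eq_integral => x _.
  by rewrite GE yB andbT /= patchE.
by rewrite -[LHS](@integral0 _ _ _ m1 setT); apply: eq_integral => x _; rewrite GE (negPf yB) andbF.
Qed.

Lemma measurable_integral_snd d1 d2 (T1 : measurableType d1) (T2 : measurableType d2) (R : realType)
    (m2 : {sigma_finite_measure set T2 -> \bar R}) (B : set T2) (F : T1 * T2 -> \bar R) :
  measurable B -> measurable_fun setT F -> (forall x, 0 <= F x) ->
  measurable_fun setT (fun x => \int[m2]_(y in B) F (x, y)).
Proof.
move=> mB mF F0; pose G := F \_ (setT `*` B).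
have mG : measurable_fun setT G.
  by apply/(measurable_restrictT _ (measurableX measurableT mB))/measurable_funTS.
have G0 x : 0 <= G x by rewrite /G patchE; case: ifP.
have := @measurable_fun_fubini_tonelli_F _ _ _ _ _ m2 G mG G0.
rewrite (_ : fubini_F m2 G = (fun x => \int[m2]_(y in B) F (x, y)))//.
apply/funext => x; rewrite /fubini_F [RHS]integral_mkcond; apply: eq_integral => y _.
by rewrite /G !patchE in_setX in_setT.
Qed.

Lemma measurable_integral_fst d1 d2 (T1 : measurableType d1) (T2 : measurableType d2) (R : realType)
    (m1 : {sigma_finite_measure set T1 -> \bar R}) (A : set T1) (F : T1 * T2 -> \bar R) :
  measurable A -> measurable_fun setT F -> (forall x, 0 <= F x) ->
  measurable_fun setT (fun y => \int[m1]_(x in A) F (x, y)).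
Proof.
move=> mA mF F0; pose G := F \_ (A `*` setT).
have mG : measurable_fun setT G.
  by apply/(measurable_restrictT _ (measurableX mA measurableT))/measurable_funTS.
have G0 x : 0 <= G x by rewrite /G patchE; case: ifP.
have := @measurable_fun_fubini_tonelli_G _ _ _ _ _ m1 G mG G0.
rewrite (_ : fubini_G m1 G = (fun y => \int[m1]_(x in A) F (x, y)))//.
apply/funext => y; rewrite /fubini_G [RHS]integral_mkcond; apply: eq_integral => x _.
by rewrite /G !patchE in_setX in_setT andbT.
Qed.

Lemma integral_le_cover d (T : measurableType d) (R : realType) (mu : {measure set T -> \bar R})
    (I : eqType) (s : seq I) (A : set T) (B : I -> set T) (f : T -> \bar R) :
  measurable A -> (forall i, measurable (B i)) -> measurable_fun setT f -> (forall x, 0 <= f x) ->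
  (forall x, A x -> exists2 i, i \in s & B i x) ->
  \int[mu]_(x in A) f x <= \sum_(i <- s) \int[mu]_(x in B i) f x.
Proof.
move=> mA mB mf f0 cov.
have mfB i : measurable_fun setT (f \_ (B i)).
  by apply/(measurable_restrictT _ (mB i)); exact: measurable_funTS.
have fB0 i x : 0 <= (f \_ (B i)) x by rewrite patchE; case: ifP.
rewrite integral_mkcond.
under [leRHS]eq_bigr do rewrite integral_mkcond.
rewrite -ge0_integral_sum//; apply: ge0_le_integral => //.
- by move=> x _; rewrite patchE; case: ifP.
- by apply/(measurable_restrictT _ mA); exact: measurable_funTS.
- exact: emeasurable_sum.
- move=> x _; rewrite patchE; case: ifPn => [|_]; last by apply: sume_ge0.
  rewrite inE => /cov[i si Bix].
  rewrite (big_rem i)//= patchE mem_set// leeDl//.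
  by apply: sume_ge0.
Qed.

End integral_tools.

Section segment.
Context {R : realType} {n : nat}.
Local Notation mu := (@lebesgue_rV R n).
Local Notation leb := (@lebesgue_measure R).
Implicit Types (phi : 'rV[R]_n -> R) (x z : 'rV[R]_n).

Definition sqgrad phi x : R := \sum_(i < n) pderiv i phi x ^+ 2.

Definition sqlen z : R := \sum_(i < n) z ord0 i ^+ 2.

Lemma sqgrad_ge0 phi x : 0 <= sqgrad phi x.
Proof. by apply: sumr_ge0 => i _; exact: sqr_ge0. Qed.

Lemma sqlen_ge0 z : 0 <= sqlen z.
Proof. by apply: sumr_ge0 => i _; exact: sqr_ge0. Qed.

Lemma sqlenZ t z : sqlen (t *: z) = t ^+ 2 * sqlen z.
Proof. by rewrite /sqlen mulr_sumr; apply: eq_bigr => i _; rewrite mxE exprMn. Qed.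

Lemma continuous_sum (I : Type) (s : seq I) (F : I -> 'rV[R]_n -> R) :
  (forall i, continuous (F i)) -> continuous (fun x => \sum_(i <- s) F i x).
Proof.
move=> cF; elim: s => [|i s IH].
  rewrite (_ : (fun _ => _) = cst 0); first exact: cst_continuous.
  by apply/funext => x; rewrite big_nil.
rewrite (_ : (fun _ => _) = F i \+ (fun x => \sum_(j <- s) F j x)).
  by move=> x; exact: (cvgD (cF i x) (IH x)).
by apply/funext => x; rewrite big_cons.
Qed.

Lemma continuous_sq (f : 'rV[R]_n -> R) : continuous f -> continuous (fun x => f x ^+ 2).
Proof. by move=> cf x; exact: (cvgM (cf x) (cf x)). Qed.

Lemma sqgrad_continuous phi : smooth phi -> continuous (sqgrad phi).
Proof.
move=> sphi; apply: continuous_sum => i; apply: continuous_sq.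
exact/smooth_continuous/smooth_pderiv.
Qed.

Lemma line_continuous x z : continuous (fun s : R => s *: z + x).
Proof.
move=> s; apply: cvgD; last exact: cvg_cst.
by apply: cvgZr_tmp.
Qed.

Lemma sum_cauchy_schwarz (a b : 'I_n -> R) :
  (\sum_i a i * b i) ^+ 2 <= (\sum_i a i ^+ 2) * \sum_i b i ^+ 2.
Proof.
pose m (s t : R^o) : R := s * t.
have Hm : sbilin m by split=> [u v|k u v w]; [exact: mulrC|rewrite /m mulrDl -mulrA].
have m0 : nonneg_on setT m by move=> u _; exact: sqr_ge0.
have := @sq_sum_le R R^o m n a b Hm m0.
by rewrite /m -expr2.
Qed.

(** The increment is the integral over the segment of the derivative along it;
    then Jensen's and the Cauchy-Schwarz inequality. *)
Lemma increment_sq_le phi x z : smooth phi ->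
  (((phi (x + z) - phi x) ^+ 2)%:E <=
   \int[leb]_(s in `[0%R, 1%R]) (sqlen z * sqgrad phi (x + s *: z))%:E)%E.
Proof.
move=> sphi; pose g (s : R) := phi (s *: z + x).
pose dg (s : R) := \sum_i z ord0 i * pderiv i phi (s *: z + x).
have gd (s : R) : is_derive s 1 g (dg s).
  apply: (@is_derive_line _ _ phi x z _ s).1; exact: smooth_derive.
have cg : continuous g.
  by move=> s; apply: differentiable_continuous; apply/derivable1_diffP; case: (gd s).
have cdg : continuous dg.
  have cD : continuous (fun y => \sum_i z ord0 i * pderiv i phi y).
    apply: continuous_sum => i y.
    have h := @smooth_continuous _ _ _ (smooth_pderiv i sphi) y.
    exact: (cvgMl_tmp (a := z ord0 i) h).
  by move=> s; exact: (cvg_comp _ _ (@line_continuous x z s) (cD _)).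
set a := phi (x + z) - phi x.
have aE : \int[leb]_(s in `[0, 1]) dg s = a.
  rewrite /Rintegral (@continuous_FTC2 R dg g 0 1 ltr01).
  - by rewrite /g /a /= scale1r scale0r add0r [z + x]addrC.
  - exact: continuous_subspaceT.
  - split.
    + by move=> s _; case: (gd s).
    + by apply: cvg_at_right_filter; exact: cg.
    + by apply: cvg_at_left_filter; exact: cg.
  - by move=> s _; rewrite derive1E; case: (gd s).
have m01 : measurable (`[0, 1]%classic : set R) by exact: measurable_itv.
have int_cont (f : R -> R) : continuous f -> leb.-integrable `[0, 1] (EFin \o f).
  move=> cf; apply: continuous_compact_integrable; first exact: segment_compact.
  exact: continuous_subspaceT.
have idg := int_cont _ cdg.
have cdg2 : continuous (fun s => dg s ^+ 2) by move=> s; exact: (cvgM (cdg s) (cdg s)).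
have l01 : leb `[0, 1] = 1%E.
  by rewrite lebesgue_measure_itv /= lte_fin ltr01 sube0.
have jensen : a ^+ 2 <= \int[leb]_(s in `[0, 1]) (dg s ^+ 2).
  have : 0 <= \int[leb]_(s in `[0, 1]) ((dg s - a) ^+ 2).
    by apply: Rintegral_ge0 => s _; exact: sqr_ge0.
  have -> : \int[leb]_(s in `[0, 1]) ((dg s - a) ^+ 2) =
     \int[leb]_(s in `[0, 1]) (dg s ^+ 2 + ((- (2 * a)) * dg s + a ^+ 2)).
    by apply: eq_Rintegral => s _; ring.
  have i2 : leb.-integrable `[0, 1] (EFin \o (fun s => - (2 * a) * dg s)).
    by apply: int_cont => s; exact: (cvgMl_tmp (a := - (2 * a)) (cdg s)).
  have i3 : leb.-integrable `[0, 1] (EFin \o (fun s : R => a ^+ 2)).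
    by apply: int_cont => s; exact: cvg_cst.
  rewrite RintegralD//; last 2 first.
  - exact: int_cont.
  - exact: (@integrableD _ _ _ leb _ m01 _ _ i2 i3).
  rewrite RintegralD// RintegralZl// aE.
  have -> : \int[leb]_(s in `[0, 1]) (a ^+ 2) = a ^+ 2.
    transitivity (a ^+ 2 * fine (leb `[0, 1])); first exact: Rintegral_cst.
    by rewrite l01 mulr1.
  lra.
apply: (@le_trans _ _ (\int[leb]_(s in `[0%R, 1%R]) (dg s ^+ 2)%:E)%E).
  have i4 := int_cont _ cdg2.
  have fin : (\int[leb]_(s in `[0%R, 1%R]) (dg s ^+ 2)%:E)%E \is a fin_num.
    by apply: integrable_fin_num => //.
  by move: jensen; rewrite /Rintegral -lee_fin fineK.
apply: ge0_le_integral => //.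
- by move=> s _; rewrite lee_fin sqr_ge0.
- exact: (measurable_int _ (int_cont _ cdg2)).
- apply: (measurable_int leb); apply: int_cont => s.
  under eq_fun do rewrite addrC.
  have h := cvg_comp _ _ (@line_continuous x z s) (@sqgrad_continuous phi sphi _).
  exact: (cvgMl_tmp (a := sqlen z) h).
- move=> s _; rewrite lee_fin [x + _]addrC; exact: sum_cauchy_schwarz.
Qed.

Lemma measurable_line z : measurable_fun setT (fun p : 'rV[R]_n * R => p.1 + p.2 *: z).
Proof.
apply: measurable_fun_rV => i; under eq_fun do rewrite !mxE.
apply: measurable_funD.
  exact: (measurableT_comp (measurable_rV_coord i) measurable_fst).
by apply: measurable_funM => //; exact: measurable_snd.
Qed.

Local Open Scope ereal_scope.

(** Integrating the pointwise bound and exchanging the integrals leaves, for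
    each [s], the integral of the gradient over the translate of [A] by [s z],
    which lies in [B]. *)
Lemma segment_estimate phi z (A B : set 'rV[R]_n) : smooth phi ->
  measurable A -> measurable B ->
  (forall x, A x -> forall s : R, (0 <= s <= 1)%R -> B (x + s *: z)%R) ->
  \int[mu]_(x in A) ((phi (x + z)%R - phi x) ^+ 2)%:E <=
  (sqlen z)%:E * \int[mu]_(x in B) (sqgrad phi x)%:E.
Proof.
move=> sphi mA mB AB.
have mD : measurable_fun setT (fun x => (sqgrad phi x)%:E).
  by apply/measurable_EFinP; apply: continuous_measurable_rV; apply: sqgrad_continuous.
have D0 x : 0 <= (sqgrad phi x)%:E by rewrite lee_fin sqgrad_ge0.
have mphi : measurable_fun setT phi by apply: continuous_measurable_rV; apply: smooth_continuous.
pose F (p : 'rV[R]_n * R) := (sqlen z * sqgrad phi (p.1 + p.2 *: z))%:E.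
have mF : measurable_fun setT F.
  apply/measurable_EFinP; apply: measurable_funM => //.
  apply: (measurableT_comp _ (measurable_line z)).
  by apply: continuous_measurable_rV; apply: sqgrad_continuous.
have F0 p : 0 <= F p.
  by rewrite /F lee_fin mulr_ge0//; [exact: sqlen_ge0|exact: sqgrad_ge0].
have m01 : measurable (`[0%R, 1%R]%classic : set R) by exact: measurable_itv.
have l01 : leb `[0%R, 1%R] = 1.
  by rewrite lebesgue_measure_itv /= lte_fin ltr01 sube0.
apply: (@le_trans _ _ (\int[mu]_(x in A) \int[leb]_(s in `[0%R, 1%R]) F (x, s))).
  apply: ge0_le_integral => //.
  - by move=> x _; rewrite lee_fin sqr_ge0.
  - apply/measurable_EFinP; apply: measurable_funX; apply: measurable_funB.
      exact: measurable_funTS (measurableT_comp mphi (measurable_rV_shift z)).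
    exact: measurable_funTS.
  - exact: measurable_funTS (measurable_integral_snd leb m01 mF F0).
  - by move=> x _; exact: increment_sq_le.
rewrite tonelli_sets//.
apply: (@le_trans _ _ (\int[leb]_(s in `[0%R, 1%R])
    cst ((sqlen z)%:E * \int[mu]_(x in B) (sqgrad phi x)%:E) s)); last first.
  set K := (_ * _)%E.
  have E : \int[leb]_(s in `[0%R, 1%R]) cst K s = K * leb `[0%R, 1%R] by exact: integral_cst.
  by rewrite E l01 mule1.
apply: ge0_le_integral => //.
- by move=> s _; exact: integral_ge0.
- exact: measurable_funTS (measurable_integral_fst mu mA mF F0).
- move=> s; rewrite /= in_itv /= => s01.
  have mDs : measurable_fun A (fun x => (sqgrad phi (x + s *: z)%R)%:E).
    by apply: measurable_funTS; exact: (measurableT_comp mD (measurable_rV_shift (s *: z))).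
  have -> : \int[mu]_(x in A) F (x, s) =
      (sqlen z)%:E * \int[mu]_(x in A) (sqgrad phi (x + s *: z)%R)%:E.
    rewrite -(ge0_integralZl mu mA mDs); last 2 first.
    - by move=> x _; exact: D0.
    - by rewrite lee_fin sqlen_ge0.
    by apply: eq_integral => x _; rewrite /F EFinM.
  apply: lee_wpmul2l; first by rewrite lee_fin sqlen_ge0.
  rewrite (ge0_integral_rV_shift (s *: z)%R mB)//; last exact: measurable_funTS.
  apply: ge0_subset_integral => //.
  - by rewrite -[X in measurable X]setTI; exact: measurable_rV_shift.
  - by apply: measurable_funTS; exact: (measurableT_comp mD (measurable_rV_shift (s *: z))).
  - by move=> x Ax; exact: AB.
Qed.

End segment.

(** * Boundary layers *)

Section boundary_layer.
Context {R : realType} {n : nat}.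
Local Notation mu := (@lebesgue_rV R n).
Local Notation leb := (@lebesgue_measure R).
Implicit Types (phi : 'rV[R]_n -> R).

Section graph_coordinates.
Variables (Q : 'M[R]_n) (k : 'I_n) (g : 'rV[R]_n.-1 -> R).
Hypotheses (QQ : Q *m Q^T = 1%:M) (Lg : lipschitz g).

Definition height (y : 'rV[R]_n) : R := (y *m Q) ord0 k - g (col' k (y *m Q)).

Definition vertical : 'rV[R]_n := delta_mx ord0 k *m Q^T.

Lemma height_vertical y t : height (y + t *: vertical) = height y + t.
Proof.
have E : (y + t *: vertical) *m Q = y *m Q + t *: delta_mx ord0 k.
  rewrite mulmxDl -scalemxAl /vertical -mulmxA.
  by rewrite (mulmx1C QQ) mulmx1.
rewrite /height E; have -> : col' k (y *m Q + t *: delta_mx ord0 k) = col' k (y *m Q).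
  apply/rowP => j; rewrite !mxE /= (_ : lift k j == k = false) ?andbF ?mulr0 ?addr0//.
  by apply/negbTE; rewrite eq_sym neq_lift.
by rewrite !mxE !eqxx mulr1; ring.
Qed.

Lemma height_continuous : continuous height.
Proof.
have [M hM] : exists M : R, forall x y, `|g x - g y| <= M * `|x - y|.
  have [M [_ hM]] := Lg; exists (M + 1) => x y.
  by apply: (hM (M + 1) _ (x, y)); rewrite ?ltrDl.
pose C := \sum_(i < n) \sum_(j < n) `|Q i j|.
have C0 : 0 <= C by apply: sumr_ge0 => i _; apply: sumr_ge0.
have lin (x y : 'rV[R]_n) j : `|(x *m Q) ord0 j - (y *m Q) ord0 j| <= C * `|x - y|.
  rewrite !mxE -sumrB; apply: le_trans (ler_norm_sum _ _ _) _.
  rewrite /C mulr_suml; apply: ler_sum => i _.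
  rewrite -mulrBl normrM mulrC; apply: ler_pM => //.
    by rewrite (bigD1 j)//= lerDl; apply: sumr_ge0.
  by have := coord_le_norm (x - y) i; rewrite !mxE.
have lip x y : `|height x - height y| <= (C + `|M| * C) * `|x - y|.
  have -> : height x - height y = ((x *m Q) ord0 k - (y *m Q) ord0 k) -
      (g (col' k (x *m Q)) - g (col' k (y *m Q))) by rewrite /height; ring.
  apply: le_trans (ler_normB _ _) _; rewrite mulrDl; apply: lerD; first exact: lin.
  apply: le_trans (hM _ _) _; apply: (@le_trans _ _ (`|M| * `|col' k (x *m Q) - col' k (y *m Q)|)).
    by rewrite ler_wpM2r// ler_norm.
  rewrite -mulrA ler_wpM2l//; apply: rV_norm_le; first by rewrite mulr_ge0.
  by move=> j; have := lin x y (lift k j); rewrite !mxE.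
move=> x; apply/(@cvgrPdist_le _ _ _ (nbhs x)) => e e0.
have D0 : 0 < C + `|M| * C + 1 by rewrite ltr_wpDl// addr_ge0// mulr_ge0.
have d0 : 0 < e / (C + `|M| * C + 1) by rewrite divr_gt0.
have /= := @nbhsx_ballx _ _ x _ d0; apply: (@filterS _ (nbhs x)) => y.
rewrite mx_norm_ball /= => xy.
apply: le_trans (lip x y) _; move/ltW : xy.
rewrite ler_pdivlMr// mulrC; apply: le_trans.
by rewrite ler_wpM2r// lerDl.
Qed.

End graph_coordinates.

Local Open Scope ereal_scope.

(** Let [L] be the layer of height [delta] above the graph. The translates of [L]
    in the vertical direction by [t] up to [T] stay in [Omega] and differ from
    [L] in mass by the energy times [T ^ 2]; on average over [t] their mass is
    small, because a given point lies in the translate for a set of parameters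
    of length [delta] only. *)
Lemma layer_estimate (Omega L : set 'rV[R]_n) (e : 'rV[R]_n) (h : 'rV[R]_n -> R) (T delta : R) phi :
  measurable Omega -> measurable L -> measurable_fun setT h -> smooth phi ->
  (0 < T)%R -> (0 < delta)%R ->
  (forall (y : 'rV[R]_n) (t : R), h (y + t *: e) = h y + t)%R ->
  (forall y, L y -> 0 < h y < delta)%R ->
  (forall (y : 'rV[R]_n) (t : R), L y -> (0 <= t <= T)%R -> Omega (y + t *: e)%R) ->
  \int[mu]_(x in L) (phi x ^+ 2)%:E <=
  (2 * delta / T)%:E * \int[mu]_(x in Omega) (phi x ^+ 2)%:E +
  (2 * T ^+ 2 * sqlen e)%:E * \int[mu]_(x in Omega) (sqgrad phi x)%:E.
Proof.
move=> mO mL mh sphi T0 d0 hE hL LO.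
have cphi : continuous phi by apply: smooth_continuous.
have mphi : measurable_fun setT phi by exact: continuous_measurable_rV.
have mphi2 : measurable_fun setT (fun x => (phi x ^+ 2)%:E).
  by apply/measurable_EFinP; exact: measurable_funX.
have p0 x : 0 <= (phi x ^+ 2)%:E by rewrite lee_fin sqr_ge0.
set b := \int[mu]_(x in Omega) (phi x ^+ 2)%:E.
set G := \int[mu]_(x in Omega) (sqgrad phi x)%:E.
set A := \int[mu]_(x in L) (phi x ^+ 2)%:E.
have b0 : 0 <= b by exact: integral_ge0.
have G0 : 0 <= G by apply: integral_ge0 => x _; rewrite lee_fin sqgrad_ge0.
have A0 : 0 <= A by exact: integral_ge0.
have msh t : measurable_fun setT (fun x : 'rV[R]_n => (phi (x + t *: e)%R ^+ 2)%:E).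
  exact: (measurableT_comp mphi2 (measurable_rV_shift (t *: e))).
pose B t := \int[mu]_(x in L) (phi ((x : 'rV[R]_n) + t *: e)%R ^+ 2)%:E.
have B0 t : 0 <= B t by apply: integral_ge0 => x _; rewrite lee_fin sqr_ge0.
have S0 : (0 <= sqlen e)%R by exact: sqlen_ge0.
have step t : (0 <= t <= T)%R -> A <= 2%:E * B t + (2 * T ^+ 2 * sqlen e)%:E * G.
  move=> /andP[t0 tT].
  have md : measurable_fun L (fun x : 'rV[R]_n => ((phi (x + t *: e)%R - phi x) ^+ 2)%:E).
    apply/measurable_EFinP; apply: measurable_funX; apply: measurable_funB.
      exact: measurable_funTS (measurableT_comp mphi (measurable_rV_shift (t *: e))).
    exact: measurable_funTS.
  apply: (@le_trans _ _ (\int[mu]_(x in L) (2%:E * (phi ((x : 'rV[R]_n) + t *: e)%R ^+ 2)%:E +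
      2%:E * ((phi (x + t *: e)%R - phi x) ^+ 2)%:E))).
    apply: ge0_le_integral => //.
    - exact: measurable_funTS.
    - apply: emeasurable_funD; apply: measurable_funeM => //.
      exact: measurable_funTS.
    - move=> x _; rewrite -!EFinM -EFinD lee_fin.
      have := sqr_ge0 (2 * phi (x + t *: e) - phi x)%R.
      by move: (phi _) (phi _) => u v; rewrite !expr2; lra.
  rewrite ge0_integralD//; last 4 first.
  - by move=> x _; rewrite -EFinM lee_fin mulr_ge0// sqr_ge0.
  - by apply: measurable_funeM; exact: measurable_funTS.
  - by move=> x _; rewrite -EFinM lee_fin mulr_ge0// sqr_ge0.
  - exact: measurable_funeM.
  apply: leeD.
    rewrite (ge0_integralZl mu mL)//; last exact: measurable_funTS.
  rewrite (ge0_integralZl mu mL)//; last by move=> x _; rewrite lee_fin sqr_ge0.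
  apply: (@le_trans _ _ (2%:E * ((sqlen (t *: e))%:E * G))).
    apply: lee_wpmul2l; first by rewrite lee_fin.
    apply: segment_estimate => // x Lx s /andP[s0 s1].
    rewrite scalerA; apply: LO => //; rewrite mulr_ge0//=.
    by apply: le_trans tT; rewrite ler_piMl.
  rewrite muleA -EFinM; apply: lee_wpmul2r => //.
  rewrite lee_fin sqlenZ -mulrA ler_pM2l// ler_wpM2r//.
  by rewrite ler_sqr ?nnegrE// (le_trans t0).
pose D t := [set z : 'rV[R]_n | L (z + (- t) *: e)%R].
have mD t : measurable (D t).
  by rewrite -[X in measurable X]setTI; exact: (measurable_rV_shift ((- t) *: e)).
pose F (p : 'rV[R]_n * R) := (\1_L (p.1 + p.2 *: (- e)) * phi p.1 ^+ 2)%:E.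
have mF : measurable_fun setT F.
  apply/measurable_EFinP; apply: measurable_funM.
    exact: (measurableT_comp (measurable_indic mL) (measurable_line (- e)%R)).
  by apply: measurable_funX; exact: (measurableT_comp mphi measurable_fst).
have F0 p : 0 <= F p by rewrite lee_fin mulr_ge0 ?sqr_ge0// indicE.
have mT : measurable (`[0%R, T]%classic : set R) by exact: measurable_itv.
have lT : leb `[0%R, T] = T%:E by rewrite lebesgue_measure_itv /= lte_fin T0 sube0.
have BE t : (0 <= t <= T)%R -> B t = \int[mu]_(z in Omega) F (z, t).
  move=> tT; have DO : D t `<=` Omega.
    move=> z Dz; have := LO _ _ Dz tT.
    by rewrite scaleNr subrK.
  transitivity (\int[mu]_(z in D t) (phi z ^+ 2)%:E).
    rewrite (ge0_integral_rV_shift (t *: e)%R (mD t))//; last exact: measurable_funTS.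
    rewrite (_ : rV_shift _ @^-1` _ = L)//; apply/seteqP; split => x /=.
      by rewrite /D /rV_shift /= scaleNr addrK.
    by rewrite /D /rV_shift /= scaleNr addrK.
  rewrite -(setIidr DO) integral_mkcondr; apply: eq_integral => z _.
  rewrite patchE /F /= indicE scalerN -scaleNr; case: ifPn => zD.
    by rewrite mem_set ?mul1r//; move: zD; rewrite inE.
  by rewrite memNset ?mul0r//; move: zD; rewrite notin_setE.
have J : \int[leb]_(t in `[0%R, T]) B t <= delta%:E * b.
  rewrite (_ : \int[leb]_(t in `[0%R, T]) B t =
      \int[leb]_(t in `[0%R, T]) \int[mu]_(z in Omega) F (z, t)); last first.
    by apply: eq_integral => t; rewrite inE /= in_itv /=; exact: BE.
  rewrite -tonelli_sets//.
  rewrite -(ge0_integralZl mu mO)//; [|exact: measurable_funTS|by rewrite lee_fin ltW].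
  apply: ge0_le_integral => //.
  - by move=> z _; exact: integral_ge0.
  - exact: measurable_funTS (measurable_integral_snd leb mT mF F0).
  - by apply: measurable_funeM; exact: measurable_funTS.
  move=> z _.
  have mI : measurable (`](h z - delta)%R, h z[%classic : set R) by exact: measurable_itv.
  apply: (@le_trans _ _ (\int[leb]_(t in `[0%R, T]) (\1_(`](h z - delta)%R, h z[%classic) t * phi z ^+ 2)%:E)).
    apply: ge0_le_integral => //.
    - exact: measurable_funTS (measurable_fun_pair2 z mF).
    - apply/measurable_EFinP; apply: measurable_funM; last exact: measurable_cst.
      exact: (measurable_indic mI).
    - move=> t _; rewrite lee_fin ler_wpM2r ?sqr_ge0// !indicE.
      case: (boolP (_ \in L)) => // zL; rewrite mem_set//= in_itv /=.
      have := hL _ (set_mem zL); rewrite /= scalerN -scaleNr hE.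
      by move=> /andP[? ?]; apply/andP; split; lra.
  under eq_integral do rewrite mulrC EFinM.
  have lI : leb `](h z - delta)%R, h z[ = delta%:E.
    rewrite lebesgue_measure_itv /= lte_fin ifT; last by lra.
    by rewrite -EFinB; congr EFin; lra.
  rewrite (ge0_integralZl leb mT)//; last first.
  - by apply/measurable_EFinP; exact: (measurable_indic mI).
  rewrite (integral_indic leb mT mI) muleC; apply: lee_wpmul2r => //.
  rewrite -lI; apply: le_measure; rewrite ?inE//; exact: measurableI.
have Tpos : 0 < T%:E by rewrite lte_fin.
have C0 : 0 <= (2 * T ^+ 2 * sqlen e)%:E * G.
  by apply: mule_ge0 => //; rewrite lee_fin mulr_ge0// mulr_ge0 ?exprn_ge0// ltW//.
have fin : T%:E * A <= 2%:E * (delta%:E * b) + T%:E * ((2 * T ^+ 2 * sqlen e)%:E * G).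
  have -> : T%:E * A = \int[leb]_(t in `[0%R, T]) cst A t.
    rewrite muleC -lT; symmetry; exact: integral_cst.
  have -> : T%:E * ((2 * T ^+ 2 * sqlen e)%:E * G) =
      \int[leb]_(t in `[0%R, T]) cst ((2 * T ^+ 2 * sqlen e)%:E * G) t.
    rewrite muleC -lT; symmetry; exact: integral_cst.
  have mB : measurable_fun setT B.
    pose F' (p : 'rV[R]_n * R) := (phi (p.1 + p.2 *: e)%R ^+ 2)%:E.
    have mF' : measurable_fun setT F'.
      apply/measurable_EFinP; apply: measurable_funX.
      exact: (measurableT_comp mphi (measurable_line e)).
    exact: (measurable_integral_fst mu mL mF' (fun p => p0 _)).
  apply: (@le_trans _ _ (\int[leb]_(t in `[0%R, T])
      (2%:E * B t + cst ((2 * T ^+ 2 * sqlen e)%:E * G) t))).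
    apply: ge0_le_integral => //.
    - by apply: emeasurable_funD => //; apply: measurable_funeM; exact: measurable_funTS.
  rewrite (ge0_integralD leb mT); last 4 first.
  - by move=> t _; apply: mule_ge0 => //.
  - by apply: measurable_funeM; exact: measurable_funTS.
  - by move=> t _; exact: C0.
  - exact: measurable_cst.
  apply: leeD => //.
  rewrite (ge0_integralZl leb mT)//; last exact: measurable_funTS.
  exact: lee_wpmul2l.
have -> : (2 * delta / T)%:E * b = T^-1%:E * (2%:E * (delta%:E * b)).
  by rewrite !muleA -!EFinM mulrC mulrA.
have -> : (2 * T ^+ 2 * sqlen e)%:E * G = T^-1%:E * (T%:E * ((2 * T ^+ 2 * sqlen e)%:E * G)).
  by rewrite muleA -EFinM mulVf ?gt_eqF// mul1e.
rewrite -ge0_muleDr; last 2 first.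
- by apply: mule_ge0; [|apply: mule_ge0 b0; rewrite lee_fin ltW].
- by apply: mule_ge0 C0; rewrite lee_fin ltW.
by rewrite lee_pdivlMl.
Qed.

(** Both constants of the layer estimate become small on choosing the length [T]
    of the translations first, and then [delta = eta T / 2]. *)
Lemma boundary_chart (Omega : set 'rV[R]_n) (x0 : 'rV[R]_n) :
  open Omega -> lipschitz_boundary Omega -> (closure Omega `\` Omega°) x0 ->
  exists B : set 'rV[R]_n, [/\ open B, B x0 &
    forall eta : R, (0 < eta)%R -> exists O : set 'rV[R]_n, [/\ open O,
      B `\` Omega `<=` O &
      forall phi, smooth phi -> \int[mu]_(x in O `&` Omega) (phi x ^+ 2)%:E <=
        eta%:E * (\int[mu]_(x in Omega) (phi x ^+ 2)%:E +
                  \int[mu]_(x in Omega) (sqgrad phi x)%:E)]].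
Proof.
move=> oO lO /lO[Q [k [g [U [QQ Lg /nbhs_ballP[d /= d0 dU] UE]]]]].
have hc := height_continuous (Q := Q) (k := k) Lg.
pose r := (d / 2)%R; have r0 : (0 < r)%R by rewrite divr_gt0.
exists (ball x0 r); split; [exact: ball_open|exact: ballxx|] => eta eta0.
pose e := vertical Q k; pose S := sqlen e; have S0 : (0 <= S)%R by exact: sqlen_ge0.
pose T := Num.min 1%R (Num.min (r / (`|e| + 1)) (eta / (2 * S + 1)))%R.
have D1 : (0 < `|e| + 1)%R by rewrite ltr_wpDl.
have D2 : (0 < 2 * S + 1)%R by rewrite ltr_wpDl// mulr_ge0.
have T0 : (0 < T)%R by rewrite !lt_min ltr01/= !divr_gt0.
have T1 : (T <= 1)%R by rewrite ge_min lexx.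
have Tr : (T * `|e| <= r)%R.
  have : (T <= r / (`|e| + 1))%R by rewrite /T !ge_min lexx orbT.
  by rewrite ler_pdivlMr//; apply: le_trans; rewrite ler_pM2l// lerDl.
have Teta : (2 * T ^+ 2 * S <= eta)%R.
  have : (T <= eta / (2 * S + 1))%R by rewrite /T !ge_min lexx !orbT.
  rewrite ler_pdivlMr//; apply: le_trans.
  have TT : (T ^+ 2 <= T)%R by rewrite expr2 ler_piMl// ltW.
  apply: (@le_trans _ _ (2 * T * S)%R); last by rewrite mulrDr mulr1 mulrA [(T * 2)%R]mulrC lerDl ltW.
  by rewrite ler_wpM2r// ler_pM2l.
pose delta := (eta * T / 2)%R; have de0 : (0 < delta)%R by rewrite divr_gt0// mulr_gt0.
have inU (y : 'rV[R]_n) (t : R) : ball x0 r y -> (0 <= t <= T)%R -> U (y + t *: e)%R.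
  rewrite mx_norm_ball /= => yr /andP[t0 tT]; apply: dU; rewrite mx_norm_ball /=.
  rewrite opprD addrA; apply: le_lt_trans (ler_normB _ _) _.
  rewrite normrZ ger0_norm//.
  have : (t * `|e| <= r)%R by apply: le_trans Tr; rewrite ler_wpM2r.
  rewrite /r; rewrite /r in yr; lra.
have ballU y : ball x0 r y -> U y.
  by move=> By; have := inU y 0%R By; rewrite scale0r addr0; apply; rewrite lexx ltW.
have OE y : U y -> Omega y <-> (0 < height Q k g y)%R.
  by move=> Uy; rewrite subr_gt0; exact: UE.
pose O := ball x0 r `&` [set y | (height Q k g y < delta)%R].
have oOO : open O.
  apply: openI; first exact: ball_open.
  by apply: (@open_comp _ _ (height Q k g) [set t | (t < delta)%R]) => //; exact: open_lt.
exists O; split => //.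
  move=> y [By nOy]; split => //=.
  apply: le_lt_trans de0; rewrite leNgt; apply/negP => h0; apply: nOy.
  by apply/OE => //; exact: ballU.
move=> phi sphi.
have mO : measurable Omega by exact: open_measurable_rV.
have mL : measurable (O `&` Omega) by apply: measurableI => //; exact: open_measurable_rV.
have mh : measurable_fun setT (height Q k g) by exact: continuous_measurable_rV.
apply: le_trans (layer_estimate mO mL mh sphi T0 de0 (height_vertical k g QQ) _ _) _.
- by move=> y [[By /= hy] Oy]; rewrite hy andbT; apply/OE => //; exact: ballU.
- move=> y t [[By _] Oy] tT; apply/OE; first exact: inU.
  rewrite height_vertical//; case/andP: tT => t0 _.
  by rewrite ltr_wpDr//; apply/OE => //; exact: ballU.
have b0 : 0 <= \int[mu]_(x in Omega) (phi x ^+ 2)%:E.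
  by apply: integral_ge0 => x _; rewrite lee_fin sqr_ge0.
have G0 : 0 <= \int[mu]_(x in Omega) (sqgrad phi x)%:E.
  by apply: integral_ge0 => x _; rewrite lee_fin sqgrad_ge0.
have dT : (2 * delta / T = eta)%R by rewrite /delta; field; rewrite gt_eqF.
by rewrite [leRHS]ge0_muleDr// dT; apply: leeD => //; apply: lee_wpmul2r.
Qed.

End boundary_layer.

Section rellich.
Context {R : realType} {n : nat}.
Local Notation mu := (@lebesgue_rV R n).
Implicit Types (phi : 'rV[R]_n -> R).

Lemma compact_finite_cover (A : set 'rV[R]_n) (B : 'rV[R]_n -> set 'rV[R]_n) :
  compact A -> (forall x, A x -> open (B x) /\ B x x) ->
  exists s : seq 'rV[R]_n, (forall x, x \in s -> A x) /\
    (forall y, A y -> exists2 x, x \in s & B x y).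
Proof.
rewrite compact_cover => cA AB.
have [x Ax|y Ay|D DA AD] := cA _ A B.
- by have [] := AB _ Ax.
- by exists y => //; have [] := AB _ Ay.
exists (finmap.enum_fset D); split.
  by move=> x xD; apply/set_mem/DA.
by move=> y /AD[x /= xD Bxy]; exists x.
Qed.

Lemma bounded_closure_compact (A : set 'rV[R]_n) : bounded_set A -> compact (closure A).
Proof.
move=> /bounded_in_obox[M [AM _]].
have sub : closure A `<=` cbox (const_mx (- M)) (const_mx M).
  move=> x Ax; rewrite ((closure_id _).1 (@cbox_closed _ _ _ _)).
  by apply: closureS Ax => y /AM; exact: obox_cbox.
exact: closed_sub_compact (@closed_closure _ A) (@cbox_compact _ _ _ _) sub.
Qed.

Lemma compact_in_open (K U : set 'rV[R]_n) : compact K -> open U -> K `<=` U ->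
  exists2 r : R, 0 < r & forall x, K x -> ball x r `<=` U.
Proof.
move=> cK oU KU.
have /choice[r hr] : forall x, exists r : R, K x -> 0 < r /\ ball x (r + r) `<=` U.
  move=> x; have [Kx|nKx] := pselect (K x); last by exists 0.
  have /nbhs_ballP[d /= d0 dU] : nbhs x U by apply: open_nbhs_nbhs; split => //; exact: KU.
  by exists (d / 2) => _; rewrite -splitr divr_gt0.
have [x Kx|s [sK Ks]] := compact_finite_cover (B := fun x => ball x (r x)) cK.
  by have [r0 _] := hr _ Kx; split; [exact: ball_open|exact: ballxx].
exists (\big[Num.min/1]_(x <- s) r x).
  by rewrite big_seq; apply: lt_bigmin => // x xs; have [] := hr _ (sK _ xs).
move=> y Ky z yz; have [x xs xy] := Ks _ Ky.
have [r0] := hr _ (sK _ xs); apply; apply: (ball_triangle xy).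
by apply: le_ball yz; apply: (bigmin_inf_seq _ x) => //; exact: lexx.
Qed.

Local Open Scope ereal_scope.

(** The boundary is compact, so finitely many charts suffice. *)
Lemma boundary_layer (Omega : set 'rV[R]_n) : open Omega -> bounded_set Omega ->
  lipschitz_boundary Omega -> forall eta : R, (0 < eta)%R ->
  exists O : set 'rV[R]_n, [/\ open O, closure Omega `\` Omega `<=` O &
    forall phi, smooth phi -> \int[mu]_(x in O `&` Omega) (phi x ^+ 2)%:E <=
        eta%:E * (\int[mu]_(x in Omega) (phi x ^+ 2)%:E +
                  \int[mu]_(x in Omega) (sqgrad phi x)%:E)].
Proof.
move=> oO bO lO eta eta0.
have iO : Omega° = Omega by apply/interior_id.
pose A := closure Omega `\` Omega.
have cA : compact A.
  apply: (closed_sub_compact _ (bounded_closure_compact bO)); last by move=> x [].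
  by rewrite /A setDE; apply: closedI; [exact: closed_closure|exact: open_closedC].
have /choice[B hB] : forall x, exists B : set 'rV[R]_n, A x -> [/\ open B, B x &
    forall eta : R, (0 < eta)%R -> exists O : set 'rV[R]_n, [/\ open O,
      B `\` Omega `<=` O &
      forall phi, smooth phi -> \int[mu]_(x in O `&` Omega) (phi x ^+ 2)%:E <=
        eta%:E * (\int[mu]_(x in Omega) (phi x ^+ 2)%:E +
                  \int[mu]_(x in Omega) (sqgrad phi x)%:E)]].
  move=> x; have [Ax|nAx] := pselect (A x); last by exists set0.
  have [|B] := boundary_chart (x0 := x) oO lO; first by rewrite iO.
  by exists B.
have [x Ax|s [sA As]] := compact_finite_cover (B := B) cA.
  by have [] := hB _ Ax.
pose eta' := (eta / (size s).+1%:R)%R.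
have e0 : (0 < eta')%R by rewrite divr_gt0.
have /choice[V hV] : forall x, exists O : set 'rV[R]_n, x \in s -> [/\ open O,
      B x `\` Omega `<=` O &
      forall phi, smooth phi -> \int[mu]_(x in O `&` Omega) (phi x ^+ 2)%:E <=
        eta'%:E * (\int[mu]_(x in Omega) (phi x ^+ 2)%:E +
                  \int[mu]_(x in Omega) (sqgrad phi x)%:E)].
  move=> x; have [xs|xs] := boolP (x \in s); last by exists set0.
  have [_ _ /(_ _ e0)[V hV]] := hB _ (sA _ xs).
  by exists V.
pose U x := if x \in s then V x else set0.
have oU x : open (U x).
  by rewrite /U; case: ifPn => [/hV[]//|_]; exact: open0.
exists (\bigcup_(x in [set` s]) U x); split.
- by apply: bigcup_open.
- move=> y Ay; have [x xs Bxy] := As _ Ay; exists x => //.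
  by rewrite /U xs; have [_ h _] := hV _ xs; apply: h; split => //; case: Ay.
move=> phi sphi.
have cphi : continuous phi by apply: smooth_continuous.
have mphi : measurable_fun setT (fun x => (phi x ^+ 2)%:E).
  by apply/measurable_EFinP; apply: measurable_funX; exact: continuous_measurable_rV.
set I := _ + _.
have I0 : 0 <= I.
  by apply: adde_ge0; apply: integral_ge0 => x _; rewrite lee_fin ?sqgrad_ge0 ?sqr_ge0.
have mO : measurable Omega by exact: open_measurable_rV.
apply: (@le_trans _ _ (\sum_(x <- s) \int[mu]_(y in U x `&` Omega) (phi y ^+ 2)%:E)).
  apply: integral_le_cover => //.
  - by apply: measurableI => //; apply: open_measurable_rV; exact: bigcup_open.
  - by move=> x; apply: measurableI => //; exact: open_measurable_rV.
  - by move=> x; rewrite lee_fin sqr_ge0.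
  - by move=> y [[x /= xs Uxy] Oy]; exists x.
apply: (@le_trans _ _ (\sum_(x <- s) eta'%:E * I)).
  rewrite big_seq [leRHS]big_seq; apply: lee_sum => x xs.
  by rewrite /U xs; have [_ _ ->] := hV _ xs.
rewrite -ge0_sume_distrl//; last by move=> x _; rewrite lee_fin ltW.
apply: lee_wpmul2r => //.
rewrite sumEFin lee_fin big_const_seq count_predT iter_addr_0 -mulr_natr /eta'.
by rewrite mulrAC ler_pdivrMr// ler_pM2l// ler_nat.
Qed.

End rellich.

(** * The Poincare inequality on cubes *)

Section cubes.
Context {R : realType} {n : nat}.
Local Notation mu := (@lebesgue_rV R n).
Implicit Types (phi : 'rV[R]_n -> R) (a : 'rV[R]_n) (h : R).

Definition cube a h : set 'rV[R]_n := [set x | forall i, a ord0 i <= x ord0 i < a ord0 i + h].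

Lemma cube_measure a h : 0 < h -> measurable (cube a h) /\ mu (cube a h) = (h ^+ n)%:E.
Proof.
move=> h0; have mI (i : 'I_n) : measurable (`[a ord0 i, a ord0 i + h[%classic : set R).
  exact: measurable_itv.
have [mB lB] := lebesgue_rV_box mI.
have E : cube a h = [set x : 'rV[R]_n | forall i, `[a ord0 i, a ord0 i + h[%classic (x ord0 i)].
  by apply/seteqP; split => x /= H i; have := H i; rewrite /= in_itv.
rewrite E; split => //; rewrite lB -[in RHS](card_ord n) -prodr_const -prodEFin.
apply: eq_bigr => i _; rewrite lebesgue_measure_itv /= lte_fin ltrDl h0.
by rewrite -EFinB; congr EFin; ring.
Qed.

Lemma cbox_measure h : 0 < h -> measurable (cbox (const_mx (- h)) (const_mx h) : set 'rV[R]_n) /\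
  mu (cbox (const_mx (- h)) (const_mx h)) = ((2 * h) ^+ n)%:E.
Proof.
move=> h0; have mI (i : 'I_n) : measurable (`[- h, h]%classic : set R).
  exact: measurable_itv.
have [mB lB] := lebesgue_rV_box mI.
have E : cbox (const_mx (- h)) (const_mx h) = [set x : 'rV[R]_n | forall i, `[- h, h]%classic (x ord0 i)].
  by apply/seteqP; split => x /= H i; have := H i; rewrite /= in_itv /= !mxE.
rewrite E; split => //; rewrite lB -[in RHS](card_ord n) -prodr_const -prodEFin.
apply: eq_bigr => i _; rewrite lebesgue_measure_itv /= lte_fin gtrN// -EFinB; congr EFin; ring.
Qed.

Lemma cube_bounded_L2 a h phi : 0 < h -> continuous phi -> L2 (cube a h) phi.
Proof.
move=> h0 cphi; have [mQ lQ] := cube_measure a h0.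
have /compact_bounded[M [Mr hM]] : compact (phi @` cbox a (a + const_mx h)).
  apply: continuous_compact; last exact: cbox_compact.
  exact: continuous_subspaceT.
apply: (bounded_L2 mQ (M := `|M| + 1)).
- by rewrite lQ ltry.
- by apply: measurable_funTS; exact: continuous_measurable_rV.
- move=> x Qx; apply: (hM (`|M| + 1)); first by rewrite (le_lt_trans (ler_norm M)) ?ltrDl.
  by exists x => // i; have /andP[? ?] := Qx i; rewrite !mxE; apply/andP; split => //; exact: ltW.
Qed.

Lemma measurable_rV_add : measurable_fun setT (fun p : 'rV[R]_n * 'rV[R]_n => p.1 + p.2).
Proof.
apply: measurable_fun_rV => i; under eq_fun do rewrite !mxE.
apply: measurable_funD.
  exact: (measurableT_comp (measurable_rV_coord i) measurable_fst).
exact: (measurableT_comp (measurable_rV_coord i) measurable_snd).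
Qed.

Local Open Scope ereal_scope.

Lemma integral_quadratic (D : set 'rV[R]_n) (f : 'rV[R]_n -> R) (a b c v : R) :
  measurable D -> mu D = v%:E ->
  mu.-integrable D (EFin \o f) -> mu.-integrable D (EFin \o (fun x => f x ^+ 2)%R) ->
  \int[mu]_(x in D) (a * f x ^+ 2 + b * f x + c)%:E =
  (a * (\int[mu]_(x in D) (f x ^+ 2)) + b * (\int[mu]_(x in D) f x) + c * v)%:E.
Proof.
move=> mD vD if1 if2.
have i1 : mu.-integrable D (fun x => a%:E * (f x ^+ 2)%:E) by exact: integrableZl.
have i2 : mu.-integrable D (fun x => b%:E * (f x)%:E) by exact: integrableZl.
have i3 : mu.-integrable D (cst c%:E).
  change (mu.-integrable D (EFin \o (fun _ : 'rV[R]_n => c))).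
  apply: measurable_bounded_integrable => //.
    by have : mu D < +oo by rewrite vD ltry.
  exists `|c|%R; split; first exact: num_real.
  by move=> y My x Dx; exact: ltW.
under eq_integral do rewrite !EFinD !EFinM.
rewrite integralD//; last exact: integrableD.
rewrite integralD// !integralZl// !EFinD !EFinM /Rintegral !fineK; last 2 first.
- exact: integrable_fin_num.
- exact: integrable_fin_num.
congr (_ + _); rewrite -vD; exact: integral_cst.
Qed.

Lemma variance_arith (S m V C g : R) : (0 < V -> 0 <= C -> 0 <= g ->
  2 * (V * S - m ^+ 2) <= C * V * g -> S <= m ^+ 2 / V + C * g)%R.
Proof.
move=> V0 C0 g0 H; have Cg : (0 <= C * V * g)%R by rewrite !mulr_ge0// ltW.
rewrite -(ler_pM2l V0) mulrDr mulrCA divff ?gt_eqF// mulr1.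
by rewrite (mulrA V) (mulrC V); lra.
Qed.

(** The mean over pairs of points [x], [y] of the cube of [(phi y - phi x) ^ 2] is
    twice the variance of [phi]. Writing [y = x + z] with [z] in a cube of twice
    the side, the increments are controlled by the gradient. *)
Lemma cube_poincare a h phi : (0 < h)%R -> smooth phi ->
  (dotL2 (cube a h) phi phi <= (\int[mu]_(x in cube a h) phi x) ^+ 2 / h ^+ n +
     (n%:R * 2 ^+ n * h ^+ 2) * \int[mu]_(x in cube a h) sqgrad phi x)%R.
Proof.
move=> h0 sphi; have [mQ lQ] := cube_measure a h0.
have [mZ lZ] := cbox_measure h0.
set Q := cube a h in mQ lQ *; set Z := cbox _ _ in mZ lZ.
have cphi : continuous phi by apply: smooth_continuous.
have mphi : measurable_fun setT phi by exact: continuous_measurable_rV.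
have Lphi : L2 Q phi by exact: cube_bounded_L2.
have L1 : L2 Q (cst 1%R) by apply: cube_bounded_L2 => //; exact: cst_continuous.
have iphi : mu.-integrable Q (EFin \o phi).
  have := L2_mul_integrable mQ Lphi L1.
  by apply: eq_integrable => // x _; rewrite /= mulr1.
have iphi2 := L2_sq_integrable mQ Lphi.
pose S := (\int[mu]_(x in Q) (phi x ^+ 2))%R; pose m := (\int[mu]_(x in Q) phi x)%R.
have LE : \int[mu]_(x in Q) \int[mu]_(y in Q) ((phi y - phi x) ^+ 2)%:E =
    (2 * (h ^+ n * S - m ^+ 2))%:E.
  transitivity (\int[mu]_(x in Q) (h ^+ n * phi x ^+ 2 + (- 2 * m) * phi x + S)%:E).
    apply: eq_integral => x _.
    transitivity (\int[mu]_(y in Q) (1 * phi y ^+ 2 + (- 2 * phi x) * phi y + phi x ^+ 2)%:E).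
      by apply: eq_integral => y _; congr EFin; ring.
    rewrite (integral_quadratic _ _ _ mQ lQ iphi iphi2) -/S -/m.
    by congr EFin; ring.
  rewrite (integral_quadratic _ _ _ mQ lQ iphi iphi2) -/S -/m.
  by congr EFin; ring.
have msg : measurable_fun setT (fun x => (sqgrad phi x)%:E).
  by apply/measurable_EFinP; apply: continuous_measurable_rV; exact: sqgrad_continuous.
have isg : mu.-integrable Q (EFin \o sqgrad phi).
  have Lg := cube_bounded_L2 a h0 (sqgrad_continuous sphi).
  have := L2_mul_integrable mQ Lg L1.
  by apply: eq_integrable => // x _; rewrite /= mulr1.
pose G := \int[mu]_(x in Q) (sqgrad phi x)%:E.
have G0 : 0 <= G by apply: integral_ge0 => x _; rewrite lee_fin sqgrad_ge0.
pose F (p : 'rV[R]_n * 'rV[R]_n) := (\1_Q (p.1 + p.2) * (phi (p.1 + p.2) - phi p.1) ^+ 2)%:E.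
have mF : measurable_fun setT F.
  apply/measurable_EFinP; apply: measurable_funM.
    exact: (measurableT_comp (measurable_indic mQ) measurable_rV_add).
  apply: measurable_funX; apply: measurable_funB.
    exact: (measurableT_comp mphi measurable_rV_add).
  exact: (measurableT_comp mphi measurable_fst).
have F0 p : 0 <= F p by rewrite lee_fin mulr_ge0 ?sqr_ge0// indicE.
have LF : \int[mu]_(x in Q) \int[mu]_(y in Q) ((phi y - phi x) ^+ 2)%:E =
    \int[mu]_(x in Q) \int[mu]_(z in Z) F (x, z).
  apply: eq_integral => x /set_mem Qx.
  have mfx : measurable_fun Q (fun y => ((phi y - phi x) ^+ 2)%:E).
    apply: measurable_funTS; apply/measurable_EFinP; apply: measurable_funX.
    by apply: measurable_funB => //; exact: measurable_cst.
  rewrite (ge0_integral_rV_shift x mQ mfx); last by move=> y _; rewrite lee_fin sqr_ge0.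
  have sub : rV_shift x @^-1` Q `<=` Z.
    move=> z Qz i; have /andP[z1 z2] := Qz i; have /andP[x1 x2] := Qx i.
    rewrite /rV_shift !mxE in z1 z2; rewrite !mxE.
    move: (z ord0 i) (x ord0 i) (a ord0 i) z1 z2 x1 x2 => p q r *; lra.
  rewrite -(setIidr sub) integral_mkcondr; apply: eq_integral => z _.
  rewrite patchE /F /= indicE [(x + z)%R]addrC; case: ifPn => zD.
    by rewrite mem_set ?mul1r//; move: zD; rewrite inE.
  by rewrite memNset ?mul0r//; move: zD; rewrite notin_setE.
have UB : \int[mu]_(x in Q) \int[mu]_(z in Z) F (x, z) <=
    (n%:R * h ^+ 2 * (2 * h) ^+ n)%:E * G.
  rewrite tonelli_sets//.
  apply: (@le_trans _ _ (\int[mu]_(z in Z) cst ((n%:R * h ^+ 2)%:E * G) z)); last first.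
    have E : \int[mu]_(z in Z) cst ((n%:R * h ^+ 2)%:E * G) z = (n%:R * h ^+ 2)%:E * G * mu Z.
      exact: integral_cst.
    by rewrite E lZ muleAC -EFinM.
  apply: (ge0_le_integral mu mZ).
  - by move=> z _; exact: integral_ge0.
  - exact: measurable_funTS (measurable_integral_fst mu mQ mF F0).
  - exact: measurable_cst.
  move=> z Zz.
  pose A := Q `&` rV_shift z @^-1` Q.
  have mA : measurable A.
    apply: measurableI => //; rewrite -[X in measurable X]setTI; exact: measurable_rV_shift.
  have -> : \int[mu]_(x in Q) F (x, z) = \int[mu]_(x in A) ((phi (x + z)%R - phi x) ^+ 2)%:E.
    rewrite /A integral_mkcondr; apply: eq_integral => x _.
    rewrite patchE /F /= indicE; case: ifPn => zD.
      by rewrite mem_set ?mul1r//; move: zD; rewrite inE.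
    by rewrite memNset ?mul0r//; move: zD; rewrite notin_setE.
  apply: le_trans (segment_estimate sphi mA mQ _) _.
    move=> x [Qx Qxz] s /andP[s0 s1] i; rewrite !mxE.
    have /andP[z1 z2] := Qxz i; have /andP[x1 x2] := Qx i.
    rewrite /rV_shift !mxE in z1 z2.
    move: (z ord0 i) (x ord0 i) (a ord0 i) z1 z2 x1 x2 => p q r z1 z2 x1 x2.
    have [w [w0 wA wB]] : exists w, [/\ 0 < w, w <= r + h - q & w <= r + h - (q + p)]%R.
      exists (Num.min (r + h - q) (r + h - (q + p)))%R.
      by rewrite lt_min !subr_gt0 x2 z2 !ge_min !lexx orbT.
    have s1' : (0 <= 1 - s)%R by rewrite subr_ge0.
    have e1 : (0 <= (1 - s) * (q - r))%R by rewrite mulr_ge0// subr_ge0.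
    have e2 : (0 <= s * (q + p - r))%R by rewrite mulr_ge0// subr_ge0.
    have e3 : (0 <= (1 - s) * (r + h - q - w))%R by rewrite mulr_ge0// subr_ge0.
    have e4 : (0 <= s * (r + h - (q + p) - w))%R by rewrite mulr_ge0// subr_ge0.
    by apply/andP; split; lra.
  apply: lee_wpmul2r => //; rewrite lee_fin /sqlen -[in leRHS](card_ord n) -sum1_card.
  rewrite natr_sum mulr_suml; apply: ler_sum => i _; rewrite mul1r.
  have := Zz i; rewrite !mxE => /andP[w1 w2].
  by rewrite -subr_ge0 subr_sqr mulr_ge0; lra.
have : (2 * (h ^+ n * S - m ^+ 2) <= n%:R * h ^+ 2 * (2 * h) ^+ n * fine G)%R.
  rewrite -lee_fin [leRHS]EFinM fineK; last exact: integrable_fin_num.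
  by rewrite -LE LF.
rewrite [dotL2 _ _ _](_ : _ = S); last by apply: eq_Rintegral => x _; rewrite expr2.
have hn : (0 < h ^+ n)%R by rewrite exprn_gt0.
have g0 : (0 <= fine G)%R by exact: fine_ge0.
have C0 : (0 <= n%:R * 2 ^+ n * h ^+ 2 :> R)%R.
  by apply: mulr_ge0; [apply: mulr_ge0 => //; exact: exprn_ge0|exact: sqr_ge0].
have -> : (n%:R * h ^+ 2 * (2 * h) ^+ n = n%:R * 2 ^+ n * h ^+ 2 * h ^+ n :> R)%R.
  by rewrite exprMn; ring.
exact: variance_arith.
Qed.

End cubes.

(** * Rellich compactness *)

Section rellich_smooth.
Context {R : realType} {n : nat}.
Local Notation mu := (@lebesgue_rV R n).
Implicit Types (phi : 'rV[R]_n -> R).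

Lemma grid (A h : R) : 0 < h -> exists (I : finType) (a : I -> 'rV[R]_n),
  (forall x, obox (const_mx (- A)) (const_mx A) x -> exists k, cube (a k) h x) /\
  (forall k l x, cube (a k) h x -> cube (a l) h x -> k = l).
Proof.
move=> h0; pose M := Num.bound (2 * A / h).
exists {ffun 'I_n -> 'I_M}, (fun k : {ffun 'I_n -> 'I_M} => \row_(i < n) (- A + h * (k i)%:R)); split.
  move=> x xA; pose t i := (x ord0 i + A) / h.
  have tP i : 0 <= t i < M%:R.
    have := xA i; rewrite !mxE => /andP[x1 x2].
    rewrite divr_ge0 ?ltW//=; last by lra.
    apply: (@lt_trans _ _ (2 * A / h)); first by rewrite ltr_pM2r ?invr_gt0//; lra.
    by apply: archi_boundP; rewrite divr_ge0// ?ltW//; lra.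
  have tM i : (Num.truncn (t i) < M)%N.
    have /andP[t0 tM] := tP i; have /andP[t1 _] := truncn_itv t0.
    by rewrite -(ltr_nat R); exact: le_lt_trans tM.
  exists [ffun i => Ordinal (tM i)] => i; rewrite !mxE ffunE /=.
  have /andP[t0 _] := tP i; have /andP[] := truncn_itv t0.
  have E : x ord0 i = - A + h * t i by rewrite /t mulrCA divff ?gt_eqF// mulr1; ring.
  rewrite E -natr1; move: (t i) (Num.truncn _)%:R => u v v1 v2.
  have -> : - A + h * v + h = - A + h * (v + 1) by ring.
  by rewrite lerD2l ltrD2l ler_pM2l// ltr_pM2l// v1.
move=> k l x xk xl; apply/ffunP => i; apply: val_inj => /=.
have := xk i; have := xl i; rewrite !mxE.
have E (v : R) : - A + h * v + h = - A + h * (v + 1) by ring.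
rewrite !E => /andP[p1 p2] /andP[p3 p4].
have lt_eq (p r : R) : - A + h * p <= x ord0 i -> x ord0 i < - A + h * (r + 1) -> p < r + 1.
  by move=> h1 h2; have := le_lt_trans h1 h2; rewrite ltrD2l ltr_pM2l.
have := lt_eq _ _ p1 p4; have := lt_eq _ _ p3 p2.
rewrite !natr1 !ltr_nat !ltnS => e1 e2; apply/eqP; rewrite eqn_leq e1.
exact: e2.
Qed.

Local Open Scope ereal_scope.

Lemma integral_disjoint_le (I : finType) (B : I -> set 'rV[R]_n) (D : set 'rV[R]_n)
    (f : 'rV[R]_n -> \bar R) :
  measurable D -> (forall k, measurable (B k)) -> (forall k, B k `<=` D) ->
  (forall k l x, B k x -> B l x -> k = l) ->
  measurable_fun setT f -> (forall x, 0 <= f x) ->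
  \sum_k \int[mu]_(x in B k) f x <= \int[mu]_(x in D) f x.
Proof.
move=> mD mB BD dB mf f0.
have tB : trivIset [set` index_enum I] B.
  by move=> k l _ _ [x [Bk Bl]]; exact: dB Bk Bl.
rewrite -(@ge0_integral_bigsetU _ _ _ mu _ B f _ mB (index_enum_uniq I) tB)//; last first.
  exact: measurable_funTS.
apply: ge0_subset_integral => //.
- by apply: bigsetU_measurable => k _; exact: mB.
- exact: measurable_funTS.
- by rewrite -bigcup_seq => x [k _]; exact: BD.
Qed.

Local Close Scope ereal_scope.

(** Away from a boundary layer that carries little mass, the domain is covered by
    the small cubes of a grid that it contains. On each of them Poincare's
    inequality bounds the mass by the mean, which is one functional per cube,
    and by a small multiple of the energy. The functions [chi] are the
    normalized indicators of these cubes. *)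
Lemma rellich_smooth (Omega : set 'rV[R]_n) (eta : R) : open Omega -> bounded_set Omega ->
  lipschitz_boundary Omega -> 0 < eta ->
  exists (I : finType) (chi : I -> 'rV[R]_n -> R), (forall k, L2 Omega (chi k)) /\
    forall phi, smooth phi ->
      dotL2 Omega phi phi <= eta * (dotL2 Omega phi phi + \int[mu]_(x in Omega) sqgrad phi x) +
        \sum_k dotL2 Omega phi (chi k) ^+ 2.
Proof.
move=> oO bO lO eta0.
have mO : measurable Omega by exact: open_measurable_rV.
have [|L [oL bL HL]] := boundary_layer oO bO lO (eta := eta / 2); first by rewrite divr_gt0.
have mL : measurable L by exact: open_measurable_rV.
pose K := closure Omega `\` L.
have cK : compact K.
  apply: (closed_sub_compact _ (bounded_closure_compact bO)); last by move=> x [].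
  by rewrite /K setDE; apply: closedI; [exact: closed_closure|exact: open_closedC].
have KO : K `<=` Omega by move=> x [cx nL]; apply: contrapT => nO; apply: nL; exact: bL.
have [rho rho0 hrho] := compact_in_open cK oO KO.
have [A [OA A0]] := bounded_in_obox bO.
pose C : R := n%:R * 2 ^+ n.
have C0 : 0 <= C by apply: mulr_ge0 => //; exact: exprn_ge0.
pose h := Num.min (Num.min 1 rho) (eta / (2 * (C + 1))).
have D0 : 0 < 2 * (C + 1) by apply: mulr_gt0 => //; exact: ltr_wpDl.
have h0 : 0 < h by rewrite !lt_min ltr01 rho0 divr_gt0.
have hr : h <= rho by rewrite /h !ge_min lexx !orbT.
have h1 : h <= 1 by rewrite /h !ge_min lexx.
have Ch : C * h ^+ 2 <= eta / 2.
  have : h <= eta / (2 * (C + 1)) by rewrite /h !ge_min lexx !orbT.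
  rewrite ler_pdivlMr// => hh.
  have : h ^+ 2 <= h by rewrite expr2 ler_piMl// ltW.
  move=> /(ler_wpM2l C0); lra.
have [I [a [aC aD]]] := grid A h0.
pose B k := if `[< cube (a k) h `<=` Omega >] then cube (a k) h else set0.
have mB k : measurable (B k).
  by rewrite /B; case: ifP => // _; have [] := cube_measure (a k) h0.
have BO k : B k `<=` Omega by rewrite /B => x; case: ifPn => // /asboolP; apply.
have Bc k : B k `<=` cube (a k) h by rewrite /B => x; case: ifP.
have dB k l x : B k x -> B l x -> k = l.
  by move=> /Bc xk /Bc xl; exact: aD xk xl.
have cov x : Omega x -> ~ L x -> exists k, B k x.
  move=> Ox nLx; have [k xk] := aC _ (OA _ Ox); exists k; rewrite /B.
  case: ifPn => // /asboolPn; case=> y yk; apply: (hrho x) => //.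
    by split => //; exact: subset_closure.
  rewrite mx_norm_ball /=; apply: rV_norm_lt => // i; rewrite !mxE.
  apply: lt_le_trans hr; have := xk i; have := yk i.
  move: (x ord0 i) (y ord0 i) (a k ord0 i) => p q r /andP[q1 q2] /andP[p1 p2].
  by rewrite ltr_norml; apply/andP; split; lra.
pose s := Num.sqrt (h ^+ n).
have hn : 0 < h ^+ n by exact: exprn_gt0.
have s0 : 0 < s by rewrite sqrtr_gt0.
have fO := bounded_measure_finite mO bO.
have L1B k : L2 Omega (\1_(B k)).
  apply: (bounded_L2 mO (M := 1) fO); first exact: (measurable_indic (mB k)).
  by move=> x _; rewrite indicE; case: (_ \in _); rewrite ?normr1 ?normr0.
exists I, (fun k => cst s^-1 \* \1_(B k)); split.
  by move=> k; exact: L2Z (L1B k).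
move=> phi sphi.
have cphi : continuous phi by apply: smooth_continuous.
have mphi : measurable_fun setT phi by exact: continuous_measurable_rV.
have mphi2 : measurable_fun setT (fun x => (phi x ^+ 2)%:E).
  by apply/measurable_EFinP; exact: measurable_funX.
have msg : measurable_fun setT (fun x => (sqgrad phi x)%:E).
  by apply/measurable_EFinP; apply: continuous_measurable_rV; exact: sqgrad_continuous.
have Lphi : L2 Omega phi by exact: smooth_L2.
have iphi2 := L2_sq_integrable mO Lphi.
have isg : mu.-integrable Omega (EFin \o sqgrad phi).
  apply: (Rintegral_sum (index_enum 'I_n) mO _).1 => i.
  by apply: L2_sq_integrable => //; apply: smooth_L2 => //; exact: smooth_pderiv.
have chiE k : dotL2 Omega phi (cst s^-1 \* \1_(B k)) ^+ 2 =
    (\int[mu]_(x in B k) phi x) ^+ 2 / h ^+ n.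
  rewrite /dotL2 (_ : (\int[mu]_(x in Omega) _) = s^-1 * \int[mu]_(x in B k) phi x); last first.
    rewrite -[in RHS](setIidr (BO k)) Rintegral_mkcondr -RintegralZl//; last first.
      have := L2_mul_integrable mO Lphi (L1B k).
      apply: eq_integrable => // x _ /=; rewrite patchE indicE.
      by case: (_ \in _); rewrite ?mulr1 ?mulr0.
    apply: eq_Rintegral => x _; rewrite patchE /= indicE.
    by rewrite mulrCA; case: (_ \in _); rewrite ?mulr1 ?mulr0.
  by rewrite exprMn mulrC exprVn sqr_sqrtr// ltW.
have cubeE k : \int[mu]_(x in B k) (phi x ^+ 2) <= (\int[mu]_(x in B k) phi x) ^+ 2 / h ^+ n +
     (C * h ^+ 2) * \int[mu]_(x in B k) sqgrad phi x.
  rewrite /B; case: ifPn => _.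
    by have := cube_poincare (a k) h0 sphi; rewrite {1}/dotL2; under eq_Rintegral do rewrite -expr2.
  by rewrite !Rintegral_set0 expr0n /= mul0r mulr0 addr0.
pose g := \int[mu]_(x in Omega) sqgrad phi x.
pose b := \int[mu]_(x in Omega) (phi x ^+ 2).
have bE : dotL2 Omega phi phi = b by apply: eq_Rintegral => x _; rewrite expr2.
have fE (D : set 'rV[R]_n) (f : 'rV[R]_n -> R) : measurable D -> D `<=` Omega ->
    mu.-integrable Omega (EFin \o f) ->
    (\int[mu]_(x in D) (f x)%:E = (\int[mu]_(x in D) f x)%:E)%E.
  move=> mD DO iF; rewrite /Rintegral fineK//; apply: integrable_fin_num => //.
  exact: integrableS iF.
have p2 x : (0 <= (phi x ^+ 2)%:E)%E by rewrite lee_fin sqr_ge0.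
have layer := HL phi sphi.
have cover : (b%:E <= (\int[mu]_(x in L `&` Omega) (phi x ^+ 2)%:E) +
    \sum_k \int[mu]_(x in B k) (phi x ^+ 2)%:E)%E.
  rewrite -fE//.
  pose B' (o : option I) := if o is Some k then B k else L `&` Omega.
  have := @integral_le_cover _ _ _ mu _ (None :: map Some (index_enum I)) Omega B'
    (fun x => (phi x ^+ 2)%:E) mO.
  rewrite big_cons big_map; apply => //.
    by move=> [k|] /=; [exact: mB|exact: measurableI].
  move=> x Ox; have [Lx|nLx] := pselect (L x); first by exists None; rewrite ?mem_head.
  have [k Bk] := cov x Ox nLx; exists (Some k) => //.
  by rewrite in_cons /=; apply: map_f; rewrite mem_index_enum.
have energy : \sum_k \int[mu]_(x in B k) sqgrad phi x <= g.
  rewrite -lee_fin -sumEFin -fE//.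
  under eq_bigr do rewrite -fE//.
  by apply: integral_disjoint_le => // x; rewrite lee_fin sqgrad_ge0.
have mLO : measurable (L `&` Omega) by exact: measurableI.
rewrite (fE _ _ mO (@subset_refl _ _) iphi2) (fE _ _ mO (@subset_refl _ _) isg) in layer.
rewrite (fE _ _ mLO (@subIsetr _ _ _) iphi2) in layer.
have layer2 : \int[mu]_(x in L `&` Omega) (phi x ^+ 2) <= eta / 2 * (b + g).
  by rewrite -lee_fin EFinM EFinD.
have cover2 : b <= \int[mu]_(x in L `&` Omega) (phi x ^+ 2) +
    \sum_k \int[mu]_(x in B k) (phi x ^+ 2).
  rewrite -lee_fin EFinD -sumEFin -(fE _ _ mLO (@subIsetr _ _ _) iphi2).
  by under eq_bigr do rewrite -fE//.
rewrite bE -/g; under eq_bigr do rewrite chiE.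
have : \sum_k \int[mu]_(x in B k) (phi x ^+ 2) <=
    \sum_k (\int[mu]_(x in B k) phi x) ^+ 2 / h ^+ n + eta / 2 * g.
  apply: le_trans (ler_sum _ (fun k _ => cubeE k)) _.
  rewrite big_split /= lerD2l -mulr_sumr.
  apply: (@le_trans _ _ (C * h ^+ 2 * g)).
    by apply: ler_wpM2l => //; rewrite mulr_ge0 ?sqr_ge0.
  by apply: ler_wpM2r => //; apply: Rintegral_ge0 => x _; exact: sqgrad_ge0.
have b0 : 0 <= b by apply: Rintegral_ge0 => x _; exact: sqr_ge0.
have arith (l S T : R) : b <= l + S -> S <= T + eta / 2 * g -> l <= eta / 2 * (b + g) ->
    b <= eta * (b + g) + T.
  have := mulr_ge0 (ltW eta0) b0; clear; move: b g => b' g' *; lra.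
by move=> Sle; exact: arith cover2 Sle layer2.
Qed.

End rellich_smooth.

(** * The energy space *)

(** The representing vector is orthogonal to the kernel, which is closed. *)
Lemma riesz (R : realType) (V : lmodType R) (q : V -> V -> R) (l : V -> R) (M : R) :
  sbilin q -> nonneg_on setT q -> complete_for q setT ->
  (forall k u v, l (k *: u + v) = k * l u + l v) -> 0 <= M ->
  (forall v, l v ^+ 2 <= M * q v v) -> exists w, forall v, l v = q w v.
Proof.
move=> Hq q0 cq ll M0 lM.
have l0 : l 0 = 0.
  by have := ll 1 0 0; rewrite scaler0 addr0 mul1r => /eqP; rewrite addrC -subr_eq subrr eq_sym => /eqP.
have lZ k u : l (k *: u) = k * l u by rewrite -[k *: u]addr0 ll l0 addr0.
have lD u v : l (u + v) = l u + l v by rewrite -[u in LHS]scale1r ll mul1r.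
have lB u v : l (u - v) = l u - l v by rewrite lD -scaleN1r lZ mulN1r.
pose T := [set v : V | l v = 0].
have sT : subspace T.
  split=> [|k u v]; first exact: l0.
  by rewrite /T /= => lu lv; rewrite ll lu lv mulr0 addr0.
have cT : complete_for q T.
  move=> u Tu /cq[//|w _ uw]; exists w => //=.
  apply/eqP; rewrite -sqrf_eq0 eq_le sqr_ge0 andbT leNgt; apply/negP => lw0.
  have M1 : 0 < M + 1 by rewrite ltr_wpDl.
  have [n0 /(_ n0 (leqnn _))] := uw (l w ^+ 2 / (M + 1)) (divr_gt0 lw0 M1).
  rewrite ltr_pdivlMr// => h.
  have := lM (u n0 - w); rewrite lB (Tu n0) sub0r sqrrN => h2.
  have := q0 (u n0 - w) I; move: (q _ _) h h2 => x h h2 x0; lra.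
have [[f lf]|nf] := pselect (exists f, l f != 0); last first.
  exists 0 => v; rewrite (sbilin0l Hq); apply: contrapT => /eqP lv.
  by apply: nf; exists v.
have [p Tp hp] := orthogonal_projection subspaceT Hq q0 (f := f) sT (@subsetT _ _) cT I.
pose g := f - p; have lg : l g = l f by rewrite /g lB Tp subr0.
have qg : 0 < q g g.
  rewrite lt_neqAle q0// andbT; apply/eqP => g0; have := lM g.
  by rewrite -g0 mulr0 lg leNgt exprn_even_gt0//= lf.
exists ((l f / q g g) *: g) => v.
rewrite (sbilinZl Hq).
have /(hp _) : T (v - (l v / l f) *: g).
  by rewrite /T /= lB lZ lg divfK// subrr.
rewrite -/g (sbilinBr Hq) (sbilinZr Hq) => /subr0_eq ->.
by field; rewrite lf gt_eqF.
Qed.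

Section energy_space.
Context {R : realType} {n : nat}.
Local Notation mu := (@lebesgue_rV R n).
Variables (Omega : set 'rV[R]_n) (oO : open Omega) (bO : bounded_set Omega).

(** The hypotheses on [Omega] are arguments because closedness under linear
    combinations depends on them. *)
Definition in_space (_ : open Omega) (_ : bounded_set Omega) : {pred ('rV[R]_n -> R)} :=
  [pred u | `[< H10 Omega set0 u >]].

Lemma in_spaceP u : reflect (H10 Omega set0 u) (u \in in_space oO bO).
Proof. exact: asboolP. Qed.

Fact in_space_submod : submod_closed (in_space oO bO).
Proof.
split; first by apply/in_spaceP; exact: H10_0.
move=> k u v /in_spaceP Hu /in_spaceP Hv; apply/in_spaceP.
exact: (H10_linear oO bO k Hu Hv).
Qed.

HB.instance Definition _ := GRing.isSubmodClosed.Build R _ (in_space oO bO) in_space_submod.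

(** The closure of the test functions in the first Sobolev space, as a module.
    For a Lipschitz domain this is the whole Sobolev space. *)
Record space := Space { fn :> 'rV[R]_n -> R; fnP : fn \in in_space oO bO }.

HB.instance Definition _ := [isSub of space for fn].
HB.instance Definition _ := [Choice of space by <:].
HB.instance Definition _ := [SubChoice_isSubLmodule of space by <:].

Lemma fn_linear k (u v : space) : fn (k *: u + v) = (cst k \* fn u) \+ fn v.
Proof. by []. Qed.

End energy_space.

Section energy_forms.
Context {R : realType} {n : nat}.
Local Notation mu := (@lebesgue_rV R n).
Variables (Omega : set 'rV[R]_n) (oO : open Omega) (bO : bounded_set Omega).
Local Notation V := (space oO bO).
Variables (c : 'rV[R]_n -> R) (c0 M : R).
Hypotheses (mc : measurable_fun setT c) (cM : forall x, c0 <= c x <= M) (c0p : 0 < c0).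

Let mO : measurable Omega. Proof. exact: open_measurable_rV. Qed.
Let fO : (mu Omega < +oo)%E. Proof. exact: bounded_measure_finite. Qed.

Lemma space_H1 (u : V) : H1 Omega u.
Proof. exact: H10_H1 (in_spaceP oO bO u (fnP u)). Qed.

Lemma space_L2 (u : V) : L2 Omega u.
Proof. exact: H1_L2 (space_H1 u). Qed.

Lemma H10_space K u : H10 Omega K u -> exists v : V, fn v = u.
Proof.
move=> Hu; have Hu0 : H10 Omega set0 u by exact: (H10_sub oO bO (@sub0set _ K) Hu).
by exists (Space (introT (in_spaceP oO bO u) Hu0)).
Qed.

Lemma fnB (u v : V) : fn (u - v) = fn u \- fn v.
Proof. by []. Qed.

Lemma fn_sum (I : Type) (s : seq I) (a : I -> R) (f : I -> V) :
  fn (\sum_(i <- s) a i *: f i) = (fun x => \sum_(i <- s) a i * f i x).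
Proof.
elim: s => [|i s IH]; apply/funext => x; first by rewrite !big_nil.
by rewrite !big_cons fn_linear /= IH.
Qed.

Lemma L2_bounded_mul u : L2 Omega u -> L2 Omega (c \* u).
Proof.
move=> Lu; have mu_ := L2_measurable mO Lu.
have mcO : measurable_fun Omega c by exact: measurable_funTS.
have M0 : 0 <= M by have /andP[h1 h2] := cM 0; rewrite (le_trans (ltW c0p))// (le_trans h1).
apply/(L2P mO); split; first exact: measurable_funM.
apply: (@le_integrable _ _ _ mu Omega mO _ (fun x => (M ^+ 2)%:E * (u x ^+ 2)%:E)%E).
- by apply/measurable_EFinP; apply: measurable_funX; exact: measurable_funM.
- move=> x _; rewrite /= lee_fin -exprMn !normrX lerXn2r ?nnegrE// !normrM ler_wpM2r// (ger0_norm M0).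
  have /andP[h1 h2] := cM x; rewrite ger0_norm//.
  by rewrite (le_trans _ h1)// ltW.
- exact: (integrableZl mO (M ^+ 2) (L2_sq_integrable mO Lu)).
Qed.

Definition bform (u v : V) : R := dotL2 Omega u v.
Definition qform (u v : V) : R := gradform Omega u v + dotL2 Omega (c \* u) v.
Definition hform (u v : V) : R := h1form Omega u v.

Lemma bform_bilin : sbilin bform.
Proof.
split=> [u v|k u v w]; first exact: dotL2C.
rewrite /bform fn_linear (dotL2Dl mO (L2Z k (space_L2 u)) (space_L2 v) (space_L2 w)).
by congr (_ + _); exact: (dotL2Zl mO k (space_L2 u) (space_L2 w)).
Qed.

Lemma hform_bilin : sbilin hform.
Proof.
split=> [u v|k u v w]; first exact: h1formC.
exact: (h1form_linear oO bO k (space_H1 u) (space_H1 v) (space_H1 w)).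
Qed.

Lemma weighted_linear k (u v w : V) : dotL2 Omega (c \* fn (k *: u + v)) w =
  k * dotL2 Omega (c \* u) w + dotL2 Omega (c \* v) w.
Proof.
have Lu := L2_bounded_mul (space_L2 u); have Lv := L2_bounded_mul (space_L2 v).
have Lw := space_L2 w.
rewrite (_ : c \* _ = (cst k \* (c \* u)) \+ (c \* v)); last first.
  by apply/funext => x /=; rewrite mulrDr mulrCA.
apply: (etrans (dotL2Dl mO (L2Z k Lu) Lv Lw)).
by congr (_ + _); exact: (dotL2Zl mO k Lu Lw).
Qed.

Lemma qform_bilin : sbilin qform.
Proof.
split=> [u v|k u v w].
  rewrite /qform gradformC; congr (_ + _).
  by apply: eq_Rintegral => x _ /=; ring.
rewrite /qform weighted_linear.
rewrite (gradform_linear oO bO k (space_H1 u) (space_H1 v) (space_H1 w)).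
by rewrite addrACA -mulrDr.
Qed.

Lemma weighted_bounds (u : V) :
  c0 * bform u u <= dotL2 Omega (c \* u) u /\ dotL2 Omega (c \* u) u <= M * bform u u.
Proof.
have Lu := space_L2 u; have Lcu := L2_bounded_mul Lu.
have i1 := L2_mul_integrable mO Lu Lu; have i2 := L2_mul_integrable mO Lcu Lu.
have iZ k : mu.-integrable Omega (EFin \o (fun x => k * (u x * u x))).
  by rewrite /comp; under eq_fun do rewrite EFinM; exact: integrableZl.
rewrite /bform /dotL2 -!RintegralZl//; split; apply: le_Rintegral => // x _ /=;
by rewrite -mulrA ler_wpM2r -?expr2 ?sqr_ge0//; have /andP[] := cM x.
Qed.

Lemma bform_ge0 : nonneg_on setT bform.
Proof. by move=> u _; exact: dotL2_ge0. Qed.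

Lemma qform_coercive u : c0 * bform u u <= qform u u.
Proof.
by have [h _] := weighted_bounds u; rewrite /qform ler_wpDl ?gradform_ge0.
Qed.

Lemma qform_ge0 : nonneg_on setT qform.
Proof.
by move=> u _; apply: le_trans (qform_coercive u); rewrite mulr_ge0 ?bform_ge0// ltW.
Qed.

Lemma hform_le_q u : Num.min 1 c0 * hform u u <= qform u u.
Proof.
have [h _] := weighted_bounds u; rewrite /hform /h1form /qform mulrDr.
apply: lerD; last by apply: le_trans h; rewrite ler_wpM2r ?dotL2_ge0// ge_min lexx orbT.
by rewrite ler_piMl ?gradform_ge0// ge_min lexx.
Qed.

Lemma q_le_hform u : qform u u <= (1 + M) * hform u u.
Proof.
have M0 : 0 <= M by have /andP[h1 h2] := cM 0; rewrite (le_trans (ltW c0p))// (le_trans h1).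
have [_ h] := weighted_bounds u; rewrite /hform /h1form /qform mulrDr.
apply: lerD; last by apply: le_trans h _; rewrite ler_wpM2r ?dotL2_ge0// lerDr.
by rewrite ler_peMl ?gradform_ge0// lerDl.
Qed.

Definition vanishing K : set V := [set v : V | H10 Omega K v].

Lemma vanishing_subspace K : subspace (vanishing K).
Proof.
split; first exact: H10_0.
by move=> k u v Hu Hv; exact: (H10_linear oO bO k Hu Hv).
Qed.

Lemma vanishing0 : vanishing set0 = setT.
Proof.
by apply/seteqP; split => // u _; exact: in_spaceP (fnP u).
Qed.

Lemma h1form_subC u v : H1 Omega u -> H1 Omega v ->
  h1form Omega (u \- v) (u \- v) = h1form Omega (v \- u) (v \- u).
Proof.
move=> Hu Hv; set w := v \- u; have Hw : H1 Omega w by exact: (H1B oO bO).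
have -> : u \- v = (cst (-2) \* w) \+ w by apply/funext => x; rewrite /w /=; ring.
have Hw' : H1 Omega ((cst (-2) \* w) \+ w) by exact: (H1_linear oO bO (-2) Hw Hw).
rewrite (h1form_linear oO bO (-2) Hw Hw Hw') h1formC (h1form_linear oO bO (-2) Hw Hw Hw).
by move: (h1form _ _ _) => z; ring.
Qed.

Lemma hformB u v : hform (u - v) (u - v) = h1form Omega (fn u \- fn v) (fn u \- fn v).
Proof. by rewrite /hform fnB. Qed.

(** Limits in the Sobolev space exist, and stay in the closure of the test
    functions; the energy and the Sobolev form are equivalent. *)
Lemma vanishing_complete K : complete_for qform (vanishing K).
Proof.
move=> u Su Cu.
have d0 : 0 < Num.min 1 c0 by rewrite lt_min ltr01.
have M1 : 0 < 1 + M.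
  by have /andP[h1 h2] := cM 0; rewrite ltr_pwDl// (le_trans (ltW c0p))// (le_trans h1).
have [k|e e0|l Hl ul] := H1_complete oO bO (u := fun k => fn (u k)).
- exact: space_H1.
- have [n0 hn] := Cu _ (mulr_gt0 d0 e0); exists n0 => i j ni nj.
  by rewrite -hformB -(ltr_pM2l d0); apply: le_lt_trans (hform_le_q _) (hn _ _ ni nj).
have H0l : H10 Omega K l.
  apply: (H10_closed oO bO Hl) => e e0.
  have [n0 /(_ n0 (leqnn _)) h] := ul _ e0; exists (u n0); first exact: Su.
  by rewrite h1form_subC//; exact: space_H1.
have [v vl] := H10_space H0l; rewrite -vl in ul H0l.
exists v => // e e0; have [n0 hn] := ul _ (divr_gt0 e0 M1).
exists n0 => k /hn; rewrite -hformB ltr_pdivlMr// mulrC.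
by apply: le_lt_trans; exact: q_le_hform.
Qed.

End energy_forms.

(** * Compactness of the energy space *)

Section compactness.
Context {R : realType} {n : nat}.
Local Notation mu := (@lebesgue_rV R n).
Variables (Omega : set 'rV[R]_n) (oO : open Omega) (bO : bounded_set Omega).
Local Notation V := (space oO bO).
Variables (c : 'rV[R]_n -> R) (c0 M : R).
Hypotheses (mc : measurable_fun setT c) (cM : forall x, c0 <= c x <= M) (c0p : 0 < c0).
Hypothesis lO : lipschitz_boundary Omega.

Let mO : measurable Omega. Proof. exact: open_measurable_rV. Qed.
Local Notation b := (@bform R n Omega oO bO).
Local Notation h := (@hform R n Omega oO bO).
Local Notation q := (@qform R n Omega oO bO c).

Lemma h1form_smooth phi : smooth phi ->
  h1form Omega phi phi = dotL2 Omega phi phi + \int[mu]_(x in Omega) sqgrad phi x.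
Proof.
move=> sphi; rewrite /h1form addrC gradform_smooth//; congr (_ + _).
have iF i : mu.-integrable Omega (EFin \o (fun x => pderiv i phi x ^+ 2)).
  by apply: L2_sq_integrable => //; apply: smooth_L2 => //; exact: smooth_pderiv.
rewrite (Rintegral_sum (index_enum 'I_n) mO iF).2; apply: eq_bigr => i _.
by apply: eq_Rintegral => x _; rewrite expr2.
Qed.

Lemma test_space phi : test_function setT phi -> exists v : V, fn v = phi.
Proof.
move=> tphi; apply: (@H10_space _ _ _ _ _ set0); apply: (test_H10 oO bO).
by rewrite setC0.
Qed.

Lemma functional_le (chi : 'rV[R]_n -> R) (v : V) : L2 Omega chi ->
  dotL2 Omega v chi ^+ 2 <= b v v * dotL2 Omega chi chi.
Proof. by move=> Lchi; apply: dotL2_cauchy_schwarz => //; exact: space_L2. Qed.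

Lemma functional_linear (chi : 'rV[R]_n -> R) k (u v : V) : L2 Omega chi ->
  dotL2 Omega (fn (k *: u + v)) chi = k * dotL2 Omega u chi + dotL2 Omega v chi.
Proof.
move=> Lchi; rewrite fn_linear (dotL2Dl mO (L2Z k (space_L2 u)) (space_L2 v) Lchi).
by congr (_ + _); exact: (dotL2Zl mO k (space_L2 u) Lchi).
Qed.

Lemma b_le_h v : b v v <= h v v.
Proof. by rewrite /hform /h1form lerDr gradform_ge0. Qed.

Lemma dense_arith (eta X e bv bw bd hv hw hd Sv Sw : R) :
  bv <= 2 * bw + 2 * bd -> bw <= eta * hw + Sw -> eta * hw <= eta * (2 * hv + 2 * hd) ->
  Sw <= 2 * Sv + 2 * (bd * X) -> bd <= hd -> bd * X <= hd * X ->
  hd * (4 * eta + 4 * X + 2) <= e -> bv <= 4 * eta * hv + 4 * Sv + e.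
Proof. clear; lra. Qed.

(** An estimate for smooth functions extends by density, at the price of a factor
    4 from splitting squares. *)
Lemma dense_estimate (eta : R) (J : finType) (chi : J -> 'rV[R]_n -> R) (v : V) :
  0 < eta -> (forall k, L2 Omega (chi k)) ->
  (forall phi, smooth phi ->
    dotL2 Omega phi phi <= eta * h1form Omega phi phi + \sum_k dotL2 Omega phi (chi k) ^+ 2) ->
  b v v <= 4 * eta * h v v + 4 * \sum_k dotL2 Omega v (chi k) ^+ 2.
Proof.
move=> eta0 Lchi H; apply/ler_addgt0Pr => e e0.
pose X := \sum_k dotL2 Omega (chi k) (chi k).
have X0 : 0 <= X by apply: sumr_ge0 => k _; exact: dotL2_ge0.
pose D := 4 * eta + 4 * X + 2.
have D0 : 0 < D by rewrite /D; lra.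
have /(H10P oO bO)[_ /(_ _ (divr_gt0 e0 D0))[phi tphi hphi]] := in_spaceP _ _ _ (fnP v).
have [sphi _ _] := tphi.
have [w wE] : exists w : V, fn w = phi by apply: test_space; move: tphi; rewrite setC0.
rewrite -wE -hformB in hphi.
have Hb := bform_bilin oO bO; have Hh := hform_bilin oO bO.
have b0 := @bform_ge0 R n Omega oO bO.
have h0 : nonneg_on setT h by move=> u _; exact: h1form_ge0.
have vE : v = w + (v - w) by rewrite addrC subrK.
have wE2 : w = v - (v - w) by rewrite opprB addrC subrK.
have s1 : b v v <= 2 * b w w + 2 * b (v - w) (v - w).
  by have := sqD_le subspaceT Hb b0 (u := w) (v := v - w) I I; rewrite -vE.
have s2 : h w w <= 2 * h v v + 2 * h (v - w) (v - w).
  by have := sqB_le subspaceT Hh h0 (u := v) (v := v - w) I I; rewrite -wE2.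
have s3 : b w w <= eta * h w w + \sum_k dotL2 Omega w (chi k) ^+ 2.
  by rewrite /bform /hform wE; exact: H.
have s4 : \sum_k dotL2 Omega w (chi k) ^+ 2 <=
    2 * \sum_k dotL2 Omega v (chi k) ^+ 2 + 2 * (b (v - w) (v - w) * X).
  rewrite /X mulr_sumr !mulr_sumr -big_split /=; apply: ler_sum => k _.
  have := functional_le (v - w) (Lchi k).
  have -> : dotL2 Omega (fn (v - w)) (chi k) = dotL2 Omega v (chi k) - dotL2 Omega w (chi k).
    have -> : v - w = (-1) *: w + v by rewrite scaleN1r addrC.
    by rewrite functional_linear// mulN1r addrC.
  move: (dotL2 _ _ _) (dotL2 _ w _) (_ * _) => x y z xy.
  have := sqr_ge0 (2 * x - y); lra.
have s5 := b_le_h (v - w).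
have bX := ler_wpM2r X0 s5.
have eh := ler_wpM2l (ltW eta0) s2.
have hD : h (v - w) (v - w) * D <= e by rewrite -ler_pdivlMr// ltW.
exact: dense_arith s1 s3 eh s4 s5 bX hD.
Qed.

(** Rellich's estimate for smooth functions passes to the closure, and its
    functionals are represented by vectors through the energy form. *)
Lemma qform_relatively_compact : relatively_compact q b.
Proof.
move=> eta eta0.
have m0 : 0 < Num.min 1 c0 by rewrite lt_min ltr01.
have e1 : 0 < eta * Num.min 1 c0 / 4 by rewrite divr_gt0// mulr_gt0.
have [J [chi [Lchi H]]] := rellich_smooth oO bO lO e1.
have cq : complete_for q setT by rewrite -(vanishing0 oO bO); exact: (vanishing_complete mc cM c0p).
have Hq := qform_bilin oO bO mc cM c0p.
have q0 := @qform_ge0 R n Omega oO bO c c0 M mc cM c0p.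
have /choice[w hw] : forall k, exists w : V, forall v : V, dotL2 Omega v (chi k) = q w v.
  move=> k; apply: (riesz (M := dotL2 Omega (chi k) (chi k) / c0) Hq q0 cq).
  - by move=> r u v; exact: functional_linear.
  - by rewrite divr_ge0 ?dotL2_ge0// ltW.
  - move=> v; apply: le_trans (functional_le v (Lchi k)) _.
    rewrite mulrC -mulrA; apply: ler_wpM2l; first exact: dotL2_ge0.
    by rewrite ler_pdivlMl//; exact: qform_coercive.
exists [seq 2 *: w k | k <- index_enum J] => v; rewrite big_map.
have H' phi : smooth phi -> dotL2 Omega phi phi <=
    (eta * Num.min 1 c0 / 4) * h1form Omega phi phi + \sum_k dotL2 Omega phi (chi k) ^+ 2.
  by move=> sphi; rewrite h1form_smooth//; exact: H.
apply: le_trans (dense_estimate v e1 Lchi H') _; apply: lerD.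
  have -> : 4 * (eta * Num.min 1 c0 / 4) = eta * Num.min 1 c0 by field.
  by rewrite -mulrA; apply: ler_wpM2l; [exact: ltW|exact: hform_le_q].
rewrite mulr_sumr; apply: ler_sum => k _.
rewrite hw (sbilinZr Hq) (sbilinC Hq v) exprMn; apply: ler_wpM2r; first exact: sqr_ge0.
by rewrite expr2 -natrM.
Qed.

End compactness.

Section infinite_dimension.
Context {R : realType} {n : nat}.
Local Notation mu := (@lebesgue_rV R n).
Variables (Omega : set 'rV[R]_n) (oO : open Omega) (bO : bounded_set Omega).
Local Notation V := (space oO bO).
Local Notation bf := (@bform R n Omega oO bO).

Let mO : measurable Omega. Proof. exact: open_measurable_rV. Qed.

(** Cut the box into [m] slabs: the bumps supported in distinct slabs are
    orthogonal. *)
Lemma vanishing_infinite_dimensional K (a b : 'rV[R]_n) : (0 < n)%N ->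
  (forall i, a ord0 i < b ord0 i) -> cbox a b `<=` Omega -> cbox a b `<=` ~` K ->
  infinite_dimensional bf (@vanishing R n Omega oO bO K).
Proof.
move=> n0 ab abO abK m; pose i0 : 'I_n := Ordinal n0.
pose x (k : nat) := a ord0 i0 + (b ord0 i0 - a ord0 i0) * (k%:R / m%:R).
pose lo (k : 'I_m) : 'rV[R]_n := \row_i if i == i0 then x k else a ord0 i.
pose hi (k : 'I_m) : 'rV[R]_n := \row_i if i == i0 then x k.+1 else b ord0 i.
have dl : 0 < b ord0 i0 - a ord0 i0 by rewrite subr_gt0.
have m0 (k : 'I_m) : 0 < m%:R :> R by rewrite ltr0n; exact: leq_ltn_trans (ltn_ord k).
have xle (k : 'I_m) j l : (j <= l)%N -> x j <= x l.
  by move=> jl; rewrite lerD2l ler_pM2l// ler_pM2r ?invr_gt0 ?(m0 k)// ler_nat.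
have xlt (k : 'I_m) : x k < x k.+1.
  by rewrite ltrD2l ltr_pM2l// ltr_pM2r ?invr_gt0 ?(m0 k)// ltr_nat.
have x0 (k : 'I_m) : a ord0 i0 <= x k.
  by rewrite lerDl mulr_ge0 ?divr_ge0// ltW.
have x1 (k : 'I_m) : x k.+1 <= b ord0 i0.
  have : x k.+1 <= x m by exact: xle.
  by move/le_trans; apply; rewrite /x divff ?gt_eqF ?(m0 k)// mulr1 addrC subrK.
have sub k : cbox (lo k) (hi k) `<=` cbox a b.
  move=> y yk i; have := yk i; rewrite !mxE; case: eqP => // -> /andP[y1 y2].
  by rewrite (le_trans (x0 k))//= (le_trans y2).
have tb k : test_function (~` K) (bump 1 (lo k) (hi k)).
  by apply: test_bump => // y /sub; exact: abK.
have /choice[v vE] : forall k, exists v : V, fn v = bump 1 (lo k) (hi k).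
  by move=> k; exact: (H10_space oO bO (test_H10 oO bO (tb k))).
have vK k : vanishing K (v k) by rewrite /vanishing /= vE; exact: test_H10.
have ort k l : k != l -> bf (v k) (v l) = 0.
  move=> kl; rewrite /bform /dotL2; under eq_Rintegral => y _.
    have -> : v k y * v l y = 0.
      rewrite !vE; have [yk|/bump_out->] := pselect (obox (lo k) (hi k) y); last by rewrite mul0r.
      have [yl|nyl] := pselect (obox (lo l) (hi l) y); last by rewrite [X in _ * X](bump_out _ nyl) mulr0.
      have := yk i0; have := yl i0; rewrite !mxE eqxx => /andP[p1 p2] /andP[p3 p4].
      have /orP[h|h] : (k < l)%N || (l < k)%N by rewrite -neq_ltn.
        by have := xle k _ _ h => h'; have := lt_trans p1 (lt_le_trans p4 h'); rewrite ltxx.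
      by have := xle k _ _ h => h'; have := lt_trans p3 (lt_le_trans p2 h'); rewrite ltxx.
    over.
  by rewrite /Rintegral integral0.
have pos k : 0 < bf (v k) (v k).
  rewrite lt_neqAle bform_ge0// andbT eq_sym; apply/eqP => /(dotL2_eq0 mO (space_L2 (v k))).
  move=> [A [mA A0 sA]].
  have bA : obox (lo k) (hi k) `<=` A.
    move=> y yk; apply: sA => /= /(_ (abO _ (sub k _ (obox_cbox yk)))).
    by move/eqP; rewrite vE gt_eqF// bump_gt0.
  have : (mu (obox (lo k) (hi k)) <= mu A)%E.
    by apply: le_measure; rewrite ?inE//; exact: measurable_obox.
  rewrite A0 leNgt obox_gt0// => i; rewrite !mxE; case: eqP => // _; exact: xlt.
exists (fun k => (Num.sqrt (bf (v k) (v k)))^-1 *: v k); split.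
  by move=> k; apply: subspaceZ (vK k); exact: vanishing_subspace.
move=> k l; have Hb := bform_bilin oO bO.
rewrite (sbilinZl Hb) (sbilinZr Hb); have [->|kl] := eqVneq k l; last first.
  by rewrite (ort _ _ kl) !mulr0.
by rewrite mulrA -invfM -expr2 sqr_sqrtr ?mulVf// ?gt_eqF// ltW.
Qed.

End infinite_dimension.

(** * Cutting off near a set of null capacity *)

Section null_capacity.
Context {R : realType} {n : nat}.
Local Notation mu := (@lebesgue_rV R n).
Variables (Omega : set 'rV[R]_n) (oO : open Omega) (bO : bounded_set Omega).
Local Notation V := (space oO bO).

Let mO : measurable Omega. Proof. exact: open_measurable_rV. Qed.

(** A competitor [u] of small energy is close to [1 + phi] with [phi] a test
    function that vanishes near [K]; hence [w = - phi] is close to 1. *)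
Lemma null_capacity_test K : Cap Omega K = 0 -> forall e : R, 0 < e ->
  exists2 w, test_function (~` K) w & h1form Omega (cst 1 \- w) (cst 1 \- w) < e.
Proof.
move=> K0 e e0; pose A := [set sqnormH1 Omega u | u in
  [set u | H1 Omega u /\ H10 Omega K (u \- cst 1)]].
have H11 : H1 Omega (cst 1) by apply: smooth_H1 => //; exact: smooth_cst.
have hA : has_inf A.
  split.
    exists (sqnormH1 Omega (cst 1)); exists (cst 1) => //; split => //.
    rewrite (_ : _ \- _ = cst 0); first exact: H10_0.
    by apply/funext => x /=; rewrite subrr.
  by exists 0 => _ [u [Hu _] <-]; rewrite sqnormH1E// h1form_ge0.
have e4 : 0 < e / 4 by rewrite divr_gt0.
have [_ [u [Hu /(H10P oO bO)[Hu1 /(_ _ e4)[phi tphi hphi]]] <-]] := inf_adherent e4 hA.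
rewrite -/(Cap Omega K) K0 add0r sqnormH1E// => hu.
exists (cst (-1) \* phi); first exact: test_scale.
have sphi : smooth phi by case: tphi.
have Hphi := smooth_H1 oO bO sphi.
have -> : cst 1 \- (cst (-1) \* phi) = (cst (-1) \* ((u \- cst 1) \- phi)) \+ u.
  by apply/funext => x /=; ring.
apply: le_lt_trans (h1form_sq_linear oO bO (-1) (H1B oO bO Hu1 Hphi) Hu) _.
move: (h1form _ _ _) (h1form _ _ _) hu hphi => x y hx hy; rewrite expr2; lra.
Qed.

(** If [K] contained [Omega], a test function that vanishes near [K] could not
    approximate 1. *)
Lemma null_capacity_box K : closed K -> (0 < mu Omega)%E -> Cap Omega K = 0 ->
  exists a b : 'rV[R]_n, [/\ forall i, a ord0 i < b ord0 i,
    cbox a b `<=` Omega & cbox a b `<=` ~` K].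
Proof.
move=> cK mO0 K0.
have [x [Ox Kx]] : exists x, Omega x /\ ~ K x.
  apply: contrapT => nx.
  have OK : Omega `<=` K by move=> x Ox; apply: contrapT => nK; apply: nx; exists x.
  have L1 : L2 Omega (cst 1) by apply: smooth_L2 => //; exact: smooth_cst.
  have d0 : 0 < dotL2 Omega (cst 1) (cst 1).
    rewrite -lte_fin (dotL2_sqE mO L1).
    have -> : (\int[mu]_(x in Omega) (cst 1 x ^+ 2)%:E = mu Omega)%E.
      under eq_integral do rewrite /= expr1n.
      by rewrite -[RHS]mul1e; exact: integral_cst.
    exact: mO0.
  have [w [sw _ wK]] := null_capacity_test K0 d0.
  have -> : h1form Omega (cst 1 \- w) (cst 1 \- w) =
      gradform Omega (cst 1 \- w) (cst 1 \- w) + dotL2 Omega (cst 1) (cst 1).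
    rewrite /h1form; congr (_ + _); apply: eq_Rintegral => x /set_mem Ox /=.
    by rewrite (supp_out (f := w) (x := x)) ?subr0// => /wK; apply; exact: OK.
  by rewrite ltNge lerDr gradform_ge0.
have : open (Omega `&` ~` K) by apply: openI => //; exact: closed_openC.
move=> /(_ x (conj Ox Kx)) /nbhs_ballP[r /= r0 rU].
pose d := r / 2; have d0 : 0 < d by rewrite divr_gt0.
have sub : cbox (x - const_mx d) (x + const_mx d) `<=` Omega `&` ~` K.
  move=> y hy; apply: rU; rewrite mx_norm_ball /=; apply: rV_norm_lt => // i.
  have := hy i; rewrite !mxE ltr_norml => /andP[h1 h2]; rewrite /d in h1 h2.
  by apply/andP; split; lra.
exists (x - const_mx d), (x + const_mx d); split.
- by move=> i; rewrite !mxE; lra.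
- by move=> y /sub[].
- by move=> y /sub[].
Qed.

Lemma dotL2_sq_le (C : R) (u p r : 'rV[R]_n -> R) : L2 Omega u -> L2 Omega p -> L2 Omega r ->
  (forall x, Omega x -> u x ^+ 2 <= C * (p x ^+ 2 + r x ^+ 2)) ->
  dotL2 Omega u u <= C * (dotL2 Omega p p + dotL2 Omega r r).
Proof.
move=> Lu Lp Lr H; rewrite mulrDr /dotL2.
have iu := L2_mul_integrable mO Lu Lu.
have ip := L2_mul_integrable mO Lp Lp; have ir := L2_mul_integrable mO Lr Lr.
have iZ (w : 'rV[R]_n -> R) : mu.-integrable Omega (EFin \o w) ->
    mu.-integrable Omega (EFin \o (fun x => C * w x)).
  by move=> iw; rewrite /comp; under eq_fun do rewrite EFinM; exact: integrableZl.
rewrite -!RintegralZl// -RintegralD//; [|exact: iZ|exact: iZ].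
apply: le_Rintegral => //.
  exact: (@integrableD _ _ _ mu _ mO _ _ (iZ _ ip) (iZ _ ir)).
by move=> x Ox; rewrite -mulrDr -!expr2; exact: H.
Qed.

Lemma multiplier_arith (S T g G B2 m : R) :
  S <= 2 * B2 * (m * g + G) -> T <= B2 * (g + 0) -> 0 <= g -> 0 <= G -> 0 <= B2 -> 0 <= m ->
  S + T <= (2 * m + 3) * B2 * (G + g).
Proof.
move=> h1 h2 g0 G0 B0 m0.
have a := mulr_ge0 B0 g0; have b := mulr_ge0 B0 G0.
have := mulr_ge0 m0 b; lra.
Qed.

(** The function and its derivatives are bounded on a bounded domain, and the
    Leibniz rule applies. *)
Lemma smooth_multiplier phi : smooth phi -> exists2 C : R, 0 <= C &
  forall g, smooth g -> h1form Omega (phi \* g) (phi \* g) <= C * h1form Omega g g.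
Proof.
move=> sphi; have [M0 hM0] := smooth_bounded bO sphi.
have /choice[M hM] : forall i, exists M : R, forall x, Omega x -> `|pderiv i phi x| <= M.
  by move=> i; exact: (smooth_bounded bO (smooth_pderiv i sphi)).
pose B := `|M0| + \sum_i `|M i|.
have B0 : 0 <= B by rewrite addr_ge0// sumr_ge0.
have sq_le (t : R) : `|t| <= B -> t ^+ 2 <= B ^+ 2.
  by move=> tB; rewrite -real_normK ?num_real// ler_sqr ?nnegrE.
have phiB x : Omega x -> phi x ^+ 2 <= B ^+ 2.
  move=> Ox; apply: sq_le; apply: le_trans (hM0 _ Ox) _.
  by apply: le_trans (ler_norm _) _; rewrite lerDl sumr_ge0.
have dphiB i x : Omega x -> pderiv i phi x ^+ 2 <= B ^+ 2.
  move=> Ox; apply: sq_le; apply: le_trans (hM i _ Ox) _.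
  apply: le_trans (ler_norm _) _; rewrite /B (bigD1 i)//= addrCA lerDl addr_ge0//.
  exact: sumr_ge0.
exists ((2 * n%:R + 3) * B ^+ 2); first by rewrite mulr_ge0 ?sqr_ge0// addr_ge0// mulr_ge0.
move=> g sg; have spg := smoothM sphi sg.
have Lg := smooth_L2 oO bO sg; have L0 := @L2_0 R n Omega.
rewrite /h1form !gradform_smooth//.
have s1 i : dotL2 Omega (pderiv i (phi \* g)) (pderiv i (phi \* g)) <=
    2 * B ^+ 2 * (dotL2 Omega g g + dotL2 Omega (pderiv i g) (pderiv i g)).
  apply: dotL2_sq_le => //; try exact/(smooth_L2 oO bO)/smooth_pderiv.
  move=> x Ox; rewrite pderivM//=.
  have := dphiB i x Ox; have := phiB x Ox.
  move: (phi x) (pderiv i phi x) (g x) (pderiv i g x) => p dp y dy hp hdp.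
  have e1 : dp ^+ 2 * y ^+ 2 <= B ^+ 2 * y ^+ 2 by rewrite ler_wpM2r ?sqr_ge0.
  have e2 : p ^+ 2 * dy ^+ 2 <= B ^+ 2 * dy ^+ 2 by rewrite ler_wpM2r ?sqr_ge0.
  have := sqr_ge0 (dp * y - p * dy); move: (B ^+ 2) e1 e2 => B2; rewrite !expr2; lra.
have s2 : dotL2 Omega (phi \* g) (phi \* g) <= B ^+ 2 * (dotL2 Omega g g + 0).
  have -> : 0 = dotL2 Omega (cst 0) (cst 0).
    by rewrite /dotL2; under eq_Rintegral do rewrite mulr0; rewrite /Rintegral integral0.
  apply: dotL2_sq_le => //; first exact: smooth_L2.
  by move=> x Ox; rewrite /= exprMn expr0n addr0 ler_wpM2r ?sqr_ge0// phiB.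
have s3 := ler_sum (index_enum 'I_n) (fun i (_ : xpredT i) => s1 i).
rewrite -mulr_sumr big_split /= sumr_const card_ord -[_ *+ n]mulr_natl in s3.
have g0 := dotL2_ge0 Omega g.
have G0 : 0 <= \sum_(i < n) dotL2 Omega (pderiv i g) (pderiv i g).
  by apply: sumr_ge0 => i _; exact: dotL2_ge0.
have B20 := sqr_ge0 B.
have n0 : 0 <= n%:R :> R by [].
exact: multiplier_arith s3 s2 g0 G0 B20 n0.
Qed.

(** By density [v] may be taken to be a test function [phi]. Since [K] has null
    capacity, there is a function [w] that vanishes near [K] and is close to 1;
    then [w * phi] is close to [phi] and, by concentration, it vanishes near
    [K_ eps] for small [eps]. *)
Lemma vanishing_dense (K_ : R -> set 'rV[R]_n) (K : set 'rV[R]_n) (v : V) (d : R) :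
  concentrating K_ K -> Cap Omega K = 0 -> 0 < d ->
  exists2 eps0 : R, 0 < eps0 & forall eps, 0 < eps < eps0 ->
    exists2 s : V, vanishing (K_ eps) s & hform (v - s) (v - s) <= d.
Proof.
move=> KK K0 d0; have d4 : 0 < d / 4 by rewrite divr_gt0.
have /(H10P oO bO)[Hv /(_ _ d4)[phi tphi hphi]] := in_spaceP _ _ _ (fnP v).
have [sphi _ _] := tphi.
have [C C0 hC] := smooth_multiplier sphi.
have C1 : 0 < C + 1 by rewrite ltr_wpDl.
have [w tw hw] := null_capacity_test K0 (divr_gt0 d4 C1).
have [sw cw wK] := tw.
have [|x Kx /wK|eps0 eps00 hK] := KK (~` supp w).
- exact/closed_openC/closed_closure.
- by apply.
exists eps0 => // eps /hK Ksub.
have tpw : test_function (~` K_ eps) (w \* phi).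
  apply: test_mul => //; split => // x wx Kx; exact: (Ksub _ Kx).
have HK := test_H10 oO bO tpw; have [s sE] := H10_space oO bO HK.
exists s; first by rewrite /vanishing /= sE.
have s1w : smooth (cst 1 \- w).
  rewrite (_ : _ \- _ = cst 1 \+ (cst (-1) \* w)).
    by apply: smoothD; [exact: smooth_cst|exact: smoothZ].
  by apply/funext => x /=; rewrite mulN1r.
have Hp := smooth_H1 oO bO (smoothM sphi s1w).
have Hvp := H1B oO bO Hv (smooth_H1 oO bO sphi).
rewrite hformB sE (_ : fn v \- _ = (cst 1 \* (fn v \- phi)) \+ (phi \* (cst 1 \- w))); last first.
  by apply/funext => x /=; ring.
apply: le_trans (h1form_sq_linear oO bO 1 Hvp Hp) _.
have := hC _ s1w; move: hw; rewrite ltr_pdivlMr//.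
have := h1form_ge0 Omega (cst 1 \- w).
move: (h1form Omega (_ \- w) _) (h1form Omega (phi \* _) _) (h1form _ _ _) hphi => x y z hz x0 hx hy.
rewrite expr1n; lra.
Qed.

End null_capacity.

(** * Eigenvalues on the energy space *)

Section spectrum.
Context {R : realType} {n : nat}.
Local Notation mu := (@lebesgue_rV R n).
Variables (Omega : set 'rV[R]_n) (oO : open Omega) (bO : bounded_set Omega).
Local Notation V := (space oO bO).
Variables (c c' : 'rV[R]_n -> R) (c0 M : R).
Hypotheses (mc : measurable_fun setT c') (cM : forall x, c0 <= c' x <= M) (c0p : 0 < c0).
Hypothesis lO : lipschitz_boundary Omega.
Hypotheses (mcc : measurable_fun setT c) (cc : ae_eq mu Omega c c').
Local Notation bf := (@bform R n Omega oO bO).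
Local Notation qf := (@qform R n Omega oO bO c').
Local Notation vanish K := (@vanishing R n Omega oO bO K).

Let mO : measurable Omega. Proof. exact: open_measurable_rV. Qed.

(** The weak derivatives of both are fixed by the same choice, so only the
    potentials differ, on a null set. *)
Lemma q_qform (u v : V) : q c Omega u v = qf u v.
Proof.
have Lw i (w : V) : L2 Omega (wpd Omega i w) by exact: H1_wpd (space_H1 w).
have iw i : mu.-integrable Omega (EFin \o (fun x => wpd Omega i u x * wpd Omega i v x)).
  exact: L2_mul_integrable.
have [is1 is2] := Rintegral_sum (index_enum 'I_n) mO iw.
have Lcu := L2_bounded_mul oO mc cM c0p (space_L2 u).
have icu := L2_mul_integrable mO Lcu (space_L2 v).
have mu_ (w : V) : measurable_fun Omega w by exact: L2_measurable (space_L2 w).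
have md : measurable_fun Omega (dotgrad Omega u v).
  by apply/measurable_EFinP; exact: (measurable_int _ is1).
transitivity (\int[mu]_(x in Omega) (dotgrad Omega u v x + c' x * u x * v x)).
  rewrite /q /Rintegral; congr fine; apply: ae_eq_integral => //.
  - apply/measurable_EFinP; apply: measurable_funD => //; apply: measurable_funM => //.
    by apply: measurable_funM => //; exact: measurable_funTS.
  - apply/measurable_EFinP; apply: measurable_funD => //; apply: measurable_funM => //.
    by apply: measurable_funM => //; exact: measurable_funTS.
  - by apply: filterS cc => x h Ox /=; rewrite h.
rewrite RintegralD//; congr (_ + _).
exact: is2.
Qed.

Lemma bform_eq0 (u v : V) : bf (u - v) (u - v) = 0 <-> ae_eq mu Omega u v.
Proof.
have L := L2B (space_L2 u) (space_L2 v).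
rewrite /bform fnB; split=> [/(dotL2_eq0 mO L)|uv].
  by apply: filterS => x h Ox; have /= := h Ox; exact: subr0_eq.
by apply/(dotL2_eq0 mO L); apply: filterS uv => x h Ox /=; rewrite h ?subrr.
Qed.

Lemma eigenspaceP K l (u : V) :
  Defs.eigenspace c Omega K l u <-> eigenspace_in qf bf (vanish K) l u.
Proof.
split=> -[Ku h]; split => // v Kv; first by rewrite -q_qform; exact: h.
have [v' vE] := H10_space oO bO Kv; rewrite -vE q_qform; apply: h.
by rewrite /vanishing /= vE.
Qed.

Lemma has_dim_translate K l m : has_multiplicity c Omega K l m <->
  has_dim_mod bf (eigenspace_in qf bf (vanish K) l) m.
Proof.
split=> [[e [Ee ie se]]|[e [Ee ie se]]].
  have /choice[f fE] : forall i, exists f : V, fn f = e i.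
    by move=> i; have [Ke _] := Ee i; exact: (H10_space oO bO Ke).
  exists f; split.
  - by move=> i; apply/eigenspaceP; rewrite fE.
  - move=> a; rewrite -[X in bf X X]subr0 => /bform_eq0; rewrite fn_sum => h; apply: ie.
    by apply: filterS h => x h Ox; apply: etrans (h Ox); apply: eq_bigr => i _; rewrite fE.
  - move=> u /eigenspaceP /se[a ha]; exists a; apply/bform_eq0; rewrite fn_sum.
    by apply: filterS ha => x h Ox; rewrite (h Ox); apply: eq_bigr => i _; rewrite fE.
exists (fun i => fn (e i)); split.
- by move=> i; apply/eigenspaceP.
- move=> a h; apply: ie; rewrite -[X in bf X X]subr0; apply/bform_eq0.
  by rewrite fn_sum.
- move=> u Eu; have [Ku _] := Eu; have [v vE] := H10_space oO bO Ku.
  have /se[a ha] : eigenspace_in qf bf (vanish K) l v by apply/eigenspaceP; rewrite vE.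
  by exists a; move: ha; rewrite -vE => /bform_eq0; rewrite fn_sum.
Qed.

Let Hq := qform_bilin oO bO mc cM c0p.
Let Hb := bform_bilin oO bO.
Let q0 := @qform_ge0 R n Omega oO bO c' c0 M mc cM c0p.
Let b0 := @bform_ge0 R n Omega oO bO.
Let coer := @qform_coercive R n Omega oO bO c' c0 M mc cM c0p.
Let comp := @qform_relatively_compact R n Omega oO bO c' c0 M mc cM c0p lO.

Lemma eigenbasis_sequence K e lam : eigenbasis qf bf (vanish K) e lam ->
  eigenvalue_sequence c Omega K lam.
Proof.
move=> Ee; split.
- by move=> i; have := eigenvalue_gt0 c0p coer Ee i.
- by move=> i j ij; exact: (eigenvalue_le Ee ij).
- apply/cvgryPge => A; have [N hN] := eigenvalue_unbounded Hq q0 c0p coer Ee A comp.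
  exists N => // k /= Nk; apply: le_trans (ltW hN) _; exact: (eigenvalue_le Ee Nk).
- move=> l.
  have [m hm cm] := eigenspace_dim Hq Hb q0 b0 c0p coer comp l (vanishing_subspace oO bO K) Ee.
  by exists m => //; apply/has_dim_translate.
Qed.

(** The multiplicities determine a nondecreasing list, and the dimension of an
    eigenspace is unique. *)
Lemma lambda_eigenbasis K e lam k : eigenbasis qf bf (vanish K) e lam ->
  lambda c Omega K k = lam k.-1.
Proof.
move=> Ee; have Sl := eigenbasis_sequence Ee.
have := @xgetPex _ (cst 0) (eigenvalue_sequence c Omega K) (ex_intro _ lam Sl).
rewrite /lambda; move: (xget _ _) => lam' [_ nd' _ h'].
have [_ nd _ h] := Sl.
apply: (nondecreasing_card_eq nd' nd) => l.
have [m hm cm] := h l; have [m' hm' cm'] := h' l; exists m; split => //.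
have /has_dim_translate d := hm; have /has_dim_translate d' := hm'.
by rewrite (has_dim_mod_unique Hb b0 d d').
Qed.

(** The competitors of the capacity are the functions [u - p'] with [p'] in the
    subspace, and the nearest point is the projection. *)
Lemma Capc_projection K (u p : V) : vanish K p ->
  (forall t, vanish K t -> qf (u - p) t = 0) -> Capc c Omega K u = qf (u - p) (u - p).
Proof.
move=> Kp h; pose A := [set q c Omega w w | w in [set w | H1 Omega w /\ H10 Omega K (w \- fn u)]].
have Ap : A (qf (u - p) (u - p)).
  exists (fn (u - p)); last exact: q_qform.
  split; first exact: space_H1.
  rewrite (_ : _ \- _ = fn (- p)); last first.
    apply/funext => x; rewrite -[LHS]/(fn u x - fn p x - fn u x) -[RHS]/(- fn p x); ring.
  exact: (subspaceN (vanishing_subspace oO bO K) Kp).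
have lbA : lbound A (qf (u - p) (u - p)).
  move=> _ [w [Hw Kw] <-]; have [s sE] := H10_space oO bO Kw.
  have -> : w = fn (u - (- s)).
    by rewrite opprK; apply/funext => x; rewrite -[RHS]/(fn u x + fn s x) sE /=; ring.
  rewrite q_qform; apply: (projection_nearest Hq q0 (vanishing_subspace oO bO K) Kp _ h).
  by apply: subspaceN (vanishing_subspace oO bO K) _; rewrite /vanishing /= sE.
apply/eqP; rewrite eq_le; apply/andP; split.
  by apply: ge_inf => //; exists (qf (u - p) (u - p)).
by apply: lb_le_inf => //; exists (qf (u - p) (u - p)).
Qed.

Lemma vanishing_dense_all (K_ : R -> set 'rV[R]_n) (K : set 'rV[R]_n) (W : seq V) (d : R) :
  concentrating K_ K -> Cap Omega K = 0 -> 0 < d ->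
  \forall eps \near 0^'+, forall w, w \in W ->
    exists2 s : V, vanish (K_ eps) s & qf (w - s) (w - s) <= d.
Proof.
move=> KK K0 d0; elim: W => [|w W IH]; first by near=> eps.
have M1 : 0 < 1 + M.
  by have /andP[h1 h2] := cM 0; rewrite ltr_pwDl// (le_trans (ltW c0p))// (le_trans h1).
have [e0 e00 he] := vanishing_dense w KK K0 (divr_gt0 d0 M1).
near=> eps => v; rewrite inE => /predU1P[->|vW]; last by move: v vW; near: eps.
have [|s Ks hs] := he eps.
  by apply/andP; split; near: eps; [exact: nbhs_right_gt|exact: nbhs_right_lt].
exists s => //; apply: le_trans (q_le_hform mc cM c0p _) _.
by rewrite -ler_pdivlMl// mulrC.
Unshelve. all: by end_near. Qed.

End spectrum.

(** * Asymptotics of a simple eigenvalue *)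

Theorem theorem2p5 (R : realType) (N : nat) (Omega : set 'rV[R]_N)
    (c : 'rV[R]_N -> R) (c0 : R) (K_ : R -> set 'rV[R]_N) (K : set 'rV[R]_N)
    (n0 : nat) (phi0 : 'rV[R]_N -> R) :
  (2 <= N)%N ->
  open Omega -> bounded_set Omega -> connected Omega ->
  lipschitz_boundary Omega ->
  c \in Lfun (lebesgue_rV N) +oo%E ->
  0 < c0 -> {ae lebesgue_rV N, forall x, c0 <= c x} ->
  (forall eps, 0 < eps -> compact (K_ eps) /\ K_ eps `<=` closure Omega) ->
  compact K -> K `<=` closure Omega ->
  concentrating K_ K ->
  Cap Omega K = 0 ->
  (1 <= n0)%N ->
  simple_eigenvalue c Omega set0 (lambda c Omega set0 n0) ->
  eigenfunction c Omega set0 (lambda c Omega set0 n0) phi0 ->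
  dotL2 Omega phi0 phi0 = 1 ->
  (fun eps => lambda c Omega (K_ eps) n0 - lambda c Omega set0 n0) =
    (fun eps => Capc c Omega (K_ eps) phi0)
    +o_ (0^'+) (fun eps => Capc c Omega (K_ eps) phi0).
Proof.
move=> N2 oO bO _ lO cL c0p cc0 _ cK _ KK K0 n01 simple [eigphi _] norm_phi.
have mO : measurable Omega by exact: open_measurable_rV.
have [Kphi qphi] := eigphi.
have [phi phiE] := H10_space oO bO Kphi.
have mO0 : (0 < @lebesgue_rV R N Omega)%E.
  rewrite lt_neqAle measure_ge0 andbT eq_sym; apply/eqP => O0.
  have : dotL2 Omega phi0 phi0 = 0.
    apply/(dotL2_eq0 mO); first by rewrite -phiE; exact: space_L2.
    by exists Omega; split => // x /= h; apply: contrapT => nO; apply: h.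
  by rewrite norm_phi => /eqP; rewrite oner_eq0.
have mT0 : (0 < @lebesgue_rV R N setT)%E.
  apply: (lt_le_trans mO0); apply: le_measure; rewrite ?inE//.
have [c' [M [mc cM cc]]] := bounded_representative Omega cL cc0 mT0.
have mcc : measurable_fun setT c by move: cL; rewrite inE => /andP[]; rewrite inE.
have Np : (0 < N)%N by exact: ltnW.
(* bumps in a box off [K], hence off [K_ eps] for small [eps], make the spaces infinite dimensional *)
have [a [b [ab abO abK]]] := null_capacity_box oO bO (compact_closed (@norm_hausdorff _ _) cK) mO0 K0.
pose q := @qform R N Omega oO bO c'; pose bf := @bform R N Omega oO bO.
have Hq : sbilin q by exact: (qform_bilin oO bO mc cM c0p).
have Hb : sbilin bf := bform_bilin oO bO.
have q0 : nonneg_on setT q := @qform_ge0 R N Omega oO bO c' c0 M mc cM c0p.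
have b0 : nonneg_on setT bf := @bform_ge0 R N Omega oO bO.
have coer : forall v, c0 * bf v v <= q v v := @qform_coercive R N Omega oO bO c' c0 M mc cM c0p.
have comp : relatively_compact q bf :=
  @qform_relatively_compact R N Omega oO bO c' c0 M mc cM c0p lO.
have sub K' := @vanishing_subspace R N Omega oO bO K'.
have compl K' : complete_for q (@vanishing R N Omega oO bO K').
  exact: (@vanishing_complete R N Omega oO bO c' c0 M mc cM c0p K').
have basis K' : cbox a b `<=` ~` K' -> exists e lam, eigenbasis q bf (@vanishing R N Omega oO bO K') e lam.
  move=> abK'; apply: (eigenbasis_exists Hq Hb q0 b0 c0p coer comp (sub K') (compl K')).
  exact: (vanishing_infinite_dimensional oO bO Np ab abO abK').
have [|f [mu Ef]] := basis set0; first by rewrite setC0.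
set k := n0.-1.
have lE K' e lam : eigenbasis q bf (@vanishing R N Omega oO bO K') e lam ->
    lambda c Omega K' n0 = lam k.
  exact: (lambda_eigenbasis mc cM c0p lO mcc cc).
have l0 := lE _ _ _ Ef.
rewrite l0 in simple qphi.
have [m hm cm] := eigenspace_dim Hq Hb q0 b0 c0p coer comp (mu k) (sub set0) Ef.
have m1 : m = 1%N.
  have /(has_dim_translate oO bO mc cM c0p mcc cc) d1 := simple.
  exact: (has_dim_mod_unique Hb b0 hm d1).
have uniq_k j : mu j = mu k -> j = k.
  by move=> jE; rewrite m1 in cm; exact: (card_eq1_unique cm).
have lt_k j : (j < k)%N -> mu j < mu k.
  move=> jk; rewrite lt_neqAle (eigenvalue_le Ef (ltnW jk)) andbT.
  by apply/eqP => /uniq_k jE; rewrite jE ltnn in jk.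
have k_lt : mu k < mu k.+1.
  rewrite lt_neqAle (eigenvalue_le Ef (leqnSn k)) andbT.
  by apply/eqP => /esym/uniq_k/eqP; rewrite eqn_leq ltnn.
have qphi' v : q phi v = mu k * bf phi v.
  apply: etrans (esym (q_qform mc cM c0p mcc cc phi v)) _.
  rewrite phiE (qphi _ (in_spaceP _ _ _ (fnP v))).
  by rewrite /bf /bform phiE.
have bphi : bf phi phi = 1 by rewrite /bf /bform phiE.
rewrite vanishing0 in Ef.
apply/eqaddoP => eta eta0.
have [d d0 [W HW]] := eigenvalue_expansion Hq Hb q0 b0 c0p coer comp Ef lt_k k_lt qphi' bphi eta0.
have [|x Kx /abK|e0 e00 he0] := KK (~` cbox a b).
- exact/closed_openC/cbox_closed.
- by apply.
have dense := vanishing_dense_all mc cM c0p W KK K0 d0.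
near=> eps.
have [|e [lam Ee]] := basis (K_ eps).
  have /he0 h : 0 < eps < e0.
    by apply/andP; split; near: eps; [exact: nbhs_right_gt|exact: nbhs_right_lt].
  by move=> x abx Kx; exact: (h _ Kx).
have [p Kp qp] := orthogonal_projection subspaceT Hq q0 (f := phi) (sub (K_ eps))
  (@subsetT _ _) (compl (K_ eps)) I.
have CE : Capc c Omega (K_ eps) phi0 = q (phi - p) (phi - p).
  by rewrite -phiE; exact: (Capc_projection mc cM c0p mcc cc Kp qp).
rewrite -[X in `|X| <= _]/(lambda c Omega (K_ eps) n0 - lambda c Omega set0 n0 -
  Capc c Omega (K_ eps) phi0) (lE _ _ _ Ee) l0 CE.
rewrite [X in _ <= _ * X]ger0_norm; last exact: q0.
apply: (HW _ _ _ _ (sub (K_ eps)) (compl (K_ eps)) _ Ee Kp qp).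
near: eps; exact: dense.
Unshelve. all: by end_near. Qed.
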